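(* Let $\omega\in[0,1)$, $\nu>0$, $\beta>0$, $p\in H$. Assume that for $i=1,2$: $\mu_i\in C^1(0,\infty)\cap L^1(0,\infty)\cap C[0,\infty)$, $\mu_i\ge 0$, $\mu_i\not\equiv 0$, $\mu_i'(s)+\delta_i\mu_i(s)\le 0$ for $s>0$ with some $\delta_i>0$; and that $M\in C^2([0,\infty))$ with $\mathcal M(z)=\int_0^zM(\xi)\,d\xi\ge -az-b$ for $z\ge0$, for some $a\in(0,\lambda_1)$, $b\in\mathbb R$. Let $U_0=(u_0;w_0;v_0;\overline\eta_0;\eta_0)\in D(\mathcal L)$ and suppose moreover that the function $u_0(t):=u_0-\overline\eta_0(t)$, $t\ge 0$, satisfies $u_0(\cdot)\in L^\infty(0,+\infty;F_{3/2})$. Then the first component $u$ of the classical solution of $\dot U=\mathcal LU+f(U)$, $U(0)=U_0$, satisfies $$u\in C([0,+\infty);F_{3/2}).$$ Hence, if moreover $H=L^2(\Omega)$, $A=-\Delta$, $D(A)=H^2(\Omega)\cap H^1_0(\Omega)$, where $\Omega\subset\mathbb R^2$ is a bounded domain with smooth or rectangular boundary, then $\Delta u(t,\mathbf x)=0$ for $\mathbf x\in\partial\Omega$, $t\ge0$.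
   Context: $H$ is a real separable Hilbert space with inner product $(\cdot,\cdot)$ and norm $\|\cdot\|$; $A$ is a positive self-adjoint operator on $D(A)\subset H$ with an orthonormal eigenbasis $\{e_k\}$, $Ae_k=\lambda_ke_k$, $0<\lambda_1\le\lambda_2\le\dots$, $\lambda_k\to\infty$. $F_s=D(A^s)$ with norm $\|v\|_s=\|A^sv\|$ (for $s<0$ the corresponding completion of $H$), so $F_0=H$. Phase space: $\mathcal H=F_1\times F_0\times F_0\times L^2_{\mu_1}(\mathbb R_+;F_1)\times L^2_{\mu_2}(\mathbb R_+;F_{1/2})$, $\mathbb R_+=(0,\infty)$, where $\|\overline\eta\|^2_{L^2_{\mu_1}(\mathbb R_+;F_1)}=\int_0^\infty\mu_1(s)\|\overline\eta(s)\|_1^2ds$ and $\|\eta\|^2_{L^2_{\mu_2}(\mathbb R_+;F_{1/2})}=\int_0^\infty\mu_2(s)\|\eta(s)\|_{1/2}^2ds$. Operators: $\overline T\,\overline\eta=-\overline\eta_s$, $D(\overline T)=\{\overline\eta\in L^2_{\mu_1}(\mathbb R_+;F_1):\overline\eta_s\in L^2_{\mu_1}(\mathbb R_+;F_1),\overline\eta(0)=0\}$; $T\eta=-\eta_s$, $D(T)=\{\eta\in L^2_{\mu_2}(\mathbb R_+;F_{1/2}):\eta_s\in L^2_{\mu_2}(\mathbb R_+;F_{1/2}),\eta(0)=0\}$. For $U=(u;w;v;\overline\eta;\eta)$, $$\mathcal LU=\Big(w;\ -\beta A^2u-\int_0^\infty\mu_1(s)A^2\overline\eta(s)ds+\nu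 Av;\ -\omega Av-\int_0^\infty\mu_2(s)A\eta(s)ds-\nu Aw;\ \overline T\,\overline\eta+w;\ T\eta+v\Big),$$ with $D(\mathcal L)$ the set of $U\in\mathcal H$ such that $\overline\eta\in D(\overline T)$, $\eta\in D(T)$, $w\in F_1$, $v\in F_{1/2}$, $\beta A^2u+\int_0^\infty\mu_1(s)A^2\overline\eta(s)ds-\nu Av\in F_0$, $\omega Av+\int_0^\infty\mu_2(s)A\eta(s)ds\in F_0$. Let $f(U)=(0;\,-M(\|A^{1/2}u\|^2)Au+p;\,0;\,0;\,0)$. A classical solution is a continuously differentiable $\mathcal H$-valued function $U(t)=(u(t);u_t(t);v(t);\overline\eta^t;\eta^t)$ with values in $D(\mathcal L)$ satisfying $\dot U=\mathcal LU+f(U)$, $U(0)=U_0$; under the stated assumptions it exists and is unique on $[0,\infty)$ for every $U_0\in D(\mathcal L)$. *)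

(* Defs.v *)
From HB Require Import structures.
From mathcomp Require Import all_boot all_order all_algebra.
From mathcomp Require Import all_classical all_reals all_analysis.

Set Implicit Arguments.
Unset Strict Implicit.
Unset Printing Implicit Defensive.

Import Order.TTheory GRing.Theory Num.Theory.
Import numFieldNormedType.Exports.

Local Open Scope classical_set_scope.
Local Open Scope ring_scope.

Section Calculus.
Context {R : realType}.

(* [f] has derivative [g] on [0, +oo[, one-sided at 0. *)
Definition has_deriv_halfline (f g : R -> R) : Prop :=
  forall x, 0 <= x ->
    h^-1 * (f (x + h) - f x) @[h --> within [set h | 0 <= x + h] 0^'] --> g x.

Definition C2_halfline (f : R -> R) : Prop :=
  exists f1 f2 : R -> R,
    [/\ has_deriv_halfline f f1, has_deriv_halfline f1 f2
      & {within `[0, +oo[, continuous f2}].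

Definition memory_kernel (mu : R -> R) (delta : R) : Prop :=
  [/\ {within `[0, +oo[, continuous mu},
      (forall s, 0 < s -> derivable mu s 1),
      {within `]0, +oo[, continuous (derive1 mu)} &
      [/\ (@lebesgue_measure R).-integrable `]0, +oo[ (EFin \o mu),
          (forall s, 0 <= s -> 0 <= mu s),
          (exists2 s, 0 <= s & mu s != 0),
          0 < delta
        & (forall s, 0 < s -> derive1 mu s + delta * mu s <= 0)]].

End Calculus.

Section Operator.
Context {R : realType} {H : completeNormedModType R}.

(* [dot] makes the Banach space [H] a real Hilbert space. *)
Definition hilbert_dot (dot : H -> H -> R) : Prop :=
  [/\ (forall x y, dot x y = dot y x),
      (forall a x y z, dot (a *: x + y) z = a * dot x z + dot y z)
    & (forall x, dot x x = `|x| ^+ 2)].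

(* [A] is an unbounded operator with domain [DA]; its values outside [DA] are
   irrelevant.  The last conjunct is D(A^* ) = D(A). *)
Definition positive_selfadjoint (dot : H -> H -> R) (DA : set H) (A : H -> H)
    : Prop :=
  [/\ DA 0,
      (forall a x y, DA x -> DA y ->
         DA (a *: x + y) /\ A (a *: x + y) = a *: A x + A y),
      closure DA = setT,
      (forall x, DA x -> x != 0 -> 0 < dot (A x) x) &
      (forall x y, (forall z, DA z -> dot (A z) x = dot z y) <->
                   (DA x /\ A x = y))].

(* The index is shifted by one: [lam 0] is lambda_1.  The basis is countable,
   so [H] is separable. *)
Definition orthonormal_eigenbasis (dot : H -> H -> R) (DA : set H) (A : H -> H)
    (lam : R^nat) (e : nat -> H) : Prop :=
  [/\ (forall i j, dot (e i) (e j) = (i == j)%:R),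
      (forall x, series (fun k => dot x (e k) *: e k) @ \oo --> x),
      (forall k, DA (e k) /\ A (e k) = lam k *: e k),
      0 < lam 0%N &
      (forall k, lam k <= lam k.+1) /\ lam @ \oo --> +oo].

Variables (dot : H -> H -> R) (lam : R^nat) (e : nat -> H).

Definition pow_series (r : R) (v : H) : nat -> H :=
  series (fun k => (lam k `^ r * dot v (e k)) *: e k).

(* For r >= 0, [Fsp r] is F_r = D(A^r) and [Apow r] is A^r on it. *)
Definition Fsp (r : R) : set H := [set v | cvgn (pow_series r v)].
Definition Apow (r : R) (v : H) : H := limn (pow_series r v).
Definition Fnorm (r : R) (v : H) : \bar R :=
  if `[< Fsp r v >] then (`|Apow r v|)%:E else +oo%E.

(* Elements of the whole scale F_r, r real, as sequences of coefficients in the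
   eigenbasis; for r < 0 this is the completion of H under |A^r v|, in which [H]
   embeds through [coef]. *)
Definition coef (v : H) : nat -> R := fun k => dot v (e k).
Definition Fgen (r : R) : set (nat -> R) :=
  [set c | cvgn (series (fun k => (lam k `^ r * c k) ^+ 2))].
Definition Agen (r : R) (c : nat -> R) : nat -> R := fun k => lam k `^ r * c k.
(* Inverse of [coef] on [Fgen 0]. *)
Definition of_coef (c : nat -> R) : H := limn (series (fun k => c k *: e k)).

(* int_0^oo mu(s) c(s) ds in the scale: coefficients are continuous
   functionals, so they commute with the Bochner integral. *)
Definition mem_integral (mu : R -> R) (c : R -> nat -> R) : nat -> R :=
  fun k => \int[lebesgue_measure]_(s in `]0, +oo[) (mu s * c s k).

(* [H] is separable, so Borel and strong measurability agree, and likewise for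
   functions with values in F_r. *)
Definition measurable_half (eta : R -> H) : Prop :=
  measurable_fun (`]0%R, +oo[ : set (measurableTypeR R))
    (eta : R -> g_sigma_algebraType (@open H)).

(* Elements of L^2_mu(R_+; F_r) are given by representatives R -> H, identified
   when the seminorm of their difference vanishes; values outside F_r count as
   having infinite norm, and 0 * +oo = 0 where mu vanishes. *)
Definition mem_norm2 (mu : R -> R) (r : R) (eta : R -> H) : \bar R :=
  (\int[lebesgue_measure]_(s in `]0%R, +oo[) ((mu s)%:E * Fnorm r (eta s) ^+ 2))%E.

Definition L2mem (mu : R -> R) (r : R) : set (R -> H) :=
  [set eta | measurable_half eta /\ (mem_norm2 mu r eta < +oo)%E].

(* eta is (a.e. equal to) the absolutely continuous function with eta(0) = h and
   eta_s = xi, i.e. eta(s) = h + int_0^s xi.  This is required where mu > 0, the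
   rest being invisible in L^2_mu; a kernel being nonincreasing, mu is bounded
   below on ]0, s[ when mu s > 0, so xi is integrable there. *)
Definition has_primitive (mu : R -> R) (h : H) (eta xi : R -> H) : Prop :=
  {ae @lebesgue_measure R, forall s, 0 < s -> 0 < mu s -> forall k,
    coef (eta s) k =
    coef h k + \int[lebesgue_measure]_(r in `]0, s[) coef (xi r) k}.

Definition mem_deriv_spec (mu : R -> R) (r : R) (eta : R -> H) : set (R -> H) :=
  [set xi | L2mem mu r xi /\ has_primitive mu 0 eta xi].

Definition domT (mu : R -> R) (r : R) : set (R -> H) :=
  [set eta | L2mem mu r eta /\ exists xi, mem_deriv_spec mu r eta xi].

(* T eta = - eta_s; the derivative is unique as an element of L^2_mu(R_+; F_r),
   a representative is chosen. *)
Definition Top (mu : R -> R) (r : R) (eta : R -> H) : R -> H :=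
  - xget 0 (mem_deriv_spec mu r eta).

(* (u; w; v; etabar; eta) *)
Definition state : Type := (H * H * H * (R -> H) * (R -> H))%type.

Variables (omega nu beta : R) (p : H) (M mu1 mu2 : R -> R).

Definition phase_space : set state :=
  [set U | let: (u, w, v, etab, eta) := U in
     [/\ Fsp 1 u, L2mem mu1 1 etab & L2mem mu2 2^-1 eta]].

Definition phase_norm (U : state) : \bar R :=
  let: (u, w, v, etab, eta) := U in
  sqrte (Fnorm 1 u ^+ 2 + (`|w| ^+ 2)%:E + (`|v| ^+ 2)%:E
         + mem_norm2 mu1 1 etab + mem_norm2 mu2 2^-1 eta)%E.

(* beta A^2 u + int mu1 A^2 etabar - nu A v *)
Definition mech_expr (u v : H) (etab : R -> H) : nat -> R :=
  beta *: Agen 2 (coef u)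
  + mem_integral mu1 (fun s => Agen 2 (coef (etab s)))
  - nu *: Agen 1 (coef v).

(* omega A v + int mu2 A eta *)
Definition heat_expr (v : H) (eta : R -> H) : nat -> R :=
  omega *: Agen 1 (coef v) + mem_integral mu2 (fun s => Agen 1 (coef (eta s))).

Definition domL : set state :=
  [set U | phase_space U /\
     let: (u, w, v, etab, eta) := U in
     [/\ domT mu1 1 etab /\ domT mu2 2^-1 eta,
         Fsp 1 w, Fsp 2^-1 v,
         Fgen 0 (mech_expr u v etab)
       & Fgen 0 (heat_expr v eta)]].

Definition Lop (U : state) : state :=
  let: (u, w, v, etab, eta) := U in
  (w,
   of_coef (- mech_expr u v etab),
   of_coef (- heat_expr v eta) - nu *: Apow 1 w,
   Top mu1 1 etab + cst w,
   Top mu2 2^-1 eta + cst v).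

Definition forcing (A : H -> H) (U : state) : state :=
  let: (u, w, v, etab, eta) := U in
  (0, - (M (`|Apow 2^-1 u| ^+ 2) *: A u) + p, 0, 0, 0).

(* [dU] is the continuous derivative of [U] on [0, +oo[ in the phase space. *)
Definition C1_phase (U dU : R -> state) : Prop :=
  [/\ (forall t, 0 <= t -> phase_space (U t) /\ phase_space (dU t)),
      (forall t, 0 <= t ->
         phase_norm (h^-1 *: (U (t + h) - U t) - dU t)
           @[h --> within [set h | 0 <= t + h] 0^'] --> 0%E)
    & (forall t, 0 <= t ->
         phase_norm (dU t' - dU t)
           @[t' --> within [set t' | 0 <= t'] (nbhs t)] --> 0%E)].

Definition classical_solution (A : H -> H) (U0 : state) (U : R -> state)
    : Prop :=
  exists dU : R -> state,
    [/\ C1_phase U dU,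
        (forall t, 0 <= t -> domL (U t)),
        (forall t, 0 <= t ->
           phase_norm (dU t - (Lop (U t) + forcing A (U t))) = 0%E)
      & phase_norm (U 0 - U0) = 0%E].

Definition comp_u (U : state) : H := U.1.1.1.1.
Definition comp_etabar (U : state) : R -> H := U.1.2.

(* L^oo(0, +oo; F_r) *)
Definition Linfty_F (r : R) (g : R -> H) : Prop :=
  measurable_half g /\
  exists C : R, {ae @lebesgue_measure R, forall s, 0 < s ->
                   (Fnorm r (g s) <= C%:E)%E}.

(* C([0, +oo); F_r) *)
Definition continuous_F (r : R) (g : R -> H) : Prop :=
  forall t, 0 <= t -> Fsp r (g t) /\
    Fnorm r (g t' - g t) @[t' --> within [set t' | 0 <= t'] (nbhs t)] --> 0%E.

End Operator.

Section Plane.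
Context {R : realType}.
Local Notation plane := (R * R)%type.

Definition area := (@lebesgue_measure R \x @lebesgue_measure R)%E.

(* partial derivative in the first ([false]) or second ([true]) variable *)
Definition pd (i : bool) (f : plane -> R) (x : plane) : R :=
  'D_(if i then (0, 1) else (1, 0)) f x.

(* C^oo(R^2): all iterated partial derivatives are differentiable. *)
Definition smooth (f : plane -> R) : Prop :=
  forall (s : seq bool) (x : plane), differentiable (foldr pd f s) x.

Definition test_fun (Omega : set plane) : set (plane -> R) :=
  [set phi | smooth phi /\ exists K : set plane,
     [/\ compact K, K `<=` Omega & forall x, ~ K x -> phi x = 0]].

Variable Omega : set plane.

Definition bdry : set plane := closure Omega `\` interior Omega.

Definition bounded_domain : Prop :=
  [/\ open Omega, connected Omega, Omega !=set0 & bounded_set Omega].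

(* Near each of its points the boundary is a regular level set of a smooth
   function, with Omega on one side. *)
Definition smooth_boundary : Prop :=
  forall x, bdry x -> exists W : set plane, exists rho : plane -> R,
    [/\ nbhs x W, smooth rho,
        (exists i, pd i rho x != 0)
      & forall y, W y -> (Omega y <-> rho y < 0)].

(* Open rectangle, in any position in the plane. *)
Definition rectangular_boundary : Prop :=
  exists (o : plane) (c s l1 l2 : R),
    [/\ c ^+ 2 + s ^+ 2 = 1, 0 < l1, 0 < l2 &
        Omega = [set x | exists a b : R, [/\ 0 < a < l1, 0 < b < l2,
                  x.1 = o.1 + a * c - b * s & x.2 = o.2 + a * s + b * c]]].

Definition L2norm2 (f : plane -> R) : \bar R :=
  (\int[area]_(x in Omega) ((f x) ^+ 2)%:E)%E.

Definition L2 : set (plane -> R) :=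
  [set f | measurable_fun Omega f /\ (L2norm2 f < +oo)%E].

Definition weak_pd (i : bool) (f g : plane -> R) : Prop :=
  forall phi, test_fun Omega phi ->
    \int[area]_(x in Omega) (f x * pd i phi x)
    = - \int[area]_(x in Omega) (g x * phi x).

Definition H1 : set (plane -> R) :=
  [set f | L2 f /\ forall i, exists2 g, L2 g & weak_pd i f g].

Definition H2 : set (plane -> R) :=
  [set f | L2 f /\ forall i, exists2 g, H1 g & weak_pd i f g].

(* Convergence in H^1(Omega) of restrictions of smooth functions. *)
Definition cvg_H1 (phi : nat -> plane -> R) (f : plane -> R) : Prop :=
  [/\ L2 f, L2norm2 (phi n \- f) @[n --> \oo] --> 0%E
    & forall i, exists g, [/\ L2 g, weak_pd i f g
        & L2norm2 (pd i (phi n) \- g) @[n --> \oo] --> 0%E]].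

(* closure of C_c^oo(Omega) in H^1(Omega) *)
Definition H10 : set (plane -> R) :=
  [set f | exists phi, (forall n, test_fun Omega (phi n)) /\ cvg_H1 phi f].

Definition weak_laplacian (f g : plane -> R) : Prop :=
  forall phi, test_fun Omega phi ->
    \int[area]_(x in Omega)
      (f x * (pd false (pd false phi) x + pd true (pd true phi) x))
    = \int[area]_(x in Omega) (g x * phi x).

(* Euclidean diameter; 0 for the empty set *)
Definition diam (S : set plane) : \bar R :=
  ereal_sup ([set 0%E] `|` [set r | exists x y, [/\ S x, S y &
    r = (Num.sqrt ((x.1 - y.1) ^+ 2 + (x.2 - y.2) ^+ 2))%:E]]).

(* One-dimensional Hausdorff measure (arc length). *)
Definition hausdorff1 (S : set plane) : \bar R :=
  ereal_sup [set ereal_inf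
      [set (\sum_(k <oo) diam (F k))%E
        | F in [set F : nat -> set plane |
                 S `<=` \bigcup_k F k /\ forall k, (diam (F k) <= d%:E)%E]]
    | d in [set d : R | 0 < d]].

(* The trace of g in H^1(Omega) on the boundary is h: the trace operator is the
   closure, from H^1(Omega) to L^2 of the boundary for arc length, of the
   restriction of functions smooth up to the boundary. *)
Definition has_trace (g h : plane -> R) : Prop :=
  exists phi : nat -> plane -> R,
    [/\ (forall n, smooth (phi n)), cvg_H1 phi g &
        (\int[hausdorff1]_(x in bdry) ((phi n x - h x) ^+ 2)%:E)%E
          @[n --> \oo] --> 0%E].

Context {H : completeNormedModType R}.

(* H = L^2(Omega): [iota] picks representatives of an isometric isomorphism. *)
Definition is_L2_space (dot : H -> H -> R) (iota : H -> plane -> R) : Prop :=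
  [/\ (forall h, L2 (iota h)),
      (forall a h g, {ae area, forall x, Omega x ->
         iota (a *: h + g) x = a * iota h x + iota g x}),
      (forall h g, \int[area]_(x in Omega) (iota h x * iota g x) = dot h g)
    & (forall f, L2 f -> exists h,
         {ae area, forall x, Omega x -> iota h x = f x})].

(* A = - Delta with D(A) = H^2 /\ H^1_0 *)
Definition is_dirichlet_laplacian (iota : H -> plane -> R) (DA : set H)
    (A : H -> H) : Prop :=
  (forall h, DA h <-> H2 (iota h) /\ H10 (iota h)) /\
  (forall h, DA h -> weak_laplacian (iota h) (fun x => - iota (A h) x)).

End Plane.

(* Main.v *)
Require Import Defs.
From HB Require Import structures.
From mathcomp Require Import all_boot all_order all_algebra.
From mathcomp Require Import all_classical all_reals all_analysis.
From mathcomp Require Import measurable_realfun ring lra.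
Import Order.TTheory GRing.Theory Num.Theory.
Import numFieldNormedType.Exports.
Local Open Scope classical_set_scope.
Local Open Scope ring_scope.

Set Implicit Arguments.
Unset Strict Implicit.
Unset Printing Implicit Defensive.

(** Why the theorem is true.

    Applying [A^(-1/2)] to the second equation of the system, and writing
    [kappa] for the mass of [mu1], the formula
    [etabar^t(s) = u(t) - u(t - s)] turns the memory term into a convolution:
    [(beta + kappa) A^(3/2) u(t) = int_0^t mu1(s) A^(3/2) u(t - s) ds + h(t)],
    where [h] gathers [A^(-1/2)] of the mechanical expression of the domain,
    [nu A^(1/2) v], and the contribution of the history before time 0, which
    only sees [A^(3/2) (u_0 - etabar_0)].  The kernel of this Volterra equation
    has mass at most [kappa < beta + kappa], so continuity of [h] in [H] passes
    to [A^(3/2) u].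

    The argument is carried out on Fourier coefficients in the eigenbasis, where
    every unknown is a scalar function of time, and continuity with values in a
    space of sequences means: each coefficient is continuous, and the tails of
    the sums of squares are small uniformly on compact time intervals.

    - [memory_representation] is the formula for the history, mode by mode.  The
      history solves a transport equation whose integral over [0, s] is smooth
      along the characteristics ([flow_balance]).

    - [volterra_estimate] replaces the Volterra theory by a maximum principle:
      at a time where the partial sum of [lam k ^ 3 * u_k ^ 2] is maximal, the
      memory term can only lose what comes from the initial history.

    - The right-hand side has uniformly small tails: the mechanical expression
      because the equation expresses it through the acceleration, [u] in [F_1]
      and [p]; the velocity [v] in [F_(1/2)] because [source_bound] recovers it
      from the second history and its time derivative, for every [omega]; the
      initial history because [mu1] is nonincreasing
      ([translated_memory_le]).  Compactness makes tails uniform in time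
      ([uniform_tails]).

    For the second assertion, [- A u(t)] belongs to [F_(1/2)], the form domain
    of the Dirichlet Laplacian.  By Green's formula ([H10_gradient_green]) the
    gradients of the partial sums of its eigenfunction expansion are Cauchy in
    [L^2], so it is a limit in [H^1] of test functions, and those vanish on the
    boundary: [laplacian_trace]. *)

(** * Fourier coefficients in a Hilbert space *)

Section Hilbert.
Context {R : realType} {H : completeNormedModType R}.
Variables (dot : H -> H -> R).
Hypothesis hdot : hilbert_dot dot.

Lemma dotC x y : dot x y = dot y x.
Proof. by case: hdot. Qed.

Lemma dotxx x : dot x x = `|x| ^+ 2.
Proof. by case: hdot. Qed.

Lemma dotPl a x y z : dot (a *: x + y) z = a * dot x z + dot y z.
Proof. by case: hdot. Qed.

Lemma dotDl x y z : dot (x + y) z = dot x z + dot y z.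
Proof. by rewrite -[x]scale1r dotPl mul1r scale1r. Qed.

Lemma dot0l z : dot 0 z = 0.
Proof. by have := dotDl 0 0 z; rewrite addr0 => /eqP; rewrite -subr_eq0 opprD addrA subrr sub0r oppr_eq0 => /eqP. Qed.

Lemma dotZl a x z : dot (a *: x) z = a * dot x z.
Proof. by rewrite -[a *: x]addr0 dotPl dot0l addr0. Qed.

Lemma dotNl x z : dot (- x) z = - dot x z.
Proof. by rewrite -scaleN1r dotZl mulN1r. Qed.

Lemma dotBl x y z : dot (x - y) z = dot x z - dot y z.
Proof. by rewrite dotDl dotNl. Qed.

Lemma dotDr x y z : dot z (x + y) = dot z x + dot z y.
Proof. by rewrite ![dot z _]dotC dotDl. Qed.

Lemma dotZr a x z : dot z (a *: x) = a * dot z x.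
Proof. by rewrite ![dot z _]dotC dotZl. Qed.

Lemma dotBr x y z : dot z (x - y) = dot z x - dot z y.
Proof. by rewrite ![dot z _]dotC dotBl. Qed.

Lemma dot_suml (I : Type) (r : seq I) (P : pred I) (F : I -> H) z :
  dot (\sum_(i <- r | P i) F i) z = \sum_(i <- r | P i) dot (F i) z.
Proof. by elim/big_rec2: _ => [|i y1 y2 _ <-]; rewrite ?dot0l ?dotDl. Qed.

Lemma normB_sq x y : `|x - y| ^+ 2 = `|x| ^+ 2 - 2 * dot x y + `|y| ^+ 2.
Proof. by rewrite -!dotxx !dotBl !dotBr [dot y x]dotC; lra. Qed.

Lemma dot_CS x y : `|dot x y| <= `|x| * `|y|.
Proof.
have [->|y0] := eqVneq y 0; first by rewrite dotC dot0l !normr0 mulr0.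
have ny : 0 < `|y| by rewrite normr_gt0.
have : 0 <= `|(`|y| ^+ 2) *: x - (dot x y) *: y| ^+ 2 by rewrite exprn_ge0.
rewrite normB_sq !normrZ !dotZl !dotZr !exprMn normr_id.
rewrite (real_normK (num_real (dot x y))).
rewrite [X in 0 <= X -> _](_ : _ = `|y| ^+ 2 *
   ((`|x| * `|y|) ^+ 2 - dot x y ^+ 2)); last by ring.
rewrite pmulr_rge0 ?exprn_gt0// subr_ge0 => h.
rewrite -(@ler_pXn2r _ 2) ?nnegrE ?mulr_ge0//.
by rewrite real_normK// num_real.
Qed.

Lemma cvg_dotl (T : Type) (F : set_system T) {FF : Filter F} (f : T -> H) x y :
  f @ F --> x -> (fun t => dot (f t) y) @ F --> dot x y.
Proof.
move=> fx; apply/cvgrPdist_le => /= e e0.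
have ny : 0 < `|y| + 1 by rewrite ltr_wpDl.
move/cvgrPdist_le : fx => /(_ (e / (`|y| + 1))).
rewrite divr_gt0// => /(_ isT) fx.
near=> t; rewrite -dotBl (le_trans (dot_CS _ _))//.
have h : `|x - f t| <= e / (`|y| + 1) by near: t.
apply: (le_trans (ler_wpM2r (normr_ge0 y) h)).
rewrite -mulrA; apply: ler_piMr; first exact: ltW.
by rewrite mulrC ler_pdivrMr// mul1r lerDl.
Unshelve. all: by end_near. Qed.

Variables (e : nat -> H).
Hypothesis eij : forall i j, dot (e i) (e j) = (i == j)%:R.

Lemma dot_sum_e (c : nat -> R) m n j :
  dot (\sum_(m <= k < n) c k *: e k) (e j) = if (m <= j < n)%N then c j else 0.
Proof.
rewrite dot_suml; under eq_bigr do rewrite dotZl eij.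
case: ifPn => [/andP[mj jn]|h].
  rewrite (bigD1_seq j) ?iota_uniq ?mem_index_iota ?mj//= eqxx mulr1.
  by rewrite big1 ?addr0// => i /negbTE ->; rewrite mulr0.
rewrite big_seq_cond big1// => i; rewrite mem_index_iota andbT => hi.
case: eqVneq => [ij|]; last by rewrite mulr0.
by move: h; rewrite -ij hi.
Qed.

Lemma norm_sum_e (c : nat -> R) m n :
  `|\sum_(m <= k < n) c k *: e k| ^+ 2 = \sum_(m <= k < n) c k ^+ 2.
Proof.
rewrite -dotxx dot_suml [LHS]big_seq [RHS]big_seq; apply: eq_bigr => i.
by rewrite mem_index_iota dotZl dotC dot_sum_e => ->; rewrite expr2.
Qed.

Lemma coef_series_lim (c : nat -> R) x j :
  series (fun k => c k *: e k) @ \oo --> x -> dot x (e j) = c j.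
Proof.
move=> h0.
have h : dot (series (fun k => c k *: e k) n) (e j) @[n --> \oo] --> dot x (e j).
  exact: cvg_dotl.
apply/esym.
have : (fun n => dot (series (fun k => c k *: e k) n) (e j)) @ \oo --> c j.
  apply: cvg_near_cst; near=> n; rewrite /series/= dot_sum_e leq0n/=.
  by rewrite ifT//; near: n; exists j.+1.
by move=> h'; rewrite -(cvg_lim (@Rhausdorff R) h') -(cvg_lim (@Rhausdorff R) h).
Unshelve. all: by end_near. Qed.

Lemma cvg_norm_series (c : nat -> R) x :
  series (fun k => c k *: e k) @ \oo --> x ->
  series (fun k => c k ^+ 2) @ \oo --> `|x| ^+ 2.
Proof.
move=> /cvg_norm h; rewrite expr2.
rewrite (_ : series _ = (fun n => `|series (fun k => c k *: e k) n| *
  `|series (fun k => c k *: e k) n|)); first exact: cvgM.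
by apply/funext => n; rewrite -expr2 norm_sum_e.
Qed.

Lemma cvg_series_e (c : nat -> R) :
  cvgn (series (fun k => c k ^+ 2)) -> cvgn (series (fun k => c k *: e k)).
Proof.
move=> /cauchy_cvgP/cauchy_seriesP h; apply/cauchy_cvgP/cauchy_seriesP => eps eps0.
have /h : 0 < eps ^+ 2 by rewrite exprn_gt0.
apply: filterS => n; rewrite -norm_sum_e normrX normr_id.
by rewrite ltr_pXn2r// nnegrE// ltW.
Qed.

End Hilbert.

(** * The scale of the powers of the operator *)

Section Scale.
Context {R : realType} {H : completeNormedModType R}.
Variables (dot : H -> H -> R) (DA : set H) (A : H -> H) (lam : R^nat) (e : nat -> H).
Hypothesis hdot : hilbert_dot dot.
Hypothesis he : orthonormal_eigenbasis dot DA A lam e.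

Lemma eigen_orthonormal i j : dot (e i) (e j) = (i == j)%:R.
Proof. by case: he. Qed.
Let eij := eigen_orthonormal.

Lemma eigen_mono k : lam 0%N <= lam k.
Proof. by case: he => _ _ _ _ [h _]; elim: k => // k /le_trans; apply. Qed.

Lemma eigen_gt0 k : 0 < lam k.
Proof. by case: he => _ _ _ l0 _; apply: lt_le_trans (eigen_mono k). Qed.

Lemma eigen_dom k : DA (e k) /\ A (e k) = lam k *: e k.
Proof. by case: he. Qed.

Lemma fourier_cvg x : series (fun k => dot x (e k) *: e k) @ \oo --> x.
Proof. by case: he. Qed.

Lemma parseval x : series (fun k => dot x (e k) ^+ 2) @ \oo --> `|x| ^+ 2.
Proof. exact: (cvg_norm_series hdot eij (c := fun k => dot x (e k)) (@fourier_cvg x)). Qed.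

Lemma sum_le_series_lim (c : nat -> R) l m n : (forall k, 0 <= c k) ->
  series c @ \oo --> l -> \sum_(m <= k < n) c k <= l.
Proof.
move=> c0 cl; apply: (@le_trans _ _ (series c n)).
  rewrite /series/=; have [mn|nm] := leqP m n.
    by rewrite (@big_cat_nat _ _ _ m 0 n)//= lerDr sumr_ge0.
  by rewrite big_geq ?sumr_ge0// ltnW.
rewrite -(cvg_lim (@Rhausdorff R) cl); apply: nondecreasing_cvgn_le; last first.
  by apply/cvg_ex; exists l.
by apply: nondecreasing_series => k _ _; exact: c0.
Qed.

Lemma bessel x m n : \sum_(m <= k < n) dot x (e k) ^+ 2 <= `|x| ^+ 2.
Proof.
by apply: sum_le_series_lim (@parseval x) => k; rewrite sqr_ge0.
Qed.

Lemma FspP r v : Fsp dot lam e r v <->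
  cvgn (series (fun k => (lam k `^ r * dot v (e k)) ^+ 2)).
Proof.
split=> [h|]; last exact: (cvg_series_e hdot eij).
by apply/cvg_ex; eexists; exact: (cvg_norm_series hdot eij h).
Qed.

Lemma coef_Apow r v k : Fsp dot lam e r v ->
  dot (Apow dot lam e r v) (e k) = lam k `^ r * dot v (e k).
Proof.
by move=> h; exact: (coef_series_lim hdot eij (c := fun k => lam k `^ r * dot v (e k)) k h).
Qed.

Lemma Fsp_partial_sum r v m n : Fsp dot lam e r v ->
  \sum_(m <= k < n) (lam k `^ r * dot v (e k)) ^+ 2 <= `|Apow dot lam e r v| ^+ 2.
Proof.
move=> h; apply: le_trans (bessel (Apow dot lam e r v) m n).
by apply: ler_sum => k _; rewrite coef_Apow.
Qed.

(** Series of squares converge as soon as their partial sums are bounded; every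
    membership in the scale is obtained in this way. *)
Lemma Fsp_bounded r v B :
  (forall n, \sum_(0 <= k < n) (lam k `^ r * dot v (e k)) ^+ 2 <= B) ->
  Fsp dot lam e r v /\ `|Apow dot lam e r v| ^+ 2 <= B.
Proof.
move=> hB.
have h : cvgn (series (fun k => (lam k `^ r * dot v (e k)) ^+ 2)).
  apply: nondecreasing_is_cvgn.
    by apply: nondecreasing_series => k _ _; exact: sqr_ge0.
  by exists B => _ [n _ <-]; exact: hB.
split; first exact/FspP.
have hs : Fsp dot lam e r v by exact/FspP.
have := cvg_norm_series hdot eij (c := fun k => lam k `^ r * dot v (e k)) hs.
move/(cvg_lim (@Rhausdorff R)) => <-; apply: limr_le => //.
by apply: nearW => n; exact: hB.
Qed.

Lemma Fnorm_partial_sum r v m n :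
  ((\sum_(m <= k < n) (lam k `^ r * dot v (e k)) ^+ 2)%:E
    <= Fnorm dot lam e r v ^+ 2)%E.
Proof.
rewrite /Fnorm; case: ifPn => [/asboolP h|_]; last by rewrite expe2 mulyy leey.
by rewrite -EFin_expe lee_fin Fsp_partial_sum.
Qed.

Lemma Fnorm_ge0 r v : (0 <= Fnorm dot lam e r v)%E.
Proof. by rewrite /Fnorm; case: ifPn => // _; rewrite lee_fin. Qed.

(** The spectrum is bounded below by [lam 0 > 0]. *)
Lemma Fsp_le r s v : r <= s -> Fsp dot lam e s v -> Fsp dot lam e r v.
Proof.
move=> rs /Fsp_partial_sum hs.
apply: (Fsp_bounded (B := (lam 0%N `^ (r - s) * `|Apow dot lam e s v|) ^+ 2) _).1 => n.
rewrite exprMn; apply: le_trans (ler_wpM2l (sqr_ge0 _) (hs 0%N n)).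
rewrite mulr_sumr; apply: ler_sum => k _.
rewrite -exprMn mulrA !(exprMn _ _ (dot v (e k))); apply: ler_wpM2r; first exact: sqr_ge0.
rewrite ler_pXn2r// ?nnegrE ?mulr_ge0 ?powR_ge0//.
have {1}-> : r = (r - s) + s by rewrite subrK.
rewrite powRD; last by rewrite (gt_eqF (eigen_gt0 k)) implybT.
apply: ler_wpM2r; first exact: powR_ge0.
rewrite -[r - s]opprK [_ `^ _]powRN [leRHS]powRN lef_pV2 ?posrE ?powR_gt0 ?eigen_gt0//.
apply: ge0_ler_powR; rewrite ?nnegrE ?oppr_ge0 ?subr_le0 ?(ltW (eigen_gt0 _))//.
exact: eigen_mono.
Qed.

Lemma powR_sqr k r : (lam k `^ r) ^+ 2 = lam k `^ (r * 2).
Proof. by rewrite powRrM powR_mulrn// powR_ge0. Qed.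

Lemma powR_half k : (lam k `^ 2^-1) ^+ 2 = lam k.
Proof. by rewrite powR_sqr mulVf// powRr1// ltW// eigen_gt0. Qed.

Lemma powR_three_halves k : (lam k `^ (3 / 2)) ^+ 2 = lam k ^+ 3.
Proof. by rewrite powR_sqr mulfVK// powR_mulrn// ltW// eigen_gt0. Qed.

Lemma powR_one k : lam k `^ 1 = lam k.
Proof. by rewrite powRr1// ltW// eigen_gt0. Qed.

(** Since [A] equals its adjoint, it suffices to test against the domain, where
    symmetry moves [A] onto the eigenvectors. *)
Lemma domain_Fsp1 (hA : positive_selfadjoint dot DA A) u :
  Fsp dot lam e 1 u -> DA u /\ A u = Apow dot lam e 1 u.
Proof.
move=> hu; case: hA => _ _ _ _ sa; apply: (sa u (Apow dot lam e 1 u)).1 => z Dz.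
have zk k : dot (A z) (e k) = lam k * dot z (e k).
  by rewrite -(dotZr hdot); apply/(sa (e k) (lam k *: e k)).2; [exact: eigen_dom|].
have h1 : dot (series (fun k => dot u (e k) *: e k) n) (A z) @[n --> \oo] --> dot u (A z).
  by apply: (cvg_dotl hdot); exact: fourier_cvg.
have h2 : dot (series (fun k => (lam k `^ 1 * dot u (e k)) *: e k) n) z @[n --> \oo]
    --> dot (Apow dot lam e 1 u) z.
  by apply: (cvg_dotl hdot); exact: hu.
rewrite (dotC hdot) [RHS](dotC hdot).
rewrite -(cvg_lim (@Rhausdorff R) h1) -(cvg_lim (@Rhausdorff R) h2).
congr (limn _); apply/funext => n; rewrite /series/= !(dot_suml hdot).
apply: eq_bigr => k _; rewrite !(dotZl hdot) ![dot (e k) _](dotC hdot) zk.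
by rewrite powR_one; ring.
Qed.

Lemma coef_A (hA : positive_selfadjoint dot DA A) u k :
  DA u -> dot (A u) (e k) = lam k * dot u (e k).
Proof.
case: hA => _ _ _ _ sa Du; rewrite -(dotZr hdot).
by apply: (sa (e k) (lam k *: e k)).2; [exact: eigen_dom|].
Qed.

End Scale.

(** * Square-integrable histories with respect to a memory kernel *)

Section Integral.
Context {d} {T : measurableType d} {R : realType}.
Variable mu : {measure set T -> \bar R}.

Lemma integrableZ_EFin (D : set T) (k : R) (f : T -> R) : measurable D ->
  mu.-integrable D (EFin \o f) -> mu.-integrable D (EFin \o (fun x => k * f x)).
Proof. by move=> mD /(integrableZl mD k); apply: eq_integrable. Qed.

Lemma integrableD_EFin (D : set T) (f g : T -> R) : measurable D ->
  mu.-integrable D (EFin \o f) -> mu.-integrable D (EFin \o g) ->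
  mu.-integrable D (EFin \o (fun x => f x + g x)).
Proof. by move=> mD hf hg; apply: eq_integrable (integrableD mD hf hg). Qed.

Lemma integrableB_EFin (D : set T) (f g : T -> R) : measurable D ->
  mu.-integrable D (EFin \o f) -> mu.-integrable D (EFin \o g) ->
  mu.-integrable D (EFin \o (fun x => f x - g x)).
Proof. by move=> mD hf hg; apply: eq_integrable (integrableB mD hf hg). Qed.

Lemma ae_eq_Rintegral (D : set T) (f g : T -> R) : measurable D ->
  measurable_fun D f -> measurable_fun D g ->
  {ae mu, forall x, D x -> f x = g x} ->
  \int[mu]_(x in D) f x = \int[mu]_(x in D) g x.
Proof.
move=> mD mf mg fg; congr fine; apply: ae_eq_integral => //.
- exact/measurable_EFinP.
- exact/measurable_EFinP.
- by apply: filterS fg => x h /h ->.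
Qed.

Lemma ae_le_Rintegral (D : set T) (f g : T -> R) : measurable D ->
  mu.-integrable D (EFin \o f) -> mu.-integrable D (EFin \o g) ->
  {ae mu, forall x, D x -> f x <= g x} ->
  \int[mu]_(x in D) f x <= \int[mu]_(x in D) g x.
Proof.
move=> mD mf mg fg.
have mf' : measurable_fun D f by apply/measurable_EFinP; apply: (measurable_int mu).
have mg' : measurable_fun D g by apply/measurable_EFinP; apply: (measurable_int mu).
(* [max f g] agrees almost everywhere with [g] and dominates [f] everywhere *)
have mmax : measurable_fun D (fun x => Num.max (f x) (g x)) by exact: measurable_maxr.
have imax : mu.-integrable D (EFin \o (fun x => Num.max (f x) (g x))).
  apply: (@le_integrable _ _ _ _ _ mD _ (EFin \o (fun x => `|f x| + `|g x|))) => //.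
  - exact/measurable_EFinP.
  - move=> x Dx /=; rewrite lee_fin [leRHS]ger0_norm// /Num.max.
    by case: ifP => _; rewrite ?lerDl ?lerDr.
  - by apply: integrableD_EFin => //; exact: integrable_norm.
apply: le_trans (_ : \int[mu]_(x in D) (Num.max (f x) (g x)) <= _).
  by apply: le_Rintegral => // x _; rewrite le_max lexx.
rewrite (@ae_eq_Rintegral D _ g)//.
by apply: filterS fg => x h /h /max_idPr.
Qed.

(** The integral of a nonnegative function is a supremum over the simple
    functions below it, so that no measurability enters: this spares proving
    that the norms of the scale are measurable. *)
Lemma le_integralT (D : set T) (f g : T -> \bar R) :
  (forall x, D x -> (0 <= f x)%E) -> (forall x, D x -> (f x <= g x)%E) ->
  (\int[mu]_(x in D) f x <= \int[mu]_(x in D) g x)%E.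
Proof.
move=> f0 fg; have g0 x : D x -> (0 <= g x)%E.
  by move=> Dx; apply: le_trans (f0 _ Dx) (fg _ Dx).
rewrite !ge0_integralE//; apply: ge_ereal_sup => _ [h hf <-].
apply: ereal_sup_ubound; exists h => // x; apply: le_trans (hf x) _.
by rewrite /patch; case: ifPn => // /[1!inE]; exact: fg.
Qed.

Lemma integrable_ge0 (D : set T) (f : T -> R) : measurable_fun D f ->
  (forall x, D x -> 0 <= f x) -> (\int[mu]_(x in D) (f x)%:E < +oo)%E ->
  mu.-integrable D (EFin \o f).
Proof.
move=> mf f0 fi; apply/integrableP; split; first exact/measurable_EFinP.
apply: le_lt_trans fi; apply: le_integralT => // x Dx.
by rewrite /= ger0_norm// f0.
Qed.

End Integral.

Section CauchySchwarz.
Context {R : realType}.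
Local Notation leb := (@lebesgue_measure R).

(** Cauchy-Schwarz on a bounded interval, obtained by optimizing over [c] the
    inequality [2 c |f| <= c ^+ 2 + f ^+ 2]. *)
Lemma Rintegral_sqr_le (s : R) (f : R -> R) : 0 < s ->
  measurable_fun `]0, s[ f ->
  leb.-integrable `]0, s[ (EFin \o (fun r => f r ^+ 2)) ->
  leb.-integrable `]0, s[ (EFin \o f) /\
  forall t, 0 <= t <= s ->
  (\int[leb]_(r in `]0, t[) f r) ^+ 2 <= s * \int[leb]_(r in `]0, s[) f r ^+ 2.
Proof.
move=> s0 mf if2.
have ms : leb `]0, s[ = s%:E by rewrite lebesgue_measure_itv/= lte_fin s0 oppr0 adde0.
have icst (c : R) : leb.-integrable `]0, s[ (EFin \o (fun=> c)).
  apply: measurable_bounded_integrable => //.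
    by rewrite [X in (X < _)%E]lebesgue_measure_itv/= lte_fin s0 -EFinD ltry.
  by exists `|c|; split => // x cx y _; exact: ltW.
have ifs : leb.-integrable `]0, s[ (EFin \o f).
  apply: (@le_integrable _ _ _ leb _ (measurable_itv _) _ (EFin \o (fun r => 1 + f r ^+ 2))) => //.
  - exact/measurable_EFinP.
  - move=> x _ /=; rewrite lee_fin [leRHS]ger0_norm ?addr_ge0 ?sqr_ge0//.
    rewrite ler_norml; apply/andP; split; nra.
  - exact: integrableD_EFin.
split => // t /andP[t0 ts].
have sub : `]0, t[ `<=` (`]0, s[ : set R) by apply: subset_itvl; rewrite bnd_simp.
have ift : leb.-integrable `]0, t[ (EFin \o f) by apply: integrableS ifs.
set I := \int[leb]_(r in `]0, s[) `|f r|.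
set J := \int[leb]_(r in `]0, s[) f r ^+ 2.
have I0 : 0 <= I by apply: Rintegral_ge0.
have tI : `|\int[leb]_(r in `]0, t[) f r| <= I.
  apply: le_trans (le_normr_Rintegral _ ift) _ => //.
  rewrite /I /Rintegral; apply: fine_le.
  - by apply: integrable_fin_num => //; exact: integrable_norm.
  - by apply: integrable_fin_num => //; exact: integrable_norm.
  - apply: ge0_subset_integral => //.
    apply/measurable_EFinP; apply: measurableT_comp => //.
have hc (c : R) : 2 * c * I <= s * c ^+ 2 + J.
  rewrite /I -RintegralZl//; last exact: integrable_norm.
  have -> : s * c ^+ 2 = \int[leb]_(r in `]0, s[) c ^+ 2.
    by rewrite Rintegral_cst//= ms/= mulrC.
  rewrite -RintegralD//; apply: le_Rintegral => //.
  - by apply: integrableZ_EFin => //; exact: integrable_norm.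
  - exact: integrableD_EFin.
  - move=> x _; rewrite -[f x ^+ 2]real_normK ?num_real//.
    have := sqr_ge0 (c - `|f x|); lra.
apply: (@le_trans _ _ (I ^+ 2)).
  by rewrite -[X in X <= _]real_normK ?num_real// ler_pXn2r// nnegrE.
(* the mean of [|f|] is the optimal constant *)
have := hc (I / s); rewrite -(ler_pM2l s0).
have -> : s * (2 * (I / s) * I) = 2 * I ^+ 2 by field; rewrite gt_eqF.
have -> : s * (s * (I / s) ^+ 2 + J) = I ^+ 2 + s * J by field; rewrite gt_eqF.
lra.
Qed.

End CauchySchwarz.

Section Kernel.
Context {R : realType}.
Local Notation leb := (@lebesgue_measure R).
Variables (mu : R -> R) (delta : R).
Hypothesis hmu : memory_kernel mu delta.

Let mhalf : measurable (`]0, +oo[ : set (measurableTypeR R)).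
Proof. exact: measurable_itv. Qed.

Let mitv s : measurable (`]0, s[ : set (measurableTypeR R)).
Proof. exact: measurable_itv. Qed.

Lemma kernel_ge0 s : 0 <= s -> 0 <= mu s.
Proof. by case: hmu => _ _ _ [_ + _ _ _]; apply. Qed.

Lemma kernel_integrable : leb.-integrable `]0, +oo[ (EFin \o mu).
Proof. by case: hmu => _ _ _ []. Qed.

Lemma kernel_measurable : measurable_fun (`]0, +oo[ : set R) mu.
Proof. by apply/measurable_EFinP; exact: (measurable_int _ kernel_integrable). Qed.

Lemma kernel_noninc s t : 0 <= s -> s <= t -> mu t <= mu s.
Proof.
case: hmu => cmu dmu _ [_ _ _ d0 h].
apply: ler0_derive1_nincry => //.
- by move=> x; rewrite in_itv/= andbT; exact: dmu.
- move=> x; rewrite in_itv/= andbT => x0; have := h _ x0.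
  by have := mulr_ge0 (ltW d0) (kernel_ge0 (ltW x0)); lra.
Qed.

Lemma kernel_continuous s : 0 < s -> {for s, continuous mu}.
Proof.
case: hmu => _ dmu _ _ s0; apply: differentiable_continuous.
exact/derivable1_diffP/dmu.
Qed.

(** The kernel may be assumed nonzero at [0] only; continuity there then gives a
    positive point. *)
Lemma kernel_pos : exists2 s, 0 < s & 0 < mu s.
Proof.
case: hmu => cmu _ _ [_ _ [s s0 mus] _ _].
have mus0 : 0 < mu s by rewrite lt_neqAle eq_sym mus kernel_ge0.
move: s0; rewrite le_eqVlt => /predU1P[s0|]; last by exists s.
move: mus0; rewrite -{}s0 => {s mus} mu0.
have [h0|] := pselect (forall s, 0 < s -> mu s <= 0); last first.
  by move=> /existsNP[s /not_implyP[s0 /negP]]; rewrite -ltNge => ?; exists s.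
have /continuous_within_itvcyP[_ c0] := cmu.
exfalso; suff : mu 0 <= 0 by rewrite leNgt mu0.
rewrite -(cvg_lim (@Rhausdorff R) c0); apply: limr_le.
  by apply/cvg_ex; exists (mu 0).
by near=> x; apply: h0; near: x; exact: nbhs_right_gt.
Unshelve. all: by end_near. Qed.

Definition sqint (c : R -> R) : R :=
  \int[leb]_(s in `]0, +oo[) (mu s * c s ^+ 2).

Definition in_L2 (c : R -> R) : Prop := measurable_fun (`]0, +oo[ : set R) c /\
  leb.-integrable `]0, +oo[ (EFin \o (fun s => mu s * c s ^+ 2)).

Lemma kernel_sqr_ge0 c s : `]0, +oo[%classic s -> 0 <= mu s * c s ^+ 2.
Proof.
by rewrite /= in_itv/= andbT => s0; rewrite mulr_ge0 ?sqr_ge0 ?kernel_ge0 ?ltW.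
Qed.

Lemma sqint_ge0 c : 0 <= sqint c.
Proof. by apply: Rintegral_ge0 => s hs; exact: kernel_sqr_ge0. Qed.

Lemma in_L2_cst (a : R) : in_L2 (cst a).
Proof.
split => //.
have := integrableZl mhalf (a ^+ 2) kernel_integrable.
by apply: eq_integrable => // s _; rewrite /= -EFinM mulrC.
Qed.

Lemma in_L2Z a c : in_L2 c -> in_L2 (fun s => a * c s).
Proof.
move=> [mc ic]; split; first exact: measurable_funM.
have := integrableZl mhalf (a ^+ 2) ic.
by apply: eq_integrable => // s _; rewrite /= -EFinM; congr EFin; ring.
Qed.

Lemma in_L2D b c : in_L2 b -> in_L2 c -> in_L2 (fun s => b s + c s).
Proof.
move=> [mb ib] [mc ic].
have m : measurable_fun (`]0, +oo[ : set R) (fun s => b s + c s) by exact: measurable_funD.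
split => //.
apply: (@le_integrable _ _ _ leb _ (measurable_itv _) _
  (EFin \o (fun s => 2 * (mu s * b s ^+ 2) + 2 * (mu s * c s ^+ 2)))) => //.
- apply/measurable_EFinP; apply: measurable_funM; first exact: kernel_measurable.
  exact: measurable_funX.
- move=> s hs /=; rewrite lee_fin ger0_norm.
    2: exact: (kernel_sqr_ge0 (fun s => b s + c s) hs).
  apply: le_trans (ler_norm _).
  move: hs; rewrite /= in_itv/= andbT => /ltW/kernel_ge0 mus.
  have := mulr_ge0 mus (sqr_ge0 (b s - c s)); lra.
- by apply: integrableD_EFin => //; exact: integrableZ_EFin.
Qed.

Lemma in_L2B b c : in_L2 b -> in_L2 c -> in_L2 (fun s => b s - c s).
Proof.
move=> hb hc; have := in_L2D hb (in_L2Z (-1) hc).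
by congr in_L2; apply/funext => s; rewrite mulN1r.
Qed.

Lemma sqintZ a c : in_L2 c -> sqint (fun s => a * c s) = a ^+ 2 * sqint c.
Proof.
move=> [mc ic]; rewrite /sqint -RintegralZl//.
by apply: eq_Rintegral => s _; ring.
Qed.

Lemma sqintD b c : in_L2 b -> in_L2 c ->
  sqint (fun s => b s + c s) <= 2 * sqint b + 2 * sqint c.
Proof.
move=> hb hc; rewrite /sqint -RintegralZl//; last by case: hb.
rewrite -RintegralZl//; last by case: hc.
rewrite -RintegralD//; first last.
- by apply: integrableZ_EFin => //; case: hc.
- by apply: integrableZ_EFin => //; case: hb.
apply: le_Rintegral => //; first by case: (in_L2D hb hc).
  by apply: integrableD_EFin => //; apply: integrableZ_EFin => //; [case: hb|case: hc].
move=> s; rewrite /= in_itv/= andbT => /ltW/kernel_ge0 mus.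
have := mulr_ge0 mus (sqr_ge0 (b s - c s)); lra.
Qed.

Lemma in_L2_integrable c : in_L2 c ->
  leb.-integrable `]0, +oo[ (EFin \o (fun s => mu s * c s)).
Proof.
move=> [mc ic].
apply: (@le_integrable _ _ _ leb _ (measurable_itv _) _ (EFin \o (fun s => mu s + mu s * c s ^+ 2))) => //.
- by apply/measurable_EFinP; apply: measurable_funM => //; exact: kernel_measurable.
- move=> s; rewrite /= in_itv/= andbT => /ltW/kernel_ge0 mus.
  rewrite lee_fin [leRHS]ger0_norm; last by rewrite addr_ge0// (mulr_ge0 mus (sqr_ge0 _)).
  rewrite normrM (ger0_norm mus) -[c s ^+ 2]real_normK ?num_real//.
  have := mulr_ge0 mus (sqr_ge0 (1 - `|c s|)).
  by have := mulr_ge0 mus (normr_ge0 (c s)); lra.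
- by apply: integrableD_EFin => //; exact: kernel_integrable.
Qed.

(** A monotone kernel is bounded below by its value at [s] on the interval
    before [s], so that histories are square integrable there. *)
Lemma in_L2_local c s : 0 < s -> 0 < mu s -> in_L2 c ->
  leb.-integrable `]0, s[ (EFin \o (fun r => c r ^+ 2)) /\
  mu s * \int[leb]_(r in `]0, s[) c r ^+ 2 <= sqint c.
Proof.
move=> s0 mus [mc ic].
have sub : `]0, s[ `<=` (`]0, +oo[ : set R) by apply: subset_itvl.
have mcs : measurable_fun `]0, s[ c by apply: measurable_funS mc.
have ics : leb.-integrable `]0, s[ (EFin \o (fun r => mu r * c r ^+ 2)).
  exact: integrableS ic.
have le r : `]0, s[%classic r -> mu s * c r ^+ 2 <= mu r * c r ^+ 2.
  rewrite /= in_itv/= => /andP[r0 rs]; apply: ler_wpM2r; first exact: sqr_ge0.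
  by apply: kernel_noninc; rewrite ltW.
have i2 : leb.-integrable `]0, s[ (EFin \o (fun r => c r ^+ 2)).
  have : leb.-integrable `]0, s[ (EFin \o (fun r => mu s * c r ^+ 2)).
    apply: (@le_integrable _ _ _ leb _ (measurable_itv _) _
      (EFin \o (fun r => mu r * c r ^+ 2))) => //.
      apply/measurable_EFinP; apply: measurable_funM => //; exact: measurable_funX.
    move=> r rs /=; rewrite lee_fin !ger0_norm ?le//.
      by apply: kernel_sqr_ge0; exact: sub.
    by rewrite mulr_ge0 ?sqr_ge0// ltW.
  move=> /(integrableZ_EFin (mu s)^-1 (mitv s)).
  by apply: eq_integrable => // r _ /=; rewrite mulKf// gt_eqF.
split => //; rewrite -RintegralZl//.
apply: (@le_trans _ _ (\int[leb]_(r in `]0, s[) (mu r * c r ^+ 2))).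
  by apply: le_Rintegral => //; exact: integrableZ_EFin.
rewrite /sqint /Rintegral fine_le//.
- exact: integrable_fin_num.
- exact: integrable_fin_num.
- apply: ge0_subset_integral => //.
    by apply/measurable_EFinP; apply/measurable_EFinP; exact: (measurable_int _ ic).
  by move=> r hr; rewrite lee_fin kernel_sqr_ge0.
Qed.

(** Convergence in the weighted norm thus implies uniform convergence of the
    primitives away from the zeros of the kernel. *)
Lemma in_L2_integral c s : 0 < s -> 0 < mu s -> in_L2 c ->
  leb.-integrable `]0, s[ (EFin \o c) /\
  forall t, 0 <= t <= s ->
    (\int[leb]_(r in `]0, t[) c r) ^+ 2 <= s / mu s * sqint c.
Proof.
move=> s0 mus hc; have [i2 le2] := in_L2_local s0 mus hc.
have mcs : measurable_fun `]0, s[ c.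
  by apply: measurable_funS hc.1 => //; apply: subset_itvl.
have [i1 le1] := Rintegral_sqr_le s0 mcs i2.
split => // t ts; apply: le_trans (le1 _ ts) _.
rewrite -mulrA; apply: ler_wpM2l; first exact: ltW.
by rewrite mulrC ler_pdivlMr// mulrC.
Qed.

End Kernel.

(** * Transport of the history along characteristics *)

#[global] Instance lebesgue_ae_filter {R : realType} :
  Filter (almost_everywhere (@lebesgue_measure R)).
Proof. exact: (ae_filter_ringOfSetsType (@lebesgue_measure R)). Qed.

Section RealTools.
Context {R : realType}.
Local Notation leb := (@lebesgue_measure R).

Lemma within_continuous_nearP (A : set R) (f : R -> R) :
  {within A, continuous f} <->
  forall x, A x -> forall eps : R, 0 < eps ->
    \forall y \near x, A y -> `|f y - f x| <= eps.
Proof.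
rewrite subspace_continuousP; split => h x Ax.
  move=> eps eps0; have /cvgrPdist_le /(_ _ eps0) := h x Ax.
  by rewrite near_withinE; apply: filterS => y hy Ay; rewrite distrC; exact: hy.
apply/cvgrPdist_le => eps eps0; rewrite near_withinE.
by apply: filterS (h x Ax _ eps0) => y hy Ay; rewrite distrC; exact: hy.
Qed.

Lemma is_derive_nearP (f : R -> R) (x l : R) :
  is_derive x 1 f l <->
  forall eps : R, 0 < eps -> \forall h \near 0^', `|h^-1 * (f (x + h) - f x) - l| <= eps.
Proof.
split=> [[df fl] eps eps0|h].
  have /cvg_ex[l' hl'] := df.
  have ll' : l' = l by rewrite -fl; apply/esym/(cvg_lim (@Rhausdorff R)).
  have /cvgrPdist_le /(_ _ eps0) := hl'; rewrite ll'; apply: filterS => h.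
  by rewrite distrC /= /GRing.scale/= mulr1 (addrC h x).
have hl : h^-1 *: ((f \o shift x) (h *: 1) - f x) @[h --> 0^'] --> l.
  apply/cvgrPdist_le => eps eps0; apply: filterS (h eps eps0) => k.
  by rewrite distrC /= /GRing.scale/= mulr1 (addrC k x).
split; first by apply/cvg_ex; exists l.
exact: (cvg_lim (@Rhausdorff R)).
Qed.

Lemma is_derive_constant (f : R -> R) (a b : R) : a <= b ->
  (forall x, a < x < b -> is_derive x 1 f 0) ->
  {within `[a, b], continuous f} -> f a = f b.
Proof.
rewrite le_eqVlt => /predU1P[->//|ab] df cf.
have df' x : x \in `]a, b[ -> is_derive x 1 f ((fun=> 0) x).
  by rewrite in_itv/=; exact: df.
have [c _] := MVT ab df' cf.
by rewrite mul0r => /eqP; rewrite subr_eq0 => /eqP.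
Qed.

Lemma is_derive_uniq (f : R -> R) (x l l' : R) :
  is_derive x 1 f l -> is_derive x 1 f l' -> l = l'.
Proof. by move=> [_ <-] [_ <-]. Qed.

Lemma near_eq_is_derive (f g : R -> R) (x l : R) :
  (\forall y \near x, f y = g y) -> is_derive x 1 f l -> is_derive x 1 g l.
Proof.
move=> fg [df fl]; split; first by apply: near_eq_derivable df => //; rewrite oner_neq0.
by rewrite -fl; apply/esym; apply: near_eq_derive => //; rewrite oner_neq0.
Qed.

(** Upper bounds are enough because [g] is a norm in all uses; the condition
    [0 <= t + h] makes the limit one-sided at [t = 0]. *)
Definition vanishes_at (t : R) (g : R -> R) : Prop :=
  forall eps : R, 0 < eps -> \forall h \near 0^', 0 <= t + h -> g h <= eps.

Lemma vanishes_at_interior t g : 0 < t -> vanishes_at t g ->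
  forall eps : R, 0 < eps -> \forall h \near 0^', g h <= eps.
Proof.
move=> t0 hg eps eps0; near=> h; have : 0 <= t + h -> g h <= eps by near: h; exact: hg.
apply; have : `|h| <= t by near: h; apply: dnbhs0_le.
by rewrite ler_norml => /andP[+ _]; lra.
Unshelve. all: by end_near. Qed.

Definition prim (c : R -> R) (s : R) : R := \int[leb]_(r in `]0, s[) c r.

Lemma prim_le0 c s : s <= 0 -> prim c s = 0.
Proof. by move=> s0; rewrite /prim set_itv_ge ?Rintegral_set0// bnd_simp -leNgt. Qed.

Lemma primE c b s : leb.-integrable `]0, b[ (EFin \o c) -> 0 <= s <= b ->
  prim c s = parameterized_integral leb 0 s c.
Proof.
move=> ic /andP[s0 sb]; rewrite /prim /parameterized_integral.
have ic' : leb.-integrable `]0, s[ (EFin \o c).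
  by apply: integrableS ic => //; apply: subset_itvl; rewrite bnd_simp.
rewrite Rintegral_itv_bndo_bndc//; apply: Rintegral_itv_obnd_cbnd.
apply/integrableP; have /integrableP[m i] := ic'; split.
  by apply/emeasurable_fun_itv_bndo_bndcP.
rewrite -integral_itv_bndo_bndc//; apply: measurableT_comp => //.
Qed.

Lemma integrable_closed c b : 0 <= b -> leb.-integrable `]0, b[ (EFin \o c) ->
  leb.-integrable `[0, b] (EFin \o c).
Proof.
move=> b0 /integrableP[m i]; apply/integrableP; split.
  exact: emeasurable_fun_itv_cc m.
have m' : measurable_fun (`]0, b[ : set R) (fun x => `|(EFin \o c) x|%E).
  exact: measurableT_comp.
rewrite -integral_itv_obnd_cbnd -?integral_itv_bndo_bndc//.
by apply/emeasurable_fun_itv_bndo_bndcP.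
Qed.

Lemma prim_continuous c b : 0 <= b -> leb.-integrable `]0, b[ (EFin \o c) ->
  {within `[0, b], continuous (prim c)}.
Proof.
move=> b0 ic; have h := parameterized_integral_continuous b0 (integrable_closed b0 ic).
apply/within_continuous_nearP => x xb eps eps0.
move/within_continuous_nearP : h => /(_ x xb eps eps0).
apply: filterS => y + yb => /(_ yb); rewrite !(@primE _ b)//.
Qed.

Lemma prim_derive c b s : leb.-integrable `]0, b[ (EFin \o c) -> 0 < s < b ->
  {for s, continuous c} -> is_derive s 1 (prim c) (c s).
Proof.
move=> ic /andP[s0 sb] cs.
have b0 : 0 <= b by lra.
have [dF Fs] := continuous_FTC1_closed sb (integrable_closed b0 ic) s0 cs.
apply: (@near_eq_is_derive (parameterized_integral leb 0 ^~ c)).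
  near=> y; rewrite (@primE _ b)//; apply/andP; split.
    by near: y; apply: filterS (lt_nbhsr s0) => y; exact: ltW.
  by near: y; apply: filterS (lt_nbhsl sb) => y; exact: ltW.
by split; [exact: dF|rewrite -derive1E].
Unshelve. all: by end_near. Qed.

Lemma primB c d b s : leb.-integrable `]0, b[ (EFin \o c) ->
  leb.-integrable `]0, b[ (EFin \o d) -> s <= b ->
  prim (fun r => c r - d r) s = prim c s - prim d s.
Proof.
move=> ic id sb.
have sub : `]0, s[ `<=` (`]0, b[ : set R) by apply: subset_itvl; rewrite bnd_simp.
by rewrite /prim RintegralB//; [exact: integrableS ic|exact: integrableS id].
Qed.

Lemma primZ a c b s : leb.-integrable `]0, b[ (EFin \o c) -> s <= b ->
  prim (fun r => a * c r) s = a * prim c s.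
Proof.
move=> ic sb.
have sub : `]0, s[ `<=` (`]0, b[ : set R) by apply: subset_itvl; rewrite bnd_simp.
by rewrite /prim RintegralZl//; exact: integrableS ic.
Qed.

Lemma near_dnbhs0 (P : R -> Prop) : P 0 -> (\forall h \near 0^', P h) ->
  \forall h \near 0, P h.
Proof.
move=> P0; rewrite near_withinE; apply: filterS => h.
by have [->|h0 /(_ isT)] := eqVneq h 0.
Qed.

Lemma near_addP (x : R) (P : R -> Prop) :
  (\forall h \near 0, P (x + h)) <-> \forall y \near x, P y.
Proof.
rewrite [X in _ <-> X](near_shift 0 x) subr0.
by split; apply: filterS => h /=; rewrite addrC.
Qed.

(** The representative, continuous in [s], of the history whose time derivative
    is [z] and whose source is [w]. *)
Definition regular_history (z : R -> R -> R) (w : R -> R) (t s : R) : R :=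
  s * w t - prim (z t) s.

End RealTools.

Section Transport.
Context {R : realType}.
Local Notation leb := (@lebesgue_measure R).
Variables (mu : R -> R) (delta : R).
Hypothesis hmu : memory_kernel mu delta.
Variables (y z : R -> R -> R) (u w : R -> R).
Hypothesis hy : forall t : R, 0 <= t -> in_L2 mu (y t).
Hypothesis hz : forall t : R, 0 <= t -> in_L2 mu (z t).
Hypothesis hyz : forall t : R, 0 <= t -> vanishes_at t
  (fun h => sqint mu (fun s => h^-1 * (y (t + h) s - y t s) - z t s)).
Hypothesis hprim : forall t : R, 0 <= t -> {ae leb, forall s, 0 < s -> 0 < mu s ->
  y t s + prim (z t) s = s * w t}.
Hypothesis huw : forall t : R, 0 <= t -> vanishes_at t
  (fun h => `|h^-1 * (u (t + h) - u t) - w t|).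

Arguments hy {t} _.
Arguments hz {t} _.
Arguments hprim {t} _.
Arguments huw {t} _ _ _.
Arguments hyz {t} _ _ _.

(** The difference quotients are bounded in the weighted norm near [t], so that
    the increments are of order [h]. *)
Lemma memory_continuous (t : R) : 0 <= t -> forall eps : R, 0 < eps ->
  \forall t' \near t, 0 <= t' -> sqint mu (fun s => y t' s - y t s) <= eps.
Proof.
move=> t0 eps eps0; apply/near_addP; apply: near_dnbhs0.
  rewrite addr0 => _; rewrite (_ : (fun s => _) = (fun s => 0 * y t s)).
    by rewrite (sqintZ _ (hy t0)) expr2 !mul0r ltW.
  by apply/funext => s; rewrite subrr mul0r.
set K := 2 + 2 * sqint mu (z t).
have K0 : 0 < K by rewrite ltr_pwDl// mulr_ge0// (sqint_ge0 hmu).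
near=> h => th.
have h0 : h != 0 by near: h; exact: nbhs_dnbhs_neq.
have D1 : sqint mu (fun s => h^-1 * (y (t + h) s - y t s) - z t s) <= 1.
  by move: th; near: h; exact: hyz.
have hD : in_L2 mu (fun s => h^-1 * (y (t + h) s - y t s) - z t s).
  apply: (in_L2B hmu) (hz t0); apply: in_L2Z.
  by apply: (in_L2B hmu); exact: hy.
rewrite (_ : (fun s => _) =
  (fun s => h * ((h^-1 * (y (t + h) s - y t s) - z t s) + z t s))); last first.
  by apply/funext => s; rewrite subrK mulVKf.
rewrite (sqintZ _ (in_L2D hmu hD (hz t0))).
have := sqintD hmu hD (hz t0); set X := sqint mu (fun s => _ + z t s) => hX.
have XK : X <= K by rewrite /K; lra.
have hK : h ^+ 2 * K <= eps.
  rewrite -ler_pdivlMr// -[h ^+ 2]ger0_norm ?sqr_ge0// normrX.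
  have : `|h| <= Num.sqrt (eps / K).
    by near: h; apply: dnbhs0_le; rewrite sqrtr_gt0 divr_gt0.
  rewrite -(@ler_pXn2r _ 2) ?nnegrE ?sqrtr_ge0//.
  by rewrite sqr_sqrtr// divr_ge0// ltW.
by apply: le_trans hK; apply: ler_wpM2l => //; exact: sqr_ge0.
Unshelve. all: by end_near. Qed.

Lemma displacement_near (t : R) : 0 <= t -> forall eps : R, 0 < eps ->
  \forall t' \near t, 0 <= t' -> `|u t' - u t| <= eps.
Proof.
move=> t0 eps eps0; apply/near_addP; apply: near_dnbhs0.
  by move=> _; rewrite addr0 subrr normr0 ltW.
set K := 1 + `|w t|.
have K0 : 0 < K by rewrite ltr_pwDl.
near=> h => th.
have h0 : h != 0 by near: h; exact: nbhs_dnbhs_neq.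
have D1 : `|h^-1 * (u (t + h) - u t) - w t| <= 1.
  by move: th; near: h; exact: huw.
have -> : u (t + h) - u t = h * ((h^-1 * (u (t + h) - u t) - w t) + w t).
  by rewrite subrK mulVKf.
rewrite normrM.
apply: (@le_trans _ _ (eps / K * K)); last by rewrite divfK// gt_eqF.
apply: ler_pM => //.
  by near: h; apply: dnbhs0_le; rewrite divr_gt0.
by apply: le_trans (ler_normD _ _) _; rewrite lerD2r.
Unshelve. all: by end_near. Qed.

Lemma displacement_within (T : R) : {within `[0, T], continuous u}.
Proof.
apply/within_continuous_nearP => x; rewrite /= in_itv/= => /andP[x0 _] eps eps0.
apply: filterS (displacement_near x0 eps0) => t' h; rewrite in_itv/= => /andP[t'0 _].
exact: h.
Qed.

Lemma displacement_continuous (t : R) : 0 < t -> {for t, continuous u}.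
Proof.
move=> t0; apply: (within_continuous_continuous (a := 0) (b := t + 1)).
- lra.
- exact: displacement_within.
- by rewrite in_itv/=; apply/andP; split; lra.
Qed.

Lemma displacement_integrable (T : R) : leb.-integrable `]0, T[ (EFin \o u).
Proof.
apply: (@integrableS _ _ _ leb `[0, T]) => //.
  by apply: subset_itv; rewrite bnd_simp.
apply: continuous_compact_integrable; first exact: segment_compact.
exact: displacement_within.
Qed.

Lemma displacement_derive (t : R) : 0 < t -> is_derive t 1 u (w t).
Proof.
move=> t0; apply/is_derive_nearP => eps eps0.
exact: vanishes_at_interior t0 (huw (ltW t0)) _ eps0.
Qed.

Local Notation yhat := (regular_history z w).

Let integrable_y (t s : R) : 0 <= t -> 0 < s -> 0 < mu s ->
  leb.-integrable `]0, s[ (EFin \o y t).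
Proof. by move=> t0 s0 ms; have [] := in_L2_integral hmu s0 ms (hy t0). Qed.

Let integrable_z (t s : R) : 0 <= t -> 0 < s -> 0 < mu s ->
  leb.-integrable `]0, s[ (EFin \o z t).
Proof. by move=> t0 s0 ms; have [] := in_L2_integral hmu s0 ms (hz t0). Qed.

Let yhat_within (t s : R) : 0 <= t -> 0 < s -> 0 < mu s ->
  {within `[0, s], continuous (yhat t)}.
Proof.
move=> t0 s0 ms.
have /within_continuous_nearP hp := prim_continuous (ltW s0) (integrable_z t0 s0 ms).
apply/within_continuous_nearP => x xs eps eps0.
have e2 : 0 < eps / 2 by rewrite divr_gt0.
set K := 1 + `|w t|.
have K0 : 0 < K by rewrite ltr_pwDl.
near=> x' => xs'.
have h1 : `|prim (z t) x' - prim (z t) x| <= eps / 2.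
  by move: xs'; near: x'; exact: hp.
have h2 : `|x' - x| <= eps / 2 / K.
  by rewrite distrC; near: x'; apply: cvgr_dist_le => //; rewrite divr_gt0.
have -> : yhat t x' - yhat t x = (x' - x) * w t - (prim (z t) x' - prim (z t) x).
  by rewrite /regular_history; ring.
apply: le_trans (ler_normB _ _) _; rewrite normrM.
have h3 : `|x' - x| * `|w t| <= eps / 2 / K * K.
  by apply: ler_pM => //; rewrite lerDr.
rewrite divfK ?gt_eqF// in h3; lra.
Unshelve. all: by end_near. Qed.

Let near_pos (s : R) : 0 < s -> 0 < mu s -> \forall s' \near s, 0 < mu s'.
Proof. by move=> s0 ms; have /cvgr_gt /(_ _ ms) := kernel_continuous hmu s0. Qed.

(** Almost everywhere [y t] is the continuous function [yhat t], so that its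
    primitive is differentiable. *)
Let prim_y_derive (t s : R) : 0 <= t -> 0 < s -> 0 < mu s ->
  is_derive s 1 (prim (y t)) (yhat t s).
Proof.
move=> t0 s0 ms.
have [s' ss' ms'] : exists2 s', s < s' & 0 < mu s'.
  have [d /= d0 hd] := near_pos s0 ms; exists (s + d / 2); first lra.
  by apply: hd; rewrite /= opprD addNKr normrN gtr0_norm; lra.
have s'0 : 0 < s' by lra.
have cy := yhat_within t0 s'0 ms'.
have iyc : leb.-integrable `[0, s'] (EFin \o yhat t).
  by apply: continuous_compact_integrable; first exact: segment_compact.
have iy : leb.-integrable `]0, s'[ (EFin \o yhat t).
  by apply: integrableS iyc => //; apply: subset_itv; rewrite bnd_simp.
have E r : 0 < r < s' -> prim (yhat t) r = prim (y t) r.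
  move=> /andP[r0 rs].
  have sub : `]0, r[ `<=` (`]0, s'[ : set R).
    by apply: subset_itvl; rewrite bnd_simp ltW.
  apply: ae_eq_Rintegral => //.
  - apply/measurable_EFinP; apply: measurable_funS (measurable_int _ iy) => //.
  - apply/measurable_EFinP.
    apply: measurable_funS (measurable_int _ (integrable_y t0 s'0 ms')) => //.
  - apply: filterS (hprim t0) => x hx; rewrite /= in_itv/= => /andP[x0 xr].
    rewrite /regular_history -hx ?addrK//.
    by apply: lt_le_trans ms' _; apply: (kernel_noninc hmu); lra.
apply: (@near_eq_is_derive _ (prim (yhat t))).
  near=> r; apply: E; apply/andP; split; near: r; [exact: lt_nbhsr|exact: lt_nbhsl].
apply: (prim_derive iy); first by rewrite s0.
apply: (within_continuous_continuous s'0 cy); by rewrite in_itv/= s0.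
Unshelve. all: by end_near. Qed.

(** Chain rule in the characteristic direction: the increment in time is
    controlled uniformly in [s] by the weighted norm, the increment in [s] at
    fixed time by [prim_y_derive]. *)
Let flow_derive (d b t : R) : 0 < t < b -> 0 < t + d -> 0 < mu (b + d) ->
  is_derive t 1 (fun t => prim (y t) (t + d)) ((t + d) * w t).
Proof.
move=> /andP[t0 tb] td mb.
have tt := ltW t0.
have bd0 : 0 < b + d by lra.
have mtd : 0 < mu (t + d) by apply: lt_le_trans mb _; apply: (kernel_noninc hmu); lra.
apply/is_derive_nearP => eps eps0.
have e3 : 0 < eps / 3 by rewrite divr_gt0.
set C := (b + d) / mu (b + d).
have C0 : 0 < C by rewrite divr_gt0.
have /is_derive_nearP Dy := prim_y_derive tt td mtd.
have := prim_continuous (ltW bd0) (integrable_z tt bd0 mb).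
move=> /within_continuous_nearP /(_ (t + d)); rewrite /= in_itv/= => cz.
have eC : 0 < (eps / 3) ^+ 2 / C by rewrite divr_gt0// exprn_gt0.
near=> h.
have h0 : h != 0 by near: h; exact: nbhs_dnbhs_neq.
have ht : `|h| <= t by near: h; exact: dnbhs0_le.
have htd : `|h| <= t + d by near: h; exact: dnbhs0_le.
have htb : `|h| <= b - t by near: h; apply: dnbhs0_le; lra.
have th0 : 0 <= t + h by move: ht; rewrite ler_norml => /andP[]; lra.
have thd : 0 <= t + d + h <= b + d.
  by move: htd htb; rewrite !ler_norml => /andP[? ?] /andP[? ?]; lra.
pose D := fun s => h^-1 * (y (t + h) s - y t s) - z t s.
have LD : in_L2 mu D.
  apply: (in_L2B hmu) (hz tt); apply: in_L2Z.
  by apply: (in_L2B hmu); exact: hy.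
have pD : prim D (t + d + h) = h^-1 * (prim (y (t + h)) (t + d + h) -
    prim (y t) (t + d + h)) - prim (z t) (t + d + h).
  have /andP[_ le] := thd.
  have i1 := integrable_y th0 bd0 mb.
  have i2 := integrable_y tt bd0 mb.
  rewrite /D (@primB _ _ _ (b + d)) ?(@primZ _ _ _ (b + d)) ?(@primB _ _ _ (b + d))//.
  - exact: integrableB_EFin.
  - by apply: integrableZ_EFin => //; exact: integrableB_EFin.
  - exact: integrable_z.
have hD : `|prim D (t + d + h)| <= eps / 3.
  rewrite -(@ler_pXn2r _ 2) ?nnegrE ?(ltW e3)// real_normK ?num_real//.
  have [_ /(_ _ thd) le] := in_L2_integral hmu bd0 mb LD.
  apply: le_trans le _; rewrite -/C mulrC -ler_pdivlMr//.
  by move: th0; rewrite /D; near: h; exact: (hyz tt _ eC).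
have hz2 : `|prim (z t) (t + d + h) - prim (z t) (t + d)| <= eps / 3.
  move: (thd); near: h; apply: cvg_within.
  have : \forall x \near t + d, 0 <= x <= b + d ->
      `|prim (z t) x - prim (z t) (t + d)| <= eps / 3.
    by apply: (cz _ _ e3); apply/andP; split; lra.
  by move/near_addP.
have hy3 : `|h^-1 * (prim (y t) (t + d + h) - prim (y t) (t + d)) - yhat t (t + d)| <= eps / 3.
  by near: h; exact: Dy.
have -> : h^-1 * (prim (y (t + h)) (t + h + d) - prim (y t) (t + d)) - (t + d) * w t =
  prim D (t + d + h) + (prim (z t) (t + d + h) - prim (z t) (t + d)) +
  (h^-1 * (prim (y t) (t + d + h) - prim (y t) (t + d)) - yhat t (t + d)).
  by rewrite pD /regular_history (addrAC t h d); ring.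
apply: le_trans (ler_normD _ _) _; have := ler_normD (prim D (t + d + h))
  (prim (z t) (t + d + h) - prim (z t) (t + d)); lra.
Unshelve. all: by end_near. Qed.

Let flow_continuous (d a b : R) : 0 <= a -> 0 <= a + d -> 0 < b + d -> 0 < mu (b + d) ->
  {within `[a, b], continuous (fun t => prim (y t) (t + d))}.
Proof.
move=> a0 ad0 bd0 mb; apply/within_continuous_nearP => t.
rewrite /= in_itv/= => /andP[tA tB] eps eps0.
have t0 : 0 <= t by lra.
have e2 : 0 < eps / 2 by rewrite divr_gt0.
set C := (b + d) / mu (b + d).
have C0 : 0 < C by rewrite divr_gt0.
have := prim_continuous (ltW bd0) (integrable_y t0 bd0 mb).
move=> /within_continuous_nearP /(_ (t + d)); rewrite /= in_itv/= => cy.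
near=> t'; rewrite in_itv/= => /andP[t'A t'B].
have t'0 : 0 <= t' by lra.
have t'd : 0 <= t' + d <= b + d by lra.
have i1 := integrable_y t'0 bd0 mb.
have i2 := integrable_y t0 bd0 mb.
have L : in_L2 mu (fun s => y t' s - y t s) by apply: (in_L2B hmu); exact: hy.
have h1 : `|prim (fun s => y t' s - y t s) (t' + d)| <= eps / 2.
  rewrite -(@ler_pXn2r _ 2) ?nnegrE ?(ltW e2)// real_normK ?num_real//.
  have [_ /(_ _ t'd) le] := in_L2_integral hmu bd0 mb L.
  apply: le_trans le _; rewrite -/C mulrC -ler_pdivlMr//.
  by move: t'0; near: t'; apply: memory_continuous => //; rewrite divr_gt0// exprn_gt0.
have h2 : `|prim (y t) (t' + d) - prim (y t) (t + d)| <= eps / 2.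
  move: (t'd); near: t'.
  have : \forall x \near t + d, 0 <= x <= b + d ->
      `|prim (y t) x - prim (y t) (t + d)| <= eps / 2.
    by apply: (cy _ _ e2); apply/andP; split; lra.
  move=> /near_addP H; apply/near_addP; apply: filterS H => h.
  by rewrite (addrAC t d h).
have -> : prim (y t') (t' + d) - prim (y t) (t + d) =
   prim (fun s => y t' s - y t s) (t' + d) +
   (prim (y t) (t' + d) - prim (y t) (t + d)).
  rewrite (@primB _ _ _ (b + d))//; [ring|by case/andP: t'd].
apply: le_trans (ler_normD _ _) _; lra.
Unshelve. all: by end_near. Qed.

(** Along the characteristics [s - t = d] the primitive of the history grows
    at the rate [(t + d) * w t], of which [(t + d) * u t - prim u t] is an
    antiderivative. *)
Let flow_balance (d a b : R) : 0 <= a -> 0 <= a + d -> a <= b -> 0 < b + d ->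
  0 < mu (b + d) ->
  prim (y a) (a + d) - ((a + d) * u a - prim u a) =
  prim (y b) (b + d) - ((b + d) * u b - prim u b).
Proof.
move=> a0 ad0 ab bd0 mb.
pose f t := prim (y t) (t + d) - ((t + d) * u t - prim u t).
apply: (@is_derive_constant _ f a b ab) => [t /andP[tA tB]|].
  have t0 : 0 < t by lra.
  have D1 : is_derive t 1 (fun t => prim (y t) (t + d)) ((t + d) * w t).
    by apply: (flow_derive (b := b)) => //; lra.
  have D2 := displacement_derive t0.
  have D3 : is_derive t 1 (prim u) (u t).
    apply: (prim_derive (displacement_integrable (t + 1))); first lra.
    exact: displacement_continuous.
  have D4 : is_derive t 1 (fun t => t + d) 1.
    have := is_deriveD (is_derive_id t 1) (is_derive_cst d t 1).
    by rewrite addr0.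
  have := is_deriveB D1 (is_deriveB (is_deriveM D4 D2) D3).
  by congr is_derive; rewrite /GRing.scale/=; ring.
have ct : {within `[a, b], continuous (fun t : R => t + d)}.
  by apply: continuous_subspaceT => x; apply: cvgD; [exact: cvg_id|exact: cvg_cst].
have sub : `[a, b] `<=` (`[0, b] : set R) by apply: subset_itvr; rewrite bnd_simp.
have cu : {within `[a, b], continuous u}.
  by apply: continuous_subspaceW sub _; exact: displacement_within.
have cpu : {within `[a, b], continuous (prim u)}.
  apply: continuous_subspaceW sub _; apply: prim_continuous; first lra.
  exact: displacement_integrable.
have cf := flow_continuous a0 ad0 bd0 mb.
move=> x; apply: cvgB; first exact: cf.
by apply: cvgB; [apply: cvgM; [exact: ct|exact: cu]|exact: cpu].
Qed.

Let derive_reflect (f : R -> R) (t s l : R) : is_derive (t - s) 1 f l ->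
  is_derive s 1 (fun s => f (t - s)) (- l).
Proof.
move=> df.
have dg : is_derive s 1 (fun s => t - s) (-1).
  by have := is_deriveB (is_derive_cst t s 1) (is_derive_id s 1); rewrite sub0r.
by have := @is_derive1_comp _ f (fun s => t - s) s l (-1) df dg; rewrite mulrN1.
Qed.

Let derive_translate (f : R -> R) (t s l : R) : is_derive (s - t) 1 f l ->
  is_derive s 1 (fun s => f (s - t)) l.
Proof.
move=> df.
have dg : is_derive s 1 (fun s => s - t) 1.
  by have := is_deriveB (is_derive_id s 1) (is_derive_cst t s 1); rewrite subr0.
by have := @is_derive1_comp _ f (fun s => s - t) s l 1 df dg; rewrite mulr1.
Qed.

Let derive_linear (k s : R) : is_derive s 1 (fun s => s * k) k.
Proof.
have := is_deriveM (is_derive_id s 1) (is_derive_cst k s 1).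
by congr is_derive; rewrite /GRing.scale/=; ring.
Qed.

(** The characteristic through [(t, s)] starts at [s = 0], where the primitive
    vanishes; the balance is then differentiated in [s]. *)
Lemma recent_history (t s : R) : 0 < s < t -> 0 < mu s -> yhat t s = u t - u (t - s).
Proof.
move=> /andP[s0 st] ms; have t0 : 0 <= t by lra.
apply: is_derive_uniq (prim_y_derive t0 s0 ms) _.
apply: (@near_eq_is_derive _ (fun s => s * u t - prim u t + prim u (t - s))).
  near=> r.
  have r0 : 0 < r by near: r; exact: lt_nbhsr.
  have rt : r < t by near: r; exact: lt_nbhsl.
  have mr : 0 < mu r by near: r; exact: near_pos.
  have := @flow_balance (r - t) (t - r) t.
  have -> : t - r + (r - t) = 0 by ring.
  have -> : t + (r - t) = r by ring.
  rewrite mul0r (prim_le0 (y (t - r)))// => B.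
  by have := B ltac:(lra) ltac:(lra) ltac:(lra) r0 mr; lra.
have D : is_derive (t - s) 1 (prim u) (u (t - s)).
  apply: (prim_derive (displacement_integrable t)); first lra.
  by apply: displacement_continuous; lra.
have := is_deriveD (is_deriveB (derive_linear (u t) s) (is_derive_cst (prim u t) s 1))
  (derive_reflect D).
by congr is_derive; ring.
Unshelve. all: by end_near. Qed.

(** Here the characteristic starts at time [0] instead. *)
Lemma old_history (t s : R) : 0 <= t -> t < s -> 0 < mu s ->
  yhat t s = u t - u 0 + yhat 0 (s - t).
Proof.
move=> t0 ts ms; have s0 : 0 < s by lra.
apply: is_derive_uniq (prim_y_derive t0 s0 ms) _.
apply: (@near_eq_is_derive _ (fun s => s * u t - prim u t +
   (prim (y 0) (s - t) - (s - t) * u 0))).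
  near=> r.
  have rt : t < r by near: r; exact: lt_nbhsr.
  have mr : 0 < mu r by near: r; exact: near_pos.
  have := @flow_balance (r - t) 0 t.
  rewrite !add0r (prim_le0 u)// (addrC t) subrK => B.
  by have := B ltac:(lra) ltac:(lra) t0 ltac:(lra) mr; lra.
have D : is_derive (s - t) 1 (prim (y 0)) (yhat 0 (s - t)).
  apply: prim_y_derive => //; first lra.
  by apply: lt_le_trans ms _; apply: (kernel_noninc hmu); lra.
have := is_deriveD (is_deriveB (derive_linear (u t) s) (is_derive_cst (prim u t) s 1))
  (is_deriveB (derive_translate D) (derive_translate (derive_linear (u 0) (s - t)))).
by congr is_derive; ring.
Unshelve. all: by end_near. Qed.

End Transport.

(** * Translations of the history variable *)

Section Translation.
Context {R : realType}.
Local Notation leb := (@lebesgue_measure R).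

Let shiftt (t : R) : measurableTypeR R -> measurableTypeR R := fun s => s - t.

Let measurable_shiftt t : measurable_fun [set: measurableTypeR R] (shiftt t).
Proof. exact: (@measurable_funB _ _ _ _ id (cst t)). Qed.

Lemma lebesgue_translation (t : R) (A : set R) : measurable A ->
  pushforward leb (shiftt t) A = leb A.
Proof.
move=> mA; apply/esym.
apply: (@lebesgue_measure_unique _ (pushforward leb (shiftt t))) => //= _ [[a b]] _ <-.
rewrite /pushforward (_ : shiftt t @^-1` _ = `]a + t, b + t]%classic); last first.
  by apply/seteqP; split=> x /=; rewrite /shiftt !in_itv/= ltrBrDr lerBlDr.
by rewrite !lebesgue_measure_itv/= !lte_fin ltrD2r; case: ifP => // _;
  rewrite -!EFinD; congr EFin; ring.
Qed.

Lemma ae_translate (t : R) (P : R -> Prop) :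
  {ae leb, forall s, P s} -> {ae leb, forall s, P (s - t)}.
Proof.
case=> N [mN N0 PN]; exists (shiftt t @^-1` N); split.
- by rewrite -[X in measurable X]setTI; exact: measurable_shiftt.
- by rewrite -N0 -(lebesgue_translation t mN).
- by move=> s hs; apply: PN.
Qed.

Lemma ge0_integral_translate (t : R) (f : R -> \bar R) :
  measurable_fun (`]0, +oo[ : set R) f ->
  (forall s, 0 < s -> (0 <= f s)%E) ->
  (\int[leb]_(s in `]t, +oo[) f (s - t)%R = \int[leb]_(s in `]0%R, +oo[) f s)%E.
Proof.
move=> mf f0; rewrite (_ : `]t, +oo[%classic = shiftt t @^-1` `]0, +oo[%classic); last first.
  by apply/seteqP; split=> x /=; rewrite /shiftt !in_itv/= !andbT subr_gt0.
rewrite -[LHS](@ge0_integral_pushforward _ _ _ _ _ _ (@measurable_shiftt t) leb _ f)//=.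
- by apply: eq_measure_integral => //= A mA AS; exact: lebesgue_translation.
- by move=> s; rewrite inE/= in_itv/= andbT; exact: f0.
Qed.

End Translation.

Section Representation.
Context {R : realType}.
Local Notation leb := (@lebesgue_measure R).
Variables (mu : R -> R) (delta : R).
Hypothesis hmu : memory_kernel mu delta.

Let mhalf : measurable (`]0, +oo[ : set (measurableTypeR R)).
Proof. exact: measurable_itv. Qed.

(** A nonincreasing kernel gives the translated history at most its original
    weight. *)
Lemma translated_memory_le (t : R) (G : R -> R) : 0 <= t ->
  measurable_fun (`]0, +oo[ : set R) G ->
  (forall s, 0 < s -> 0 <= G s) ->
  leb.-integrable `]0, +oo[ (EFin \o (fun s => mu s * G s)) ->
  let Gt := (fun s => G (s - t)) \_ `]t, +oo[ in
  leb.-integrable `]0, +oo[ (EFin \o (fun s => mu s * Gt s)) /\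
  \int[leb]_(s in `]0, +oo[) (mu s * Gt s) <= \int[leb]_(s in `]0, +oo[) (mu s * G s).
Proof.
move=> t0 mG G0 iG Gt.
have Gt0 s : 0 <= Gt s.
  rewrite /Gt patchE; case: ifPn => //; rewrite inE/= in_itv/= andbT => ts.
  by apply: G0; rewrite subr_gt0.
have mGt : measurable_fun (`]0, +oo[ : set R) Gt.
  apply: measurable_funS (measurableT) _ _ => //.
  apply/(measurable_restrictT _ _).1 => //.
  have -> : (fun s => G (s - t)) = G \o (shift (- t)) by [].
  apply: (@measurable_comp _ _ _ _ _ _ (`]0, +oo[ : set R)) => //.
  - by move=> _ [s /= + <-]; rewrite /= !in_itv/= !andbT subr_gt0.
  - by apply: measurable_funTS; exact: measurable_funD.
have mG' : measurable_fun (`]0, +oo[ : set R) (fun s => (mu s * G s)%:E).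
  by apply/measurable_EFinP; apply: measurable_funM => //; exact: (kernel_measurable hmu).
have mu0 s : 0 < s -> 0 <= mu s by move=> s0; apply: (kernel_ge0 hmu); rewrite ltW.
have le : (\int[leb]_(s in `]0%R, +oo[) (mu s * Gt s)%R%:E <=
    \int[leb]_(s in `]0%R, +oo[) (mu s * G s)%R%:E)%E.
  rewrite -[leRHS](@ge0_integral_translate _ t)//; last first.
    by move=> s s0; rewrite lee_fin mulr_ge0 ?mu0 ?G0.
  rewrite [leRHS](_ : _ = \int[leb]_(s in `]0%R, +oo[ `&` `]t, +oo[)
      (mu (s - t)%R * G (s - t)%R)%R%:E)%E; last first.
    congr (integral _ _ _); apply/esym/setIidPr.
    by apply: subset_itvr; rewrite bnd_simp.
  rewrite integral_mkcondr; apply: le_integralT => s; rewrite /= in_itv/= andbT => s0.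
    by rewrite lee_fin mulr_ge0// mu0.
  rewrite /Gt !patchE; case: ifPn => [|_]; last by rewrite mulr0.
  rewrite inE/= in_itv/= andbT => ts; rewrite lee_fin; apply: ler_wpM2r.
    by apply: G0; rewrite subr_gt0.
  by apply: (kernel_noninc hmu); lra.
have i : leb.-integrable `]0, +oo[ (EFin \o (fun s => mu s * Gt s)).
  apply: integrable_ge0.
  - by apply: measurable_funM => //; exact: (kernel_measurable hmu).
  - by move=> s; rewrite /= in_itv/= andbT => s0; rewrite mulr_ge0// mu0.
  - by apply: le_lt_trans le _; exact: integrable_lty.
by split => //; rewrite /Rintegral fine_le//; exact: integrable_fin_num.
Qed.

Variables (y z : R -> R -> R) (u w : R -> R).
Hypothesis hy : forall t : R, 0 <= t -> in_L2 mu (y t).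
Hypothesis hz : forall t : R, 0 <= t -> in_L2 mu (z t).
Hypothesis hyz : forall t : R, 0 <= t -> vanishes_at t
  (fun h => sqint mu (fun s => h^-1 * (y (t + h) s - y t s) - z t s)).
Hypothesis hprim : forall t : R, 0 <= t -> {ae leb, forall s, 0 < s -> 0 < mu s ->
  y t s + prim (z t) s = s * w t}.
Hypothesis huw : forall t : R, 0 <= t -> vanishes_at t
  (fun h => `|h^-1 * (u (t + h) - u t) - w t|).

(** This is the classical formula [eta^t(s) = u(t) - u(t - s)], the displacement
    at negative times being read off the initial history.  The two previous
    lemmas give it for the regular representatives; the null set on which the
    initial history differs from its own has to be translated by [t]. *)
Lemma memory_representation (t : R) : 0 <= t ->
  {ae leb, forall s, 0 < s -> 0 < mu s ->
    (s < t -> u t - y t s = u (t - s)) /\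
    (t < s -> u t - y t s = u 0 - y 0 (s - t))}.
Proof.
move=> t0; have := ae_translate t (hprim (lexx 0)).
apply: filterS2 (hprim t0) => s ht h0 s0 ms; split=> [st|ts].
  have := recent_history hmu hy hz hyz hprim huw (t := t) (s := s).
  by rewrite /regular_history s0 st -(ht s0 ms) addrK => -> //; lra.
have := old_history hmu hy hz hyz hprim huw t0 ts ms.
have st0 : 0 < s - t by lra.
have mst : 0 < mu (s - t).
  by apply: lt_le_trans ms _; apply: (kernel_noninc hmu); lra.
by rewrite /regular_history -(ht s0 ms) -(h0 st0 mst) !addrK => ->; ring.
Qed.

End Representation.

(** * Modes of a history *)

Section Modes.
Context {R : realType} {H : completeNormedModType R}.
Local Notation leb := (@lebesgue_measure R).
Variables (dot : H -> H -> R) (DA : set H) (A : H -> H) (lam : R^nat) (e : nat -> H).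
Hypothesis hdot : hilbert_dot dot.
Hypothesis he : orthonormal_eigenbasis dot DA A lam e.

Definition mode (eta : R -> H) (k : nat) : R -> R := fun s => dot (eta s) (e k).

Lemma modeE eta k s : mode eta k s = dot (eta s) (e k).
Proof. by []. Qed.

Lemma modeZ a eta k : mode (a *: eta) k = fun s => a * mode eta k s.
Proof. by apply/funext => s; rewrite /mode /= (dotZl hdot). Qed.

Lemma modeD eta zeta k : mode (eta + zeta) k = fun s => mode eta k s + mode zeta k s.
Proof. by apply/funext => s; rewrite /mode /= (dotDl hdot). Qed.

Lemma modeB eta zeta k : mode (eta - zeta) k = fun s => mode eta k s - mode zeta k s.
Proof. by apply/funext => s; rewrite /mode /= (dotBl hdot). Qed.

Lemma measurable_mode (eta : R -> H) k :
  measurable_half eta -> measurable_fun (`]0, +oo[ : set R) (mode eta k).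
Proof.
move=> meta; pose phi (x : g_sigma_algebraType (@open H)) : R := dot x (e k).
have mphi : measurable_fun [set: g_sigma_algebraType (@open H)] phi.
  apply: (measurability (RGenOpens.G (R:=R))); first exact: RGenOpens.measurableE.
  move=> _ [_ [a [b ->]] <-]; rewrite setTI; apply: sub_sigma_algebra.
  have : continuous (fun x : H => dot x (e k)).
    by move=> x; apply: (cvg_dotl hdot); exact: cvg_id.
  by move=> /continuousP; apply; exact: interval_open.
exact: (measurableT_comp mphi meta).
Qed.

Variables (mu : R -> R) (delta : R).
Hypothesis hmu : memory_kernel mu delta.

Let mhalf : measurable (`]0, +oo[ : set (measurableTypeR R)).
Proof. exact: measurable_itv. Qed.

(** Only finite sums over the modes are integrated, so that series and integrals
    are never exchanged. *)
Lemma sqint_mode_sum (r : R) (eta : R -> H) m n :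
  (forall k, in_L2 mu (mode eta k)) ->
  ((\sum_(m <= k < n) (lam k `^ r) ^+ 2 * sqint mu (mode eta k))%:E <=
   mem_norm2 dot lam e mu r eta)%E.
Proof.
move=> hL.
have iL k : leb.-integrable `]0, +oo[
    (EFin \o (fun s => (lam k `^ r) ^+ 2 * (mu s * mode eta k s ^+ 2))).
  by apply: integrableZ_EFin => //; case: (hL k).
have E : (\int[leb]_(s in `]0%R, +oo[) (\sum_(m <= k < n)
     (lam k `^ r) ^+ 2 * (mu s * mode eta k s ^+ 2))%R%:E)%E =
   (\sum_(m <= k < n) (lam k `^ r) ^+ 2 * sqint mu (mode eta k))%:E.
  under eq_integral do rewrite -sumEFin.
  rewrite integral_sum//.
  rewrite -sumEFin; apply: eq_bigr => k _.
  rewrite -RintegralZl//; last by case: (hL k).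
  by rewrite fineK//; apply: integrable_fin_num => //; exact: iL.
rewrite -E; apply: le_integralT => s; rewrite /= in_itv/= andbT => s0.
  rewrite lee_fin sumr_ge0// => k _; rewrite mulr_ge0 ?sqr_ge0//.
  by rewrite mulr_ge0 ?sqr_ge0// (kernel_ge0 hmu)// ltW.
have mus : 0 <= mu s by rewrite (kernel_ge0 hmu)// ltW.
apply: le_trans (lee_pmul _ _ (lexx (mu s)%:E) (Fnorm_partial_sum hdot he r (eta s) m n)).
- rewrite -EFinM lee_fin mulr_sumr; apply: ler_sum => k _.
  by rewrite /mode exprMn; lra.
- by rewrite lee_fin.
- by rewrite lee_fin sumr_ge0// => k _; rewrite sqr_ge0.
Qed.

Lemma L2mem_mode (r : R) (eta : R -> H) k :
  L2mem dot lam e mu r eta -> in_L2 mu (mode eta k).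
Proof.
move=> [meta ieta]; have mk := measurable_mode k meta; split => //.
have l0 : 0 < (lam k `^ r) ^+ 2 by rewrite exprn_gt0// powR_gt0// (eigen_gt0 he).
have mm : measurable_fun (`]0, +oo[ : set R) (fun s => mu s * mode eta k s ^+ 2).
  by apply: measurable_funM; [exact: (kernel_measurable hmu)|exact: measurable_funX].
have ge0 s : `]0, +oo[%classic s -> 0 <= mu s * mode eta k s ^+ 2.
  exact: (kernel_sqr_ge0 hmu).
have : leb.-integrable `]0, +oo[
    (EFin \o (fun s => (lam k `^ r) ^+ 2 * (mu s * mode eta k s ^+ 2))).
  apply: integrable_ge0.
  - exact: measurable_funM.
  - by move=> s hs; rewrite mulr_ge0 ?ge0 ?ltW.
  - apply: le_lt_trans ieta; apply: le_integralT => s hs.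
      by rewrite lee_fin mulr_ge0 ?ge0 ?ltW.
    have mus : 0 <= mu s.
      by move: hs; rewrite /= in_itv/= andbT => /ltW; exact: (kernel_ge0 hmu).
    apply: le_trans (lee_pmul _ _ (lexx (mu s)%:E)
      (Fnorm_partial_sum hdot he r (eta s) k k.+1)).
    + by rewrite big_nat1 -EFinM lee_fin /mode exprMn; lra.
    + by rewrite lee_fin.
    + by rewrite lee_fin sumr_ge0// => i _; rewrite sqr_ge0.
move=> /(integrableZ_EFin ((lam k `^ r) ^+ 2)^-1 mhalf).
by apply: eq_integrable => // s _ /=; rewrite mulKf// gt_eqF.
Qed.

Lemma sqint_eq0 (c : R -> R) : in_L2 mu c -> sqint mu c = 0 ->
  {ae leb, forall s, 0 < s -> 0 < mu s -> c s = 0}.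
Proof.
move=> [mc ic] c0.
have mc' : measurable_fun (`]0, +oo[ : set R) (EFin \o (fun s => mu s * c s ^+ 2)).
  exact: (measurable_int _ ic).
have /(ae_eq_integral_abs _ mhalf mc').1 :
    (\int[leb]_(s in `]0%R, +oo[) `|(mu s * c s ^+ 2)%:E|)%E = 0%E.
  transitivity (sqint mu c)%:E; last by rewrite c0.
  rewrite /sqint fineK; last exact: integrable_fin_num.
  apply: eq_integral => s; rewrite inE => hs; rewrite /= ger0_norm//.
  exact: (kernel_sqr_ge0 hmu).
apply: filterS => s + s0 ms; rewrite /= in_itv/= andbT => /(_ s0) [/eqP].
by rewrite mulf_eq0 (gt_eqF ms)/= expf_eq0/= => /eqP.
Qed.

(** Integrating the history equation [zeta = - eta_s + h] over [0, s] eliminates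
    the derivative in [s], which is only known through a chosen representative. *)
Lemma history_integrated (r : R) (eta zeta : R -> H) (h : H) k :
  domT dot lam e mu r eta -> (forall k, in_L2 mu (mode zeta k)) ->
  mem_norm2 dot lam e mu r (zeta - (Top dot lam e mu r eta + cst h)) = 0%E ->
  {ae leb, forall s, 0 < s -> 0 < mu s ->
    mode eta k s + prim (mode zeta k) s = s * dot h (e k)}.
Proof.
move=> [_ hex] hz; have := xgetPex 0 hex; rewrite /Top.
set xi := xget 0 _ => -[Lxi hxi] h0.
have Lxik j := L2mem_mode j Lxi.
have E j : mode (zeta - (- xi + cst h)) j =
    (fun s => mode zeta j s + mode xi j s - dot h (e j)).
  apply/funext => s; rewrite /mode /= (dotBl hdot) (dotDl hdot) (dotNl hdot).
  by rewrite opprD opprK addrA.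
have LE j : in_L2 mu (mode (zeta - (- xi + cst h)) j).
  rewrite E; apply: (in_L2B hmu); first exact: (in_L2D hmu).
  exact: (in_L2_cst hmu).
have q0 : sqint mu (mode (zeta - (- xi + cst h)) k) = 0.
  apply/eqP; rewrite eq_le (sqint_ge0 hmu) andbT.
  have := sqint_mode_sum r k k.+1 LE; rewrite h0 big_nat1 lee_fin.
  by rewrite pmulr_rle0// exprn_gt0// powR_gt0// (eigen_gt0 he).
have ae0 := sqint_eq0 (LE k) q0; rewrite E in ae0.
apply: filterS hxi => s hs s0 ms.
have -> : mode eta k s = prim (mode xi k) s.
  by rewrite [LHS](hs s0 ms k) /coef (dot0l hdot) add0r.
have [iz _] := in_L2_integral hmu s0 ms (hz k).
have [ix _] := in_L2_integral hmu s0 ms (Lxik k).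
have icst : leb.-integrable `]0, s[ (EFin \o (fun=> dot h (e k))).
  by have [] := in_L2_integral hmu s0 ms (in_L2_cst hmu (dot h (e k))).
have -> : prim (mode zeta k) s = \int[leb]_(x in `]0, s[) (dot h (e k) - mode xi k x).
  apply: ae_eq_Rintegral => //.
  - by apply/measurable_EFinP; exact: (measurable_int _ iz).
  - by apply/measurable_EFinP; apply: (measurable_int leb); exact: integrableB_EFin.
  - apply: filterS ae0 => x hx; rewrite /= in_itv/= => /andP[x0 xs].
    have mx : 0 < mu x by apply: lt_le_trans ms _; apply: (kernel_noninc hmu); lra.
    by have := hx x0 mx; lra.
rewrite RintegralB// Rintegral_cst//= lebesgue_measure_itv/= lte_fin s0 oppr0 adde0/=.
by rewrite /prim addrC subrK mulrC.
Qed.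

End Modes.

(** * Uniform tails on compact time intervals *)

Section UniformTails.
Context {R : realType}.

Lemma bounded_sum_tail (q : nat -> R) (B : R) : (forall k, 0 <= q k) ->
  (forall n, \sum_(0 <= k < n) q k <= B) ->
  forall eps : R, 0 < eps ->
  exists N, forall m n, (N <= m)%N -> \sum_(m <= k < n) q k <= eps.
Proof.
move=> q0 qB eps eps0.
have nd : nondecreasing_seq (series q) by apply: nondecreasing_series => k _ _.
have cq : cvgn (series q).
  by apply: nondecreasing_is_cvgn => //; exists B => _ [n _ <-]; exact: qB.
have /cvgrPdist_le /(_ _ eps0) [N _ hN] := cq.
exists N => m n Nm; have [mn|nm] := leqP m n; last by rewrite (big_geq (ltnW nm)) ltW.
have -> : \sum_(m <= k < n) q k = series q n - series q m.
  by rewrite sub_series_geq.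
have := hN m Nm; rewrite /= ger0_norm; last first.
  by rewrite subr_ge0; exact: nondecreasing_cvgn_le.
have := nondecreasing_cvgn_le nd cq n; lra.
Qed.

Variable q : R -> nat -> R.
Hypothesis q0 : forall t k, 0 <= q t k.
Hypothesis qB : forall t : R, 0 <= t -> exists B, forall n, \sum_(0 <= k < n) q t k <= B.
Hypothesis q_local : forall t : R, 0 <= t -> forall eps : R, 0 < eps ->
  \forall t' \near t, 0 <= t' -> forall m n,
    \sum_(m <= k < n) q t' k <= 2 * \sum_(m <= k < n) q t k + eps.

(** Dini's argument: on a compact time interval the tails are small uniformly,
    because near each time they are controlled by the tail at that time. *)
Lemma uniform_tails (T eps : R) : 0 < eps ->
  exists N, forall t, 0 <= t <= T -> forall m n, (N <= m)%N ->
    \sum_(m <= k < n) q t k <= eps.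
Proof.
move=> eps0; have e2 : 0 < eps / 2 by rewrite divr_gt0.
have e4 : 0 < eps / 4 by rewrite divr_gt0.
pose P (N : nat) (t : R) := forall m n, (N <= m)%N -> \sum_(m <= k < n) q t k <= eps.
have : \forall N \near \oo, `[0, T] `<=` (P N : set R).
  have /compact_near_coveringP/near_covering_withinP cov := @segment_compact R 0 T.
  apply: (cov nat \oo P).
  move=> t; rewrite /= in_itv/= => /andP[t0 _].
  have [B hB] := qB t0; have [N hN] := bounded_sum_tail (q0 t) hB e4.
  exists ([set t' | 0 <= t' -> forall m n, \sum_(m <= k < n) q t' k <=
    2 * \sum_(m <= k < n) q t k + eps / 2], [set n | (N <= n)%N]).
    by split; [exact: q_local|exists N].
  move=> [t' n'] [/= h Nn'] t'T m n n'm.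
  have t'0 : 0 <= t' by move: t'T; rewrite in_itv/= => /andP[].
  by have := h t'0 m n; have := hN m n (leq_trans Nn' n'm); lra.
case=> N _ /(_ N (leqnn N)) hN; exists N => t tT m n Nm.
by apply: hN => //; rewrite /= in_itv.
Qed.

Lemma uniform_bound (T : R) :
  exists B, forall t, 0 <= t <= T -> forall n, \sum_(0 <= k < n) q t k <= B.
Proof.
pose P (N : nat) (t : R) := forall n, \sum_(0 <= k < n) q t k <= N%:R.
have : \forall N \near \oo, `[0, T] `<=` (P N : set R).
  have /compact_near_coveringP/near_covering_withinP cov := @segment_compact R 0 T.
  apply: (cov nat \oo P).
  move=> t; rewrite /= in_itv/= => /andP[t0 _].
  have [B hB] := qB t0.
  exists ([set t' | 0 <= t' -> forall m n, \sum_(m <= k < n) q t' k <=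
    2 * \sum_(m <= k < n) q t k + 1], [set n : nat | 2 * B + 1 <= n%:R]).
    by split; [exact: q_local|exact: nbhs_infty_ger].
  move=> [t' n'] [/= h Nn'] t'T n.
  have t'0 : 0 <= t' by move: t'T; rewrite in_itv/= => /andP[].
  by have := h t'0 0%N n; have := hB n; lra.
case=> N _ /(_ N (leqnn N)) hN; exists N%:R => t tT n.
by apply: hN => //; rewrite /= in_itv.
Qed.

End UniformTails.

(** * Modal energies of the phase space *)

Section Energy.
Context {R : realType} {H : completeNormedModType R}.
Local Notation leb := (@lebesgue_measure R).
Variables (dot : H -> H -> R) (DA : set H) (A : H -> H) (lam : R^nat) (e : nat -> H).
Hypothesis hdot : hilbert_dot dot.
Hypothesis he : orthonormal_eigenbasis dot DA A lam e.
Variables (mu1 mu2 : R -> R) (delta1 delta2 : R).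
Hypothesis hmu1 : memory_kernel mu1 delta1.
Hypothesis hmu2 : memory_kernel mu2 delta2.

Local Notation mode := (mode dot e).

(** The contribution of the [k]-th mode to the square of the phase norm. *)
Definition energy (x : @state R H) (k : nat) : R :=
  lam k ^+ 2 * dot x.1.1.1.1 (e k) ^+ 2 + dot x.1.1.1.2 (e k) ^+ 2 +
  dot x.1.1.2 (e k) ^+ 2 + lam k ^+ 2 * sqint mu1 (mode x.1.2 k) +
  lam k * sqint mu2 (mode x.2 k).

(** What membership in the phase space says about single modes.  Unlike
    measurability of functions with values in [H], it is visibly stable under
    linear combinations. *)
Definition modal (x : @state R H) : Prop :=
  forall k, in_L2 mu1 (mode x.1.2 k) /\ in_L2 mu2 (mode x.2 k).

Lemma energy_ge0 x k : 0 <= energy x k.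
Proof.
have l0 := eigen_gt0 he k.
by rewrite !addr_ge0 ?sqr_ge0// mulr_ge0 ?sqr_ge0 ?(sqint_ge0 hmu1) ?(sqint_ge0 hmu2)// ltW.
Qed.

Lemma energy_parts (x : @state R H) k :
  [/\ lam k ^+ 2 * dot x.1.1.1.1 (e k) ^+ 2 <= energy x k,
      dot x.1.1.1.2 (e k) ^+ 2 <= energy x k,
      lam k ^+ 2 * sqint mu1 (mode x.1.2 k) <= energy x k &
      lam k * sqint mu2 (mode x.2 k) <= energy x k].
Proof.
have h1 := mulr_ge0 (sqr_ge0 (lam k)) (sqr_ge0 (dot x.1.1.1.1 (e k))).
have h2 := sqr_ge0 (dot x.1.1.1.2 (e k)).
have h3 := sqr_ge0 (dot x.1.1.2 (e k)).
have h4 := mulr_ge0 (sqr_ge0 (lam k)) (sqint_ge0 hmu1 (mode x.1.2 k)).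
have h5 := mulr_ge0 (ltW (eigen_gt0 he k)) (sqint_ge0 hmu2 (mode x.2 k)).
rewrite /energy; split; lra.
Qed.

Lemma modalZ a x : modal x -> modal (a *: x).
Proof.
by move=> h k; have [h1 h2] := h k; rewrite !(modeZ e hdot); split; exact: in_L2Z.
Qed.

Lemma modalD x y : modal x -> modal y -> modal (x + y).
Proof.
move=> hx hy k; have [h1 h2] := hx k; have [h3 h4] := hy k.
by rewrite !(modeD e hdot); split; [exact: (in_L2D hmu1)|exact: (in_L2D hmu2)].
Qed.

Lemma modalB x y : modal x -> modal y -> modal (x - y).
Proof. by move=> hx hy; rewrite -scaleN1r; apply: modalD => //; exact: modalZ. Qed.

Lemma energyZ a x k : modal x -> energy (a *: x) k = a ^+ 2 * energy x k.
Proof.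
move=> /(_ k)[h1 h2]; rewrite /energy !(modeZ e hdot) !sqintZ//= !(dotZl hdot); ring.
Qed.

Lemma energyD x y k : modal x -> modal y ->
  energy (x + y) k <= 2 * energy x k + 2 * energy y k.
Proof.
move=> /(_ k)[h1 h2] /(_ k)[h3 h4]; rewrite /energy !(modeD e hdot)/= !(dotDl hdot).
have l0 := ltW (eigen_gt0 he k); have l2 := sqr_ge0 (lam k).
have sq (a b : R) : (a + b) ^+ 2 <= 2 * a ^+ 2 + 2 * b ^+ 2.
  by have := sqr_ge0 (a - b); lra.
have := ler_wpM2l l2 (sq (dot x.1.1.1.1 (e k)) (dot y.1.1.1.1 (e k))).
have := sq (dot x.1.1.1.2 (e k)) (dot y.1.1.1.2 (e k)).
have := sq (dot x.1.1.2 (e k)) (dot y.1.1.2 (e k)).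
have := ler_wpM2l l2 (sqintD hmu1 h1 h3).
have := ler_wpM2l l0 (sqintD hmu2 h2 h4).
rewrite !mulrDr ![_ * (2 * _)]mulrCA; lra.
Qed.

Lemma phase_modal x : phase_space dot lam e mu1 mu2 x -> modal x.
Proof.
case: x => [[[[u w] v] etab] eta] [_ h1 h2] k.
by split; [exact: (L2mem_mode hdot he hmu1 k h1)|exact: (L2mem_mode hdot he hmu2 k h2)].
Qed.

Let phase_sq (x : @state R H) : \bar R :=
  (Fnorm dot lam e 1 x.1.1.1.1 ^+ 2 + (`|x.1.1.1.2| ^+ 2)%:E + (`|x.1.1.2| ^+ 2)%:E
   + mem_norm2 dot lam e mu1 1 x.1.2 + mem_norm2 dot lam e mu2 2^-1 x.2)%E.

Let phase_normE x : phase_norm dot lam e mu1 mu2 x = sqrte (phase_sq x).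
Proof. by case: x => [[[[u w] v] etab] eta]. Qed.

Lemma energy_phase_sq x m n : modal x ->
  ((\sum_(m <= k < n) energy x k)%:E <= phase_sq x)%E.
Proof.
move=> hx; rewrite /energy !big_split/= !EFinD; apply: leeD; last first.
  apply: le_trans (sqint_mode_sum hdot he hmu2 2^-1 m n _); last by move=> k; case: (hx k).
  by rewrite lee_fin; apply: ler_sum => k _; rewrite (powR_half he).
apply: leeD; last first.
  apply: le_trans (sqint_mode_sum hdot he hmu1 1 m n _); last by move=> k; case: (hx k).
  by rewrite lee_fin; apply: ler_sum => k _; rewrite (powR_one he).
apply: leeD; last by rewrite lee_fin; exact: (bessel hdot he).
apply: leeD; last by rewrite lee_fin; exact: (bessel hdot he).
apply: le_trans (Fnorm_partial_sum hdot he 1 _ m n).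
by rewrite lee_fin; apply: ler_sum => k _; rewrite (powR_one he) exprMn.
Qed.

Let phase_sq_ge0 x : modal x -> (0 <= phase_sq x)%E.
Proof.
by move=> hx; have := energy_phase_sq 0 0 hx; rewrite big_geq.
Qed.

(** Convergence in the phase space is used only through this inequality. *)
Lemma energy_phase_norm x (eps : R) m n : modal x ->
  (phase_norm dot lam e mu1 mu2 x <= eps%:E)%E ->
  \sum_(m <= k < n) energy x k <= eps ^+ 2.
Proof.
move=> hx; rewrite phase_normE; have := energy_phase_sq m n hx.
have := phase_sq_ge0 hx; case: (phase_sq x) => [r| |]//=.
rewrite !lee_fin => r0 hr hs; apply: le_trans hr _.
rewrite -[X in X <= _]sqr_sqrtr// ler_pXn2r// nnegrE ?sqrtr_ge0//.
exact: le_trans (sqrtr_ge0 _) hs.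
Qed.

Lemma energy_bounded x : phase_space dot lam e mu1 mu2 x ->
  exists B, forall n, \sum_(0 <= k < n) energy x k <= B.
Proof.
move=> px; have hx := phase_modal px.
have fin : (phase_sq x < +oo)%E.
  move: px; case: x {hx} => [[[[u w] v] etab] eta] [hu [_ h1] [_ h2]].
  rewrite /phase_sq; apply: lte_add_pinfty; last exact: h2.
  apply: lte_add_pinfty; last exact: h1.
  apply: lte_add_pinfty; last exact: ltry.
  apply: lte_add_pinfty; last exact: ltry.
  rewrite [X in (X ^+ 2)%E]/Fnorm.
  by case: ifPn => [_|/asboolP//]; rewrite -EFin_expe ltry.
exists (fine (phase_sq x)) => n; rewrite -lee_fin fineK; first exact: energy_phase_sq.
by rewrite ge0_fin_numE// phase_sq_ge0.
Qed.

End Energy.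

Section Evolution.
Context {R : realType} {H : completeNormedModType R}.
Local Notation leb := (@lebesgue_measure R).
Variables (dot : H -> H -> R) (DA : set H) (A : H -> H) (lam : R^nat) (e : nat -> H).
Hypothesis hdot : hilbert_dot dot.
Hypothesis he : orthonormal_eigenbasis dot DA A lam e.
Variables (mu1 mu2 : R -> R) (delta1 delta2 : R).
Hypothesis hmu1 : memory_kernel mu1 delta1.
Hypothesis hmu2 : memory_kernel mu2 delta2.
Variables U dU : R -> @state R H.
Hypothesis hU : C1_phase dot lam e mu1 mu2 U dU.

Local Notation energy := (energy dot lam e mu1 mu2).
Local Notation modal := (modal dot e mu1 mu2).

Lemma solution_modal (t : R) : 0 <= t -> modal (U t) /\ modal (dU t).
Proof.
case: hU => h _ _ /h [h1 h2].
by split; apply: (phase_modal hdot he hmu1 hmu2).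
Qed.

Lemma cvge0_near (T : Type) (F : set_system T) {FF : Filter F} (f : T -> \bar R) :
  (f t @[t --> F] --> 0%E)%classic -> forall eps : R, 0 < eps ->
  \forall t \near F, (f t <= eps%:E)%E.
Proof.
move=> /fine_cvgP[ff /cvgrPdist_le fc] eps eps0.
near=> t; have ft : f t \is a fin_num by near: t.
rewrite -(fineK ft) lee_fin; apply: le_trans (ler_norm _) _.
by rewrite -normrN -sub0r; near: t; exact: fc.
Unshelve. all: by end_near. Qed.

Lemma solution_differentiable (t : R) : 0 <= t -> forall eps : R, 0 < eps ->
  \forall h \near 0^', 0 <= t + h -> forall m n,
    \sum_(m <= k < n) energy (h^-1 *: (U (t + h) - U t) - dU t) k <= eps.
Proof.
move=> t0 eps eps0; case: hU => _ /(_ t t0) hd _.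
have s0 : 0 < Num.sqrt eps by rewrite sqrtr_gt0.
have : \forall h \near within [set h | 0 <= t + h] 0^',
  (phase_norm dot lam e mu1 mu2 (h^-1 *: (U (t + h) - U t) - dU t)%R <= (Num.sqrt eps)%:E)%E.
  exact: cvge0_near hd _ s0.
rewrite near_withinE; apply: filterS => h hh th m n.
rewrite -(sqr_sqrtr (ltW eps0)).
apply: (energy_phase_norm hdot he hmu1 hmu2 _ _ _ (hh th)).
have [mt mdt] := solution_modal t0; have [mth _] := solution_modal th.
apply: (modalB hdot hmu1 hmu2) => //; apply: (modalZ hdot).
exact: (modalB hdot hmu1 hmu2).
Qed.

Let sum_energyD m n x y : modal x -> modal y ->
  \sum_(m <= k < n) energy (x + y) k <=
  2 * \sum_(m <= k < n) energy x k + 2 * \sum_(m <= k < n) energy y k.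
Proof.
move=> hx hy; rewrite !mulr_sumr -big_split/=; apply: ler_sum => k _.
exact: (energyD hdot he hmu1 hmu2).
Qed.

Let sum_energyZ m n a x : modal x ->
  \sum_(m <= k < n) energy (a *: x) k = a ^+ 2 * \sum_(m <= k < n) energy x k.
Proof.
by move=> hx; rewrite mulr_sumr; apply: eq_bigr => k _; rewrite (energyZ lam hdot).
Qed.

Lemma solution_continuous (t : R) : 0 <= t -> forall eps : R, 0 < eps ->
  \forall t' \near t, 0 <= t' -> forall m n,
    \sum_(m <= k < n) energy (U t' - U t) k <= eps.
Proof.
move=> t0 eps eps0; have [mt mdt] := solution_modal t0.
apply/near_addP; apply: near_dnbhs0.
  move=> _ m n; rewrite addr0.
  have -> : U t - U t = 0 *: U t by rewrite subrr scale0r.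
  by rewrite sum_energyZ// expr2 !mul0r ltW.
have [B hB] : exists B, forall m n, \sum_(m <= k < n) energy (dU t) k <= B.
  case: hU => /(_ t t0) [_ pdt] _ _.
  have [B hB] := energy_bounded hdot he hmu1 hmu2 pdt; exists B => m n.
  apply: le_trans (hB n); have [mn|nm] := leqP m n.
    rewrite [leRHS](big_cat_nat _ mn)//= lerDr sumr_ge0// => k _.
    exact: (energy_ge0 he hmu1 hmu2).
  rewrite (big_geq (ltnW nm)) sumr_ge0// => k _.
  exact: (energy_ge0 he hmu1 hmu2).
have B0 : 0 <= B by have := hB 0%N 0%N; rewrite big_geq.
set K := 2 + 2 * B.
have K0 : 0 < K by rewrite ltr_pwDl// mulr_ge0.
near=> h => th m n.
have h0 : h != 0 by near: h; exact: nbhs_dnbhs_neq.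
have [mth _] := solution_modal th.
pose D := h^-1 *: (U (t + h) - U t) - dU t.
have mD : modal D.
  apply: (modalB hdot hmu1 hmu2) => //; apply: (modalZ hdot).
  exact: (modalB hdot hmu1 hmu2).
have D1 : \sum_(m <= k < n) energy D k <= 1.
  by move: th m n {mD}; rewrite /D; near: h; exact: solution_differentiable.
have -> : U (t + h) - U t = h *: (D + dU t).
  by rewrite /D subrK scalerA mulfV// scale1r.
rewrite sum_energyZ; last exact: (modalD hdot hmu1 hmu2).
have := sum_energyD m n mD mdt; have := hB m n => h1 h2.
have XK : \sum_(m <= k < n) energy (D + dU t) k <= K by rewrite /K; lra.
have hK : h ^+ 2 * K <= eps.
  rewrite -ler_pdivlMr// -[h ^+ 2]ger0_norm ?sqr_ge0// normrX.
  have : `|h| <= Num.sqrt (eps / K).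
    by near: h; apply: dnbhs0_le; rewrite sqrtr_gt0 divr_gt0.
  rewrite -(@ler_pXn2r _ 2) ?nnegrE ?sqrtr_ge0//.
  by rewrite sqr_sqrtr// divr_ge0// ltW.
by apply: le_trans hK; apply: ler_wpM2l => //; exact: sqr_ge0.
Unshelve. all: by end_near. Qed.

Lemma derivative_continuous (t : R) : 0 <= t -> forall eps : R, 0 < eps ->
  \forall t' \near t, 0 <= t' -> forall m n,
    \sum_(m <= k < n) energy (dU t' - dU t) k <= eps.
Proof.
move=> t0 eps eps0; case: hU => _ _ /(_ t t0) hd.
have s0 : 0 < Num.sqrt eps by rewrite sqrtr_gt0.
have : \forall t' \near within [set t' | 0 <= t'] (nbhs t),
  (phase_norm dot lam e mu1 mu2 (dU t' - dU t)%R <= (Num.sqrt eps)%:E)%E.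
  exact: cvge0_near hd _ s0.
rewrite near_withinE; apply: filterS => t' hh t'0 m n.
rewrite -(sqr_sqrtr (ltW eps0)).
apply: (energy_phase_norm hdot he hmu1 hmu2 _ _ _ (hh t'0)).
have [_ mt] := solution_modal t0; have [_ mt'] := solution_modal t'0.
exact: (modalB hdot hmu1 hmu2).
Qed.

Let local_domination (V : R -> @state R H) :
  (forall t : R, 0 <= t -> modal (V t)) ->
  (forall t : R, 0 <= t -> forall eps : R, 0 < eps ->
    \forall t' \near t, 0 <= t' -> forall m n,
      \sum_(m <= k < n) energy (V t' - V t) k <= eps) ->
  forall t : R, 0 <= t -> forall eps : R, 0 < eps ->
    \forall t' \near t, 0 <= t' -> forall m n,
    \sum_(m <= k < n) energy (V t') k <= 2 * \sum_(m <= k < n) energy (V t) k + eps.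
Proof.
move=> mV cV t t0 eps eps0; have e2 : 0 < eps / 2 by rewrite divr_gt0.
apply: filterS (cV t t0 _ e2) => t' h t'0 m n.
have -> : V t' = V t + (V t' - V t) by rewrite addrC subrK.
have hm : modal (V t' - V t) by apply: (modalB hdot hmu1 hmu2); exact: mV.
have := sum_energyD m n (mV t t0) hm; have := h t'0 m n; lra.
Qed.

Lemma solution_tails (T eps : R) : 0 < eps ->
  exists N, forall t : R, 0 <= t <= T -> forall m n, (N <= m)%N ->
    \sum_(m <= k < n) energy (U t) k <= eps.
Proof.
apply: uniform_tails.
- by move=> t k; exact: (energy_ge0 he hmu1 hmu2).
- move=> t t0; case: hU => /(_ t t0) [p _] _ _.
  exact: (energy_bounded hdot he hmu1 hmu2).
- apply: local_domination; [by move=> t /solution_modal[]|exact: solution_continuous].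
Qed.

Lemma derivative_tails (T eps : R) : 0 < eps ->
  exists N, forall t : R, 0 <= t <= T -> forall m n, (N <= m)%N ->
    \sum_(m <= k < n) energy (dU t) k <= eps.
Proof.
apply: uniform_tails.
- by move=> t k; exact: (energy_ge0 he hmu1 hmu2).
- move=> t t0; case: hU => /(_ t t0) [_ p] _ _.
  exact: (energy_bounded hdot he hmu1 hmu2).
- apply: local_domination; [by move=> t /solution_modal[]|exact: derivative_continuous].
Qed.

Lemma solution_bound (T : R) :
  exists B, forall t : R, 0 <= t <= T -> forall n, \sum_(0 <= k < n) energy (U t) k <= B.
Proof.
apply: uniform_bound.
- move=> t t0; case: hU => /(_ t t0) [p _] _ _.
  exact: (energy_bounded hdot he hmu1 hmu2).
- apply: local_domination; [by move=> t /solution_modal[]|exact: solution_continuous].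
Qed.

End Evolution.

(** * Recovering the source of a history equation *)

Section RintegralSum.
Context {d} {T : measurableType d} {R : realType}.
Variable mu : {measure set T -> \bar R}.

Lemma Rintegral_sum (D : set T) (f : nat -> T -> R) m n : measurable D ->
  (forall k, mu.-integrable D (EFin \o f k)) ->
  mu.-integrable D (EFin \o (fun x => \sum_(m <= k < n) f k x)) /\
  \int[mu]_(x in D) (\sum_(m <= k < n) f k x) =
  \sum_(m <= k < n) \int[mu]_(x in D) f k x.
Proof.
move=> mD hf; have E : EFin \o (fun x => \sum_(m <= k < n) f k x) =
    (fun x => \sum_(m <= k < n) (EFin \o f k) x)%E.
  by apply/funext => x /=; rewrite sumEFin.
split; first by rewrite E; apply: integrable_sum.
rewrite /Rintegral -[X in integral _ _ X]/(EFin \o _) E integral_sum//.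
rewrite [LHS](_ : _ = fine (\sum_(m <= k < n) (\int[mu]_(x in D) f k x)%R%:E)%E).
  by rewrite sumEFin.
congr fine; apply: eq_bigr => k _; rewrite /Rintegral fineK//.
exact: (integrable_fin_num mD (hf k)).
Qed.

End RintegralSum.

Section SourceBound.
Context {R : realType}.
Local Notation leb := (@lebesgue_measure R).
Variables (mu : R -> R) (delta : R).
Hypothesis hmu : memory_kernel mu delta.

(** The source [a] of a history equation is recovered, on an interval where the
    kernel is positive, from the history and its time derivative. *)
Lemma source_bound : exists2 K, 0 <= K & forall (c d : R -> R) (a : R),
  in_L2 mu c -> in_L2 mu d ->
  {ae leb, forall s, 0 < s -> 0 < mu s -> c s + prim d s = s * a} ->
  a ^+ 2 <= K * (sqint mu c + sqint mu d).
Proof.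
have [s s0 ms] := kernel_pos hmu.
exists (8 / (s ^+ 3 * mu s) * (2 + s ^+ 2)).
  by rewrite mulr_ge0 ?addr_ge0 ?sqr_ge0// divr_ge0// mulr_ge0 ?exprn_ge0// ltW.
move=> c d a hc hd h.
have lin (P X Y Z D : R) : P <= 2 * X + 2 * D * (s / 2) -> X <= Y -> Y <= Z ->
  P <= 2 * Z + D * s by lra.
have [ic2 lc] := in_L2_local hmu s0 ms hc.
have [idd ld] := in_L2_integral hmu s0 ms hd.
set C := s / mu s * sqint mu d.
have C0 : 0 <= C by rewrite mulr_ge0 ?(sqint_ge0 hmu)// divr_ge0 ?ltW.
(* on the upper half of the interval the factor in [s * a] is at least [s / 2] *)
set I : set R := `]s / 2, s[%classic.
have mI : measurable (I : set (measurableTypeR R)) by exact: measurable_itv.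
have sub : I `<=` (`]0, s[ : set R).
  by apply: subset_itv; rewrite bnd_simp//; lra.
have lI : leb I = (s / 2)%:E.
  have hs : s / 2 < s by lra.
  have hs2 : s - s / 2 = s / 2 by lra.
  by rewrite /I lebesgue_measure_itv/= lte_fin hs -EFinD hs2.
have ic2I : leb.-integrable I (EFin \o (fun r => c r ^+ 2)) by apply: integrableS ic2.
have icst (x : R) : leb.-integrable I (EFin \o (fun=> x)).
  apply: measurable_bounded_integrable => //.
    by rewrite [X in (X < _)%E]lI ltry.
  by exists `|x|; split => // y xy r _; exact: ltW.
have le : \int[leb]_(r in I) (a ^+ 2 * (s ^+ 2 / 4)) <=
    \int[leb]_(r in I) (2 * c r ^+ 2 + 2 * C).
  apply: ae_le_Rintegral => //.
    by apply: integrableD_EFin => //; exact: integrableZ_EFin.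
  apply: filterS h => r hr; rewrite /I /= in_itv/= => /andP[sr rs].
  have r0 : 0 < r by lra.
  have mr : 0 < mu r by apply: lt_le_trans ms _; apply: (kernel_noninc hmu); lra.
  have pr : prim d r ^+ 2 <= C by apply: ld; lra.
  have : (c r + prim d r) ^+ 2 <= 2 * c r ^+ 2 + 2 * prim d r ^+ 2.
    by have := sqr_ge0 (c r - prim d r); lra.
  rewrite (hr r0 mr) exprMn => h2.
  have : s ^+ 2 / 4 <= r ^+ 2.
    have -> : s ^+ 2 / 4 = (s / 2) ^+ 2 by field.
    by rewrite ler_pXn2r ?nnegrE//; lra.
  by move=> /(ler_wpM2l (sqr_ge0 a)); lra.
move: le; rewrite RintegralD//; last exact: integrableZ_EFin.
rewrite (RintegralZl 2 mI ic2I) !Rintegral_cst//= lI/= => le.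
have le2 : \int[leb]_(r in I) c r ^+ 2 <= \int[leb]_(r in `]0, s[) c r ^+ 2.
  rewrite /Rintegral fine_le//; [exact: integrable_fin_num|exact: integrable_fin_num|].
  apply: ge0_subset_integral => //; first exact: (measurable_int leb).
  by move=> r _; rewrite lee_fin sqr_ge0.
have lc' : \int[leb]_(r in `]0, s[) c r ^+ 2 <= sqint mu c / mu s.
  by rewrite ler_pdivlMr// mulrC.
have fin : a ^+ 2 * (s ^+ 3 / 8) <= 2 * (sqint mu c / mu s) + C * s.
  have -> : a ^+ 2 * (s ^+ 3 / 8) = a ^+ 2 * (s ^+ 2 / 4) * (s / 2) by field.
  exact: lin le le2 lc'.
rewrite -[X in X <= _]mulr1.
have s3 : 0 < s ^+ 3 / 8 by rewrite divr_gt0// exprn_gt0.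
rewrite -(ler_pM2r s3); apply: (@le_trans _ _ (2 * (sqint mu c / mu s) + C * s)).
  by rewrite mulr1.
have c0 := sqint_ge0 hmu c; have d0 := sqint_ge0 hmu d.
have -> : 8 / (s ^+ 3 * mu s) * (2 + s ^+ 2) * (sqint mu c + sqint mu d) * (s ^+ 3 / 8) =
  (2 + s ^+ 2) * (sqint mu c + sqint mu d) / mu s.
  by field; rewrite !gt_eqF.
have -> : 2 * (sqint mu c / mu s) + C * s =
  (2 * sqint mu c + s ^+ 2 * sqint mu d) / mu s by rewrite /C; field; rewrite gt_eqF.
apply: ler_wpM2r; first by rewrite invr_ge0 ltW.
have := mulr_ge0 (sqr_ge0 s) c0; lra.
Qed.

End SourceBound.

Section Smooth.
Context {R : realType}.

Lemma has_deriv_vanishes (f g : R -> R) (t : R) : has_deriv_halfline f g -> 0 <= t ->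
  vanishes_at t (fun h => `|h^-1 * (f (t + h) - f t) - g t|).
Proof.
move=> hf t0 eps eps0; have /cvgrPdist_le /(_ _ eps0) := hf t t0.
by rewrite near_withinE; apply: filterS => h hh th; rewrite distrC; exact: hh.
Qed.

Lemma C2_halfline_bounded (f : R -> R) (B : R) : C2_halfline f ->
  exists C, forall x, 0 <= x <= B -> `|f x| <= C.
Proof.
move=> [f1 [f2 [hf _ _]]].
have [B0|B0] := leP 0 B; last by exists 0 => x /andP[? ?]; exfalso; lra.
have cf : {within `[0, B], continuous f}.
  apply: (@displacement_within _ f f1) => t t0; exact: has_deriv_vanishes.
have cf' : {within `[0, B], continuous (fun x => `|f x|)}.
  by move=> x; apply: cvg_norm; exact: cf.
have [c _ hc] := EVT_max B0 cf'.
by exists `|f c| => x xB; apply: hc; rewrite in_itv.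
Qed.

End Smooth.

(** * The equations satisfied by the modes *)

Section ModalEquations.
Context {R : realType} {H : completeNormedModType R}.
Local Notation leb := (@lebesgue_measure R).
Variables (dot : H -> H -> R) (DA : set H) (A : H -> H) (lam : R^nat) (e : nat -> H).
Hypothesis hdot : hilbert_dot dot.
Hypothesis hA : positive_selfadjoint dot DA A.
Hypothesis he : orthonormal_eigenbasis dot DA A lam e.
Variables (omega nu beta : R) (p : H) (M mu1 mu2 : R -> R) (delta1 delta2 : R).
Hypothesis hmu1 : memory_kernel mu1 delta1.
Hypothesis hmu2 : memory_kernel mu2 delta2.

Lemma phase_norm_eq0 (x : @state R H) :
  phase_norm dot lam e mu1 mu2 x = 0%E ->
  [/\ forall k, dot x.1.1.1.1 (e k) = 0, x.1.1.1.2 = 0, x.1.1.2 = 0,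
      mem_norm2 dot lam e mu1 1 x.1.2 = 0%E & mem_norm2 dot lam e mu2 2^-1 x.2 = 0%E].
Proof.
have mem0 (mu : R -> R) delta r eta : memory_kernel mu delta ->
    (0 <= mem_norm2 dot lam e mu r eta)%E.
  move=> hmu; apply: integral_ge0 => s; rewrite /= in_itv/= andbT => s0.
  apply: mule_ge0; first by rewrite lee_fin (kernel_ge0 hmu)// ltW.
  by apply: mule_ge0; exact: Fnorm_ge0.
case: x => [[[[u w] v] etab] eta]; rewrite /phase_norm.
set a := (_ ^+ 2)%E; set b := (_ ^+ 2)%:E; set c := (`|v| ^+ 2)%:E.
set d := mem_norm2 _ _ _ _ _ etab; set f := mem_norm2 _ _ _ _ _ eta.
have a0 : (0 <= a)%E by rewrite /a expe_ge0// Fnorm_ge0.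
have b0 : (0 <= b)%E by rewrite /b lee_fin sqr_ge0.
have c0 : (0 <= c)%E by rewrite /c lee_fin sqr_ge0.
have d0 : (0 <= d)%E := mem0 _ _ _ _ hmu1.
have f0 : (0 <= f)%E := mem0 _ _ _ _ hmu2.
move=> h; have : (a + b + c + d + f = 0)%E.
  rewrite -[LHS]sqr_sqrte ?h ?expe2 ?mule0//.
  exact: adde_ge0 (adde_ge0 (adde_ge0 (adde_ge0 a0 b0) c0) d0) f0.
have ab0 := adde_ge0 a0 b0; have abc0 := adde_ge0 ab0 c0; have abcd0 := adde_ge0 abc0 d0.
move=> /eqP; rewrite (padde_eq0 abcd0 f0) => /andP[/eqP + /eqP ->].
move=> /eqP; rewrite (padde_eq0 abc0 d0) => /andP[/eqP + /eqP ->].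
move=> /eqP; rewrite (padde_eq0 ab0 c0) => /andP[/eqP + /eqP c00].
move=> /eqP; rewrite (padde_eq0 a0 b0) => /andP[/eqP a00 /eqP b00].
split => //=.
- move=> k; have := Fnorm_partial_sum hdot he 1 u k k.+1.
  rewrite big_nat1 -/a a00 lee_fin (powR_one he) => h1.
  have /eqP : (lam k * dot u (e k)) ^+ 2 = 0.
    by apply/eqP; rewrite eq_le h1 sqr_ge0.
  by rewrite sqrf_eq0 mulf_eq0 (gt_eqF (eigen_gt0 he k))/= => /eqP.
- by move: b00 => [/eqP]; rewrite sqrf_eq0 normr_eq0 => /eqP.
- by move: c00 => [/eqP]; rewrite sqrf_eq0 normr_eq0 => /eqP.
Qed.

Lemma coef_of_coef (c : nat -> R) k : Fgen lam 0 c -> dot (of_coef e c) (e k) = c k.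
Proof.
rewrite /Fgen/= => hc; have hc' : cvgn (series (fun k => c k ^+ 2)).
  move: hc; rewrite (_ : (fun k => (lam k `^ 0 * c k) ^+ 2) = fun k => c k ^+ 2)//.
  by apply/funext => j; rewrite powRr0 mul1r.
apply: (coef_series_lim hdot (eigen_orthonormal he)).
exact: (cvg_series_e hdot (eigen_orthonormal he) hc').
Qed.

Lemma FgenN (c : nat -> R) : Fgen lam 0 c -> Fgen lam 0 (- c).
Proof.
rewrite /Fgen/= => hc.
rewrite (_ : (fun k => (lam k `^ 0 * (- c) k) ^+ 2) = fun k => (lam k `^ 0 * c k) ^+ 2)//.
by apply/funext => k; rewrite [(- c) k]/= mulrN sqrrN.
Qed.

Lemma coef_of_coefN (c : nat -> R) k :
  Fgen lam 0 c -> dot (of_coef e (- c)) (e k) = - c k.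
Proof. by move=> hc; rewrite (coef_of_coef k (FgenN hc)). Qed.

Local Notation mode := (mode dot e).

Lemma mech_exprE u v etab k : (forall k, in_L2 mu1 (mode etab k)) ->
  mech_expr dot lam e nu beta mu1 u v etab k =
  beta * (lam k ^+ 2 * dot u (e k)) +
  lam k ^+ 2 * \int[leb]_(s in `]0, +oo[) (mu1 s * mode etab k s) -
  nu * (lam k * dot v (e k)).
Proof.
move=> hL; rewrite /mech_expr /mem_integral.
rewrite [LHS](_ : _ = beta * Agen lam 2 (coef dot e u) k +
  \int[leb]_(s in `]0, +oo[) (mu1 s * Agen lam 2 (coef dot e (etab s)) k) -
  nu * Agen lam 1 (coef dot e v) k)//.
rewrite /Agen /coef (powR_one he) powR_mulrn; last by rewrite ltW// (eigen_gt0 he).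
congr (_ + _ - _); rewrite -RintegralZl//; last exact: (in_L2_integrable hmu1 (hL k)).
by apply: eq_Rintegral => s _; rewrite modeE; ring.
Qed.

(** The acceleration equation is solved for the mechanical expression: it is this
    combination, not its separate terms, that lies in [H]. *)
Lemma modal_equations (x dx : @state R H) :
  domL dot lam e omega nu beta mu1 mu2 x -> modal dot e mu1 mu2 x ->
  modal dot e mu1 mu2 dx ->
  phase_norm dot lam e mu1 mu2
    (dx - (Lop dot lam e omega nu beta mu1 mu2 x + forcing dot lam e p M A x)) = 0%E ->
  forall k,
  [/\ dot dx.1.1.1.1 (e k) = dot x.1.1.1.2 (e k),
      mech_expr dot lam e nu beta mu1 x.1.1.1.1 x.1.1.2 x.1.2 k =
        dot p (e k) - dot dx.1.1.1.2 (e k) -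
        M (`|Apow dot lam e 2^-1 x.1.1.1.1| ^+ 2) * (lam k * dot x.1.1.1.1 (e k)),
      {ae leb, forall s, 0 < s -> 0 < mu1 s ->
        mode x.1.2 k s + prim (mode dx.1.2 k) s = s * dot x.1.1.1.2 (e k)} &
      {ae leb, forall s, 0 < s -> 0 < mu2 s ->
        mode x.2 k s + prim (mode dx.2 k) s = s * dot x.1.1.2 (e k)}].
Proof.
case: x => [[[[u w] v] etab] eta]; case: dx => [[[[du dw] dv] detab] deta].
move=> [[hu hb hh] [[hTb hT] hw hv hmech hheat]] mx mdx h0 k.
have [/(_ k) hu0 hw0 _ hb0 hh0] := phase_norm_eq0 h0.
split.
- move: hu0; rewrite /= (dotBl hdot) (dotDl hdot) (dot0l hdot) addr0 => /eqP.
  by rewrite subr_eq0 => /eqP.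
- have /(congr1 (fun x => dot x (e k))) := hw0.
  rewrite /= (dotBl hdot) 2!(dotDl hdot) (dotNl hdot) (dotZl hdot) (dot0l hdot).
  rewrite (coef_of_coefN k hmech).
  have [Du _] := domain_Fsp1 hdot he hA hu.
  rewrite (coef_A hdot he hA k Du); lra.
- apply: (history_integrated hdot he hmu1 k hTb); first by move=> j; case: (mdx j).
  by move: hb0; rewrite /= addr0.
- apply: (history_integrated hdot he hmu2 k hT); first by move=> j; case: (mdx j).
  by move: hh0; rewrite /= addr0.
Qed.

End ModalEquations.

(** * The Volterra estimate *)

Section Volterra.
Context {R : realType}.
Local Notation leb := (@lebesgue_measure R).
Variables (mu : R -> R) (delta : R).
Hypothesis hmu : memory_kernel mu delta.
Variables (beta nu : R) (l : nat -> R) (u v G : R -> nat -> R) (y : R -> nat -> R -> R).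
Hypothesis beta0 : 0 < beta.
Hypothesis l0 : forall k, 0 < l k.
Hypothesis hy : forall (t : R) k, 0 <= t -> in_L2 mu (y t k).
Hypothesis hrep : forall (t : R) k, 0 <= t -> {ae leb, forall s, 0 < s -> 0 < mu s ->
  (s < t -> u t k - y t k s = u (t - s) k) /\
  (t < s -> u t k - y t k s = u 0 k - y 0 k (s - t))}.
Hypothesis hcu : forall k (T : R), {within `[0, T], continuous (fun t => u t k)}.
Hypothesis hG : forall (t : R) k, 0 <= t ->
  G t k = beta * (l k ^+ 2 * u t k) +
    l k ^+ 2 * \int[leb]_(s in `]0, +oo[) (mu s * y t k s) - nu * (l k * v t k).

Let mhalf : measurable (`]0, +oo[ : set (measurableTypeR R)).
Proof. exact: measurable_itv. Qed.

Let S m n t := \sum_(m <= k < n) l k ^+ 3 * u t k ^+ 2.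
Let g k s := u 0 k - y 0 k s.

Let S_continuous m n T : {within `[0, T], continuous (S m n)}.
Proof.
have -> : S m n = fun t => \sum_(m <= k < n) l k ^+ 3 * u t k ^+ 2 by [].
elim: n => [|n IH].
  rewrite (_ : (fun t => _) = cst 0); first by move=> x; exact: cvg_cst.
  by apply/funext => t; rewrite big_geq.
have [mn|nm] := leqP m n; last first.
  rewrite (_ : (fun t => _) = cst 0); first by move=> x; exact: cvg_cst.
  by apply/funext => t; rewrite big_geq.
rewrite (_ : (fun t => _) =
  (fun t => \sum_(m <= k < n) l k ^+ 3 * u t k ^+ 2) \+ (fun t => l n ^+ 3 * u t n ^+ 2)).
  move=> x; apply: cvgD; first exact: IH.
  apply: cvgM; first exact: cvg_cst.
  by rewrite expr2; apply: cvgM; exact: hcu.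
by apply/funext => t; rewrite big_nat_recr.
Qed.

Let g_L2 k : in_L2 mu (g k).
Proof. by apply: (in_L2B hmu); [exact: (in_L2_cst hmu)|exact: hy]. Qed.

Let measurable_G m n :
  measurable_fun (`]0, +oo[ : set R) (fun s => \sum_(m <= k < n) l k ^+ 3 * g k s ^+ 2).
Proof.
elim: n => [|n IH].
    rewrite (_ : (fun s => _) = cst 0)//.
    by apply/funext => s; rewrite big_geq.
  have [mn|nm] := leqP m n; last first.
    rewrite (_ : (fun s => _) = cst 0)//.
    by apply/funext => s; rewrite big_geq.
  rewrite (_ : (fun s => _) = (fun s => \sum_(m <= k < n) l k ^+ 3 * g k s ^+ 2) \+
     (fun s => l n ^+ 3 * g n s ^+ 2)); last by apply/funext => s; rewrite big_nat_recr.
  apply: measurable_funD => //; apply: measurable_funM => //.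
  by apply: measurable_funX; case: (g_L2 n).
Qed.

(** At a time [t] where [S m n] is maximal on the past, the memory dissipates
    up to the contribution of the initial history. *)
Let memory_lower_bound m n t : 0 <= t -> (forall s, 0 <= s <= t -> S m n s <= S m n t) ->
  - (4^-1 * \sum_(m <= k < n) l k ^+ 3 * sqint mu (g k)) <=
  \sum_(m <= k < n) l k ^+ 3 * u t k * \int[leb]_(s in `]0, +oo[) (mu s * y t k s).
Proof.
move=> t0 Smax.
have young4 (c a b : R) : 0 <= c -> c * a * b <= c * a ^+ 2 + 4^-1 * (c * b ^+ 2).
  by move=> hc; have := mulr_ge0 hc (sqr_ge0 (a - b / 2)); lra.
have young2 (c a b : R) : 0 <= c -> c * a * b <= 2^-1 * (c * a ^+ 2) + 2^-1 * (c * b ^+ 2).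
  by move=> hc; have := mulr_ge0 hc (sqr_ge0 (a - b)); lra.
have lin1 (a b : R) : a <= b -> 2^-1 * b + 2^-1 * a <= b by lra.
have lin2 (a b c d : R) : a <= b -> c - d <= c + 4^-1 * a -> - (4^-1 * b) <= d by lra.
have imu := kernel_integrable hmu.
set kap := \int[leb]_(s in `]0, +oo[) mu s.
have iy k : leb.-integrable `]0, +oo[ (EFin \o (fun s => mu s * y t k s)).
  exact: (in_L2_integrable hmu (hy k t0)).
pose f k s := l k ^+ 3 * u t k * (u t k * mu s - mu s * y t k s).
have iF k : leb.-integrable `]0, +oo[ (EFin \o f k).
  by apply: integrableZ_EFin => //; apply: integrableB_EFin => //; exact: integrableZ_EFin.
have E1 k : \int[leb]_(s in `]0, +oo[) f k s =
    l k ^+ 3 * u t k ^+ 2 * kap - l k ^+ 3 * u t k * \int[leb]_(s in `]0, +oo[) (mu s * y t k s).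
  rewrite /f RintegralZl//; last first.
    by apply: integrableB_EFin => //; exact: integrableZ_EFin.
  rewrite RintegralB//; last exact: integrableZ_EFin.
  by rewrite RintegralZl// -/kap; ring.
have [iS ES] := Rintegral_sum m n mhalf iF.
pose Gs s := \sum_(m <= k < n) l k ^+ 3 * g k s ^+ 2.
have Gs0 s : 0 <= Gs s.
  by apply: sumr_ge0 => k _; rewrite mulr_ge0 ?sqr_ge0// exprn_ge0// ltW.
have mGs : measurable_fun (`]0, +oo[ : set R) Gs.
  exact: measurable_G.
have ig k : leb.-integrable `]0, +oo[ (EFin \o (fun s => l k ^+ 3 * (mu s * g k s ^+ 2))).
  by apply: integrableZ_EFin => //; case: (g_L2 k).
have [iG0 EG0] := Rintegral_sum m n mhalf ig.
have GE s : mu s * Gs s = \sum_(m <= k < n) l k ^+ 3 * (mu s * g k s ^+ 2).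
  by rewrite /Gs mulr_sumr; apply: eq_bigr => k _; ring.
have iG : leb.-integrable `]0, +oo[ (EFin \o (fun s => mu s * Gs s)).
  by apply: eq_integrable iG0 => // s _ /=; rewrite GE.
have EG : \int[leb]_(s in `]0, +oo[) (mu s * Gs s) =
    \sum_(m <= k < n) l k ^+ 3 * sqint mu (g k).
  under eq_Rintegral do rewrite GE.
  rewrite EG0; apply: eq_bigr => k _; rewrite RintegralZl//; by case: (g_L2 k).
have [iGt leGt] := translated_memory_le hmu t0 mGs (fun s _ => Gs0 s) iG.
set Gt := (fun s => Gs (s - t)) \_ `]t, +oo[ in iGt leGt.
(* Young's inequality against [u (t - s)] for the recent history, and against
   the initial one, with weight [1/4], for the old history *)
have main : \int[leb]_(s in `]0, +oo[) (\sum_(m <= k < n) f k s) <=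
    \int[leb]_(s in `]0, +oo[) (S m n t * mu s + 4^-1 * (mu s * Gt s)).
  apply: ae_le_Rintegral => //.
    by apply: integrableD_EFin => //; exact: integrableZ_EFin.
  have rep : {ae leb, forall s, forall k, 0 < s -> 0 < mu s ->
      (s < t -> u t k - y t k s = u (t - s) k) /\
      (t < s -> u t k - y t k s = g k (s - t))}.
    by apply: ae_foralln => k; exact: hrep.
  have nt : {ae leb, forall s, s != t}.
    exists [set t]; split => //; first exact: lebesgue_measure_set1.
    by move=> s /=/negP; rewrite negbK => /eqP.
  apply: filterS2 rep nt => s hs st; rewrite /= in_itv/= andbT => s0.
  have mus : 0 <= mu s by rewrite (kernel_ge0 hmu)// ltW.
  have -> : \sum_(m <= k < n) f k s = mu s * \sum_(m <= k < n) l k ^+ 3 * u t k * (u t k - y t k s).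
    by rewrite mulr_sumr; apply: eq_bigr => k _; rewrite /f; ring.
  have -> : S m n t * mu s + 4^-1 * (mu s * Gt s) = mu s * (S m n t + 4^-1 * Gt s) by ring.
  move: mus; rewrite le_eqVlt => /predU1P[<-|mus]; first by rewrite !mul0r.
  apply: ler_wpM2l; first exact: ltW.
  rewrite /Gt patchE; case: ifPn; rewrite ?inE ?notin_setE/= in_itv/= andbT => ts.
    rewrite /S /Gs mulr_sumr -big_split/=; apply: ler_sum => k _.
    have [_ ->//] := hs k s0 mus.
    exact: (young4 _ _ _ (exprn_ge0 3 (ltW (l0 k)))).
  have {}ts : s < t by rewrite lt_neqAle st leNgt; exact/negP.
  rewrite mulr0 addr0; apply: (@le_trans _ _ (2^-1 * S m n t + 2^-1 * S m n (t - s))).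
    rewrite /S !mulr_sumr -big_split/=; apply: ler_sum => k _.
    have [->// _] := hs k s0 mus.
    exact: (young2 _ _ _ (exprn_ge0 3 (ltW (l0 k)))).
  have ts0 : 0 <= t - s <= t by rewrite subr_ge0 gerBl (ltW ts) (ltW s0).
  exact: lin1 _ _ (Smax _ ts0).
move: main; rewrite ES RintegralD//; first last.
- exact: integrableZ_EFin.
- exact: integrableZ_EFin.
rewrite (RintegralZl _ mhalf imu) (RintegralZl _ mhalf iGt) -/kap.
under eq_bigr do rewrite E1.
rewrite sumrB -mulr_suml -/(S m n t); move: leGt; rewrite EG; exact: lin2.
Qed.

(** The mass of the kernel occurs on both sides and cancels; [beta / 2] is what
    remains of [beta] once the right-hand side has been absorbed. *)
Lemma volterra_estimate m n (T phi : R) :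
  (forall t, 0 <= t <= T ->
    \sum_(m <= k < n) (G t k ^+ 2 / (beta * l k) + nu ^+ 2 * l k * v t k ^+ 2 / beta) <= phi) ->
  forall t, 0 <= t <= T ->
    beta / 2 * \sum_(m <= k < n) l k ^+ 3 * u t k ^+ 2 <=
    4^-1 * (\sum_(m <= k < n) l k ^+ 3 * sqint mu (fun s => u 0 k - y 0 k s)) + phi.
Proof.
move=> hphi t tT; have T0 : 0 <= T by case/andP: tT => [a b]; lra.
have [c cT cmax] := EVT_max T0 (@S_continuous m n T).
move: cT; rewrite in_itv/= => cT; have /andP[c0 cT'] := cT.
apply: (@le_trans _ _ (beta / 2 * S m n c)).
  by apply: ler_wpM2l; [rewrite divr_ge0 ?ltW|apply: cmax; rewrite in_itv].
have Smax s : 0 <= s <= c -> S m n s <= S m n c.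
  by move=> /andP[s0 sc]; apply: cmax; rewrite in_itv/=; apply/andP; split; lra.
have low := memory_lower_bound c0 Smax.
(* two completed squares, each using [beta / 4] of the leading term *)
have young k : l k * u c k * G c k + nu * l k ^+ 2 * u c k * v c k <=
    beta / 2 * (l k ^+ 3 * u c k ^+ 2) +
    (G c k ^+ 2 / (beta * l k) + nu ^+ 2 * l k * v c k ^+ 2 / beta).
  have lk := l0 k; have bl : 0 < beta * l k by rewrite mulr_gt0.
  have h1 : 0 <= (beta * l k)^-1 * (beta * l k ^+ 2 * u c k / 2 - G c k) ^+ 2.
    by rewrite mulr_ge0 ?sqr_ge0// invr_ge0 ltW.
  have h2 : 0 <= l k / beta * (beta * l k * u c k / 2 - nu * v c k) ^+ 2.
    by rewrite mulr_ge0 ?sqr_ge0// divr_ge0 ?ltW.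
  have -> : beta / 2 * (l k ^+ 3 * u c k ^+ 2) +
    (G c k ^+ 2 / (beta * l k) + nu ^+ 2 * l k * v c k ^+ 2 / beta) =
    l k * u c k * G c k + nu * l k ^+ 2 * u c k * v c k +
    ((beta * l k)^-1 * (beta * l k ^+ 2 * u c k / 2 - G c k) ^+ 2 +
     l k / beta * (beta * l k * u c k / 2 - nu * v c k) ^+ 2).
    by field; rewrite !gt_eqF.
  by rewrite lerDl addr_ge0.
have sum1 : \sum_(m <= k < n) (l k * u c k * G c k + nu * l k ^+ 2 * u c k * v c k) =
   beta * S m n c + \sum_(m <= k < n) l k ^+ 3 * u c k *
      \int[leb]_(s in `]0, +oo[) (mu s * y c k s).
  rewrite /S mulr_sumr -big_split/=; apply: eq_bigr => k _.
  by rewrite (hG k c0); ring.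
have sum2 : \sum_(m <= k < n) (l k * u c k * G c k + nu * l k ^+ 2 * u c k * v c k) <=
    beta / 2 * S m n c + phi.
  apply: le_trans (ler_sum _ (fun k _ => young k)) _.
  by rewrite big_split/= -mulr_sumr lerD2l; exact: hphi.
move: sum2; rewrite sum1; lra.
Qed.

End Volterra.

(** * Regularity of the displacement *)

Section Regularity.
Context {R : realType} {H : completeNormedModType R}.
Local Notation leb := (@lebesgue_measure R).
Variables (dot : H -> H -> R) (DA : set H) (A : H -> H) (lam : R^nat) (e : nat -> H).
Hypothesis hdot : hilbert_dot dot.
Hypothesis hA : positive_selfadjoint dot DA A.
Hypothesis he : orthonormal_eigenbasis dot DA A lam e.
Variables (omega nu beta : R) (p : H) (M mu1 mu2 : R -> R) (delta1 delta2 : R).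
Hypothesis hbeta : 0 < beta.
Hypothesis hmu1 : memory_kernel mu1 delta1.
Hypothesis hmu2 : memory_kernel mu2 delta2.
Hypothesis hM : C2_halfline M.
Variable U0 : @state R H.
Hypothesis hU0 : domL dot lam e omega nu beta mu1 mu2 U0.
Hypothesis hu0 : Linfty_F dot lam e (3 / 2) (fun t => comp_u U0 - comp_etabar U0 t).
Variables U dU : R -> @state R H.
Hypothesis hC1 : C1_phase dot lam e mu1 mu2 U dU.
Hypothesis hdom : forall t : R, 0 <= t -> domL dot lam e omega nu beta mu1 mu2 (U t).
Hypothesis hevol : forall t : R, 0 <= t -> phase_norm dot lam e mu1 mu2
  (dU t - (Lop dot lam e omega nu beta mu1 mu2 (U t) + forcing dot lam e p M A (U t))) = 0%E.
Hypothesis hinit : phase_norm dot lam e mu1 mu2 (U 0 - U0) = 0%E.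

Local Notation energy := (energy dot lam e mu1 mu2).
Local Notation modal := (modal dot e mu1 mu2).
Local Notation mode := (mode dot e).

Let u t k := dot (U t).1.1.1.1 (e k).
Let w t k := dot (U t).1.1.1.2 (e k).
Let v t k := dot (U t).1.1.2 (e k).
Let y t k := mode (U t).1.2 k.
Let z t k := mode (dU t).1.2 k.
Let G t k := mech_expr dot lam e nu beta mu1 (U t).1.1.1.1 (U t).1.1.2 (U t).1.2 k.

Let lam_gt0 := eigen_gt0 he.

Let modalU (t : R) : 0 <= t -> modal (U t).
Proof. by move=> t0; have [] := solution_modal hdot he hmu1 hmu2 hC1 t0. Qed.

Let modaldU (t : R) : 0 <= t -> modal (dU t).
Proof. by move=> t0; have [] := solution_modal hdot he hmu1 hmu2 hC1 t0. Qed.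

Let equations (t : R) k : 0 <= t -> _ :=
  fun t0 => modal_equations hdot hA he hmu1 hmu2 (hdom t0) (modalU t0) (modaldU t0) (hevol t0) k.

Let quotient_small (t : R) k (eps : R) : 0 <= t -> 0 < eps ->
  \forall h \near 0^', 0 <= t + h ->
    energy (h^-1 *: (U (t + h) - U t) - dU t) k <= eps.
Proof.
move=> t0 eps0.
apply: filterS (solution_differentiable hdot he hmu1 hmu2 hC1 t0 eps0) => h hh th.
by have := hh th k k.+1; rewrite big_nat1.
Qed.

Let huw k (t : R) : 0 <= t ->
  vanishes_at t (fun h => `|h^-1 * (u (t + h) k - u t k) - w t k|).
Proof.
move=> t0 eps eps0; have le0 : 0 < lam k * eps by rewrite mulr_gt0.
have sq0 : 0 < (lam k * eps) ^+ 2 by rewrite exprn_gt0.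
apply: filterS (quotient_small k t0 sq0) => h hh th.
have [h1 _ _ _] := energy_parts he hmu1 hmu2 (h^-1 *: (U (t + h) - U t) - dU t) k.
have := le_trans h1 (hh th).
have [duw _ _ _] := equations k t0.
have -> : dot (h^-1 *: (U (t + h) - U t) - dU t).1.1.1.1 (e k) =
   h^-1 * (u (t + h) k - u t k) - w t k.
  by rewrite /= (dotBl hdot) (dotZl hdot) (dotBl hdot) duw.
rewrite -exprMn -[X in X <= _]real_normK ?num_real// ler_pXn2r ?nnegrE ?(ltW le0)//.
by rewrite normrM gtr0_norm// ler_pM2l.
Qed.

Let hyz k (t : R) : 0 <= t -> vanishes_at t
  (fun h => sqint mu1 (fun s => h^-1 * (y (t + h) k s - y t k s) - z t k s)).
Proof.
move=> t0 eps eps0; have le0 : 0 < lam k ^+ 2 * eps by rewrite mulr_gt0// exprn_gt0.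
apply: filterS (quotient_small k t0 le0) => h hh th.
have [_ _ h1 _] := energy_parts he hmu1 hmu2 (h^-1 *: (U (t + h) - U t) - dU t) k.
have := le_trans h1 (hh th).
rewrite (modeB e hdot) (modeZ e hdot) (modeB e hdot) ler_pM2l//.
by rewrite exprn_gt0.
Qed.

Let hy k (t : R) : 0 <= t -> in_L2 mu1 (y t k).
Proof. by move=> /modalU /(_ k)[]. Qed.

Let hz k (t : R) : 0 <= t -> in_L2 mu1 (z t k).
Proof. by move=> /modaldU /(_ k)[]. Qed.

Let hprim k (t : R) : 0 <= t -> {ae leb, forall s, 0 < s -> 0 < mu1 s ->
  y t k s + prim (z t k) s = s * w t k}.
Proof. by move=> t0; have [] := equations k t0. Qed.

Let hrep (t : R) k : 0 <= t -> {ae leb, forall s, 0 < s -> 0 < mu1 s ->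
  (s < t -> u t k - y t k s = u (t - s) k) /\
  (t < s -> u t k - y t k s = u 0 k - y 0 k (s - t))}.
Proof.
exact: (memory_representation hmu1 (hy k) (hz k) (hyz k) (hprim k) (huw k)).
Qed.

Let hcu k (T : R) : {within `[0, T], continuous (fun t => u t k)}.
Proof. exact: (@displacement_within _ (fun t => u t k) (fun t => w t k) (huw k)). Qed.

Let hG (t : R) k : 0 <= t ->
  G t k = beta * (lam k ^+ 2 * u t k) +
    lam k ^+ 2 * \int[leb]_(s in `]0, +oo[) (mu1 s * y t k s) - nu * (lam k * v t k).
Proof.
by move=> t0; rewrite /G (mech_exprE he nu beta hmu1)// => j; case: (modalU t0 j).
Qed.

(** By Bessel's inequality the assumption on [u_0 - etabar_0] bounds the weighted
    sum of its squared coefficients at almost every [s]; the kernel has finite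
    mass. *)
Let initial_history : exists B, forall n,
  \sum_(0 <= k < n) lam k ^+ 3 * sqint mu1 (fun s => u 0 k - y 0 k s) <= B.
Proof.
have [_ [C hC]] := hu0.
pose g k s := dot (comp_u U0 - comp_etabar U0 s) (e k).
have mU0 : modal U0.
  by apply: (phase_modal hdot he hmu1 hmu2); move: hU0 => [].
have [hu00 _ _ hb0 _] := phase_norm_eq0 hdot he hmu1 hmu2 hinit.
have gL k : in_L2 mu1 (g k).
  rewrite (_ : g k = fun s => dot (comp_u U0) (e k) - mode (comp_etabar U0) k s).
    by apply: (in_L2B hmu1); [exact: (in_L2_cst hmu1)|case: (mU0 k)].
  by apply/funext => s; rewrite /g (dotBl hdot).
have E k : sqint mu1 (fun s => u 0 k - y 0 k s) = sqint mu1 (g k).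
  have LD : in_L2 mu1 (mode (U 0 - U0).1.2 k).
    rewrite (modeB e hdot); apply: (in_L2B hmu1); first by case: (modalU (lexx 0) k).
    by case: (mU0 k).
  have LU : in_L2 mu1 (fun s => u 0 k - y 0 k s).
    by apply: (in_L2B hmu1); [exact: (in_L2_cst hmu1)|exact: hy].
  have q0 : sqint mu1 (mode (U 0 - U0).1.2 k) = 0.
    apply/eqP; rewrite eq_le (sqint_ge0 hmu1) andbT.
    have LDj j : in_L2 mu1 (mode (U 0 - U0).1.2 j).
      rewrite (modeB e hdot); apply: (in_L2B hmu1); first by case: (modalU (lexx 0) j).
      by case: (mU0 j).
    have := sqint_mode_sum hdot he hmu1 1 k k.+1 LDj.
    rewrite hb0 big_nat1 lee_fin (powR_one he).
    by rewrite pmulr_rle0// exprn_gt0.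
  have uu : u 0 k = dot (comp_u U0) (e k).
    by apply/eqP; rewrite -subr_eq0 -(dotBl hdot); apply/eqP; exact: hu00.
  apply: ae_eq_Rintegral => //.
  - by apply/measurable_EFinP; case: LU => _ /(measurable_int leb).
  - by apply/measurable_EFinP; case: (gL k) => _ /(measurable_int leb).
  - apply: filterS (sqint_eq0 hmu1 LD q0) => s hs; rewrite /= in_itv/= andbT => s0.
    have := kernel_ge0 hmu1 (ltW s0); rewrite le_eqVlt => /predU1P[<-|ms].
      by rewrite !mul0r.
    have := hs s0 ms; rewrite (modeB e hdot) => /eqP; rewrite subr_eq0 => /eqP ys.
    by rewrite /y ys uu /g (dotBl hdot).
exists (C ^+ 2 * \int[leb]_(s in `]0, +oo[) mu1 s) => n.
under eq_bigr do rewrite E.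
have mhalf : measurable (`]0, +oo[ : set (measurableTypeR R)) by exact: measurable_itv.
have ig k : leb.-integrable `]0, +oo[ (EFin \o (fun s => lam k ^+ 3 * (mu1 s * g k s ^+ 2))).
  by apply: integrableZ_EFin => //; case: (gL k).
have [iS ES] := Rintegral_sum 0 n mhalf ig.
rewrite [leLHS](_ : _ = \int[leb]_(s in `]0, +oo[)
    (\sum_(0 <= k < n) lam k ^+ 3 * (mu1 s * g k s ^+ 2))); last first.
  by rewrite ES; apply: eq_bigr => k _; rewrite RintegralZl//; case: (gL k).
rewrite -RintegralZl//; last exact: (kernel_integrable hmu1).
apply: ae_le_Rintegral => //.
  by apply: integrableZ_EFin => //; exact: (kernel_integrable hmu1).
apply: filterS hC => s hs; rewrite /= in_itv/= andbT => s0.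
rewrite mulrC [leLHS](_ : _ = mu1 s * \sum_(0 <= k < n) lam k ^+ 3 * g k s ^+ 2); last first.
  by rewrite mulr_sumr; apply: eq_bigr => k _; ring.
apply: ler_wpM2l; first by rewrite (kernel_ge0 hmu1)// ltW.
have := hs s0; set F := Fnorm _ _ _ _ _ => FC.
have F0 : (0 <= F)%E := Fnorm_ge0 _ _ _ _ _.
have := Fnorm_partial_sum hdot he (3 / 2) (comp_u U0 - comp_etabar U0 s) 0 n.
rewrite -/F => le; rewrite -lee_fin.
apply: (@le_trans _ _ (F ^+ 2)%E).
  apply: le_trans le; rewrite lee_fin; apply: ler_sum => k _.
  by rewrite exprMn (powR_three_halves he).
move: FC F0; case: (F) => [r| |]// rC r0; rewrite -EFin_expe lee_fin.
by rewrite !lee_fin in rC r0; rewrite ler_pXn2r// nnegrE// (le_trans r0 rC).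
Qed.

(** The velocity is bounded through [source_bound], the mechanical expression
    through the equation of motion, where [M] is bounded because its argument
    stays in a compact interval. *)
Let forcing_bound (T : R) : exists2 C, 0 <= C & forall t, 0 <= t <= T -> forall k,
  G t k ^+ 2 / (beta * lam k) + nu ^+ 2 * lam k * v t k ^+ 2 / beta <=
  C * (dot p (e k) ^+ 2 + energy (U t) k + energy (dU t) k).
Proof.
have [K K0 hK] := source_bound hmu2.
have [B hB] := solution_bound hdot he hmu1 hmu2 hC1 T.
have l00 := lam_gt0 0%N.
have [Mb hMb] := C2_halfline_bounded (B / lam 0%N) hM.
exists (3 * (1 + Mb ^+ 2) / (beta * lam 0%N) + nu ^+ 2 * K / beta).
  have b1 : 0 <= 3 * (1 + Mb ^+ 2) by rewrite mulr_ge0// addr_ge0 ?sqr_ge0.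
  apply: addr_ge0; first exact: divr_ge0 b1 (ltW (mulr_gt0 hbeta l00)).
  exact: divr_ge0 (mulr_ge0 (sqr_ge0 nu) K0) (ltW hbeta).
move=> t tT k; have t0 : 0 <= t by case/andP: tT.
have [_ EG _ hh] := equations k t0.
have [E1 _ _ E4] := energy_parts he hmu1 hmu2 (U t) k.
have [_ E2 _ E5] := energy_parts he hmu1 hmu2 (dU t) k.
have lk := lam_gt0 k; have l0k := eigen_mono he k.
have eU := energy_ge0 he hmu1 hmu2 (U t) k; have edU := energy_ge0 he hmu1 hmu2 (dU t) k.
have pk := sqr_ge0 (dot p (e k)).
set m := M (`|Apow dot lam e 2^-1 (U t).1.1.1.1| ^+ 2) in EG.
have mM : m ^+ 2 <= Mb ^+ 2.
  have nb : `|Apow dot lam e 2^-1 (U t).1.1.1.1| ^+ 2 <= B / lam 0%N.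
    apply: (Fsp_bounded hdot he _).2 => n; rewrite ler_pdivlMr//.
    apply: le_trans (hB t tT n); rewrite mulr_suml; apply: ler_sum => j _.
    have [Ej _ _ _] := energy_parts he hmu1 hmu2 (U t) j; apply: le_trans Ej.
    rewrite exprMn (powR_half he) mulrAC; apply: ler_wpM2r; first exact: sqr_ge0.
    by rewrite expr2; apply: ler_wpM2l; [exact/ltW/lam_gt0|exact: (eigen_mono he)].
  have mb : `|m| <= Mb by apply: hMb; rewrite nb andbT exprn_ge0.
  by rewrite -[m ^+ 2]real_normK ?num_real// ler_pXn2r// nnegrE// (le_trans _ mb).
have three (a b c : R) : (a - b - c) ^+ 2 <= 3 * (a ^+ 2 + b ^+ 2 + c ^+ 2).
  have := sqr_ge0 (a + b); have := sqr_ge0 (a + c); have := sqr_ge0 (b - c); nra.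
have G2 : G t k ^+ 2 <=
    3 * (1 + Mb ^+ 2) * (dot p (e k) ^+ 2 + energy (U t) k + energy (dU t) k).
  have h1 : G t k ^+ 2 <= 3 * (dot p (e k) ^+ 2 + dot (dU t).1.1.1.2 (e k) ^+ 2 +
      m ^+ 2 * (lam k ^+ 2 * u t k ^+ 2)).
    rewrite /G EG -/(u t k).
    set a := dot p _; set b := dot _.1.1.1.2 _; set c := m * _.
    have -> : m ^+ 2 * (lam k ^+ 2 * u t k ^+ 2) = c ^+ 2 by rewrite /c; ring.
    exact: three.
  apply: le_trans h1 _; rewrite -mulrA; apply: ler_wpM2l => //.
  have h2 : m ^+ 2 * (lam k ^+ 2 * u t k ^+ 2) <= Mb ^+ 2 * energy (U t) k.
    by apply: ler_pM => //; rewrite ?sqr_ge0// mulr_ge0 ?sqr_ge0.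
  have := mulr_ge0 (sqr_ge0 Mb) pk; have := mulr_ge0 (sqr_ge0 Mb) edU; lra.
have v2 : lam k * v t k ^+ 2 <=
    K * (dot p (e k) ^+ 2 + energy (U t) k + energy (dU t) k).
  have := hK _ _ _ (modalU t0 k).2 (modaldU t0 k).2 hh.
  move=> /(ler_wpM2l (ltW lk)) /le_trans; apply; rewrite mulrCA.
  apply: ler_wpM2l => //; rewrite mulrDr; lra.
rewrite mulrDl; apply: lerD.
  rewrite -[leRHS]mulrA [X in _ <= _ * X]mulrC mulrA; apply: ler_pM => //.
  - exact: sqr_ge0.
  - by rewrite invr_ge0 mulr_ge0 ?ltW.
  - by rewrite lef_pV2 ?posrE ?mulr_gt0// ler_pM2l.
have -> : nu ^+ 2 * lam k * v t k ^+ 2 / beta = nu ^+ 2 / beta * (lam k * v t k ^+ 2) by ring.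
rewrite (mulrAC _ K) -[leRHS]mulrA; apply: ler_wpM2l => //.
by apply: divr_ge0; [exact: sqr_ge0|exact: ltW].
Qed.

Lemma displacement_tails (T eps : R) : 0 < eps ->
  exists N, forall t, 0 <= t <= T -> forall m n, (N <= m)%N ->
    \sum_(m <= k < n) lam k ^+ 3 * dot (U t).1.1.1.1 (e k) ^+ 2 <= eps.
Proof.
move=> eps0; have [C C0 hC] := forcing_bound T.
have C10 : 0 < 1 + 3 * C by rewrite ltr_pwDl// mulr_ge0.
(* [1 / 4] from the initial history and [3 * C] from the three forcing tails *)
have [e1 e10 e1E] : exists2 e1, 0 < e1 & (1 + 3 * C) * e1 = beta / 2 * eps.
  exists (beta / 2 * eps / (1 + 3 * C)); first by rewrite divr_gt0 ?mulr_gt0// divr_gt0.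
  by rewrite mulrCA mulfV ?mulr1// gt_eqF.
have [B hB] := initial_history.
have q0 k : 0 <= lam k ^+ 3 * sqint mu1 (fun s => u 0 k - y 0 k s).
  by rewrite mulr_ge0 ?(sqint_ge0 hmu1)// exprn_ge0// ltW.
have [N1 hN1] := bounded_sum_tail q0 hB e10.
have [N2 hN2] := bounded_sum_tail (fun k => sqr_ge0 (dot p (e k)))
  (fun n => bessel hdot he p 0 n) e10.
have [N3 hN3] := solution_tails hdot he hmu1 hmu2 hC1 T e10.
have [N4 hN4] := derivative_tails hdot he hmu1 hmu2 hC1 T e10.
exists (maxn (maxn N1 N2) (maxn N3 N4)) => t tT m n.
rewrite !geq_max => /andP[/andP[n1 n2] /andP[n3 n4]].
have hphi s : 0 <= s <= T ->
    \sum_(m <= k < n) (G s k ^+ 2 / (beta * lam k) + nu ^+ 2 * lam k * v s k ^+ 2 / beta)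
    <= C * (3 * e1).
  move=> sT; apply: le_trans (ler_sum _ (fun k _ => hC s sT k)) _.
  rewrite -mulr_sumr; apply: ler_wpM2l => //; rewrite 2!big_split/=.
  by have := hN2 m n n2; have := hN3 s sT m n n3; have := hN4 s sT m n n4; lra.
have := volterra_estimate hmu1 hbeta lam_gt0 (fun t k => @hy k t) hrep hcu hG hphi tT.
move=> h; have e2 : beta / 2 * \sum_(m <= k < n) lam k ^+ 3 * u t k ^+ 2 <= beta / 2 * eps.
  apply: le_trans h _; have := hN1 m n n1 => h1.
  rewrite -e1E; lra.
by rewrite ler_pM2l ?divr_gt0// in e2.
Qed.

Lemma displacement_Fsp (t : R) : 0 <= t -> Fsp dot lam e (3 / 2) (U t).1.1.1.1.
Proof.
move=> t0; have [N hN] := displacement_tails t ltr01.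
apply: (Fsp_bounded hdot he (B := \sum_(0 <= k < N) lam k ^+ 3 * u t k ^+ 2 + 1) _).1 => n.
under eq_bigr do rewrite exprMn (powR_three_halves he).
have tt : 0 <= t <= t by rewrite t0 lexx.
have pos k : 0 <= lam k ^+ 3 * u t k ^+ 2.
  by rewrite mulr_ge0 ?sqr_ge0// exprn_ge0// ltW.
apply: (@le_trans _ _ (\sum_(0 <= k < N + n) lam k ^+ 3 * u t k ^+ 2)).
  rewrite [leRHS](big_cat_nat _ (leq_addl N n))//= lerDl sumr_ge0// => k _; exact: pos.
by rewrite (big_cat_nat _ (leq_addr n N))//= lerD2l; exact: hN.
Qed.

(** Finitely many continuous modes, and a tail that is small at all times. *)
Lemma displacement_continuous_F :
  continuous_F dot lam e (3 / 2) (fun t => comp_u (U t)).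
Proof.
move=> t t0; split; first exact: displacement_Fsp.
suff small (eps : R) : 0 < eps -> \forall t' \near t, 0 <= t' ->
    (Fnorm dot lam e (3 / 2) (comp_u (U t') - comp_u (U t))%R <= eps%:E)%E.
  apply/fine_cvgP; split.
    rewrite near_withinE; apply: filterS (small 1 ltr01) => t' h /= t'0.
    rewrite ge0_fin_numE ?Fnorm_ge0//.
    by apply: le_lt_trans (h t'0) _; rewrite ltry.
  apply/cvgrPdist_le => eps eps0; rewrite near_withinE.
  apply: filterS (small eps eps0) => t' h t'0; have := h t'0 => {h}.
  rewrite /= sub0r normrN; have := Fnorm_ge0 dot lam e (3 / 2) (comp_u (U t') - comp_u (U t)).
  by case: (Fnorm _ _ _ _ _) => [r| |]//=; rewrite !lee_fin => r0 h; rewrite ger0_norm.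
move=> eps0; have e20 : 0 < eps ^+ 2 / 8 by rewrite divr_gt0// exprn_gt0.
have [N hN] := displacement_tails (t + 1) e20.
have tT : 0 <= t <= t + 1 by apply/andP; split; lra.
have low j (d : R) : 0 < d -> \forall t' \near t, 0 <= t' ->
    \sum_(0 <= k < j) lam k ^+ 3 * (u t' k - u t k) ^+ 2 <= d.
  elim: j d => [|j IH] d d0.
    by near=> t' => _; rewrite big_geq// ltW.
  have d2 : 0 < d / 2 by rewrite divr_gt0.
  have l3 : 0 < lam j ^+ 3 by rewrite exprn_gt0.
  have s0 : 0 < Num.sqrt (d / 2 / lam j ^+ 3) by rewrite sqrtr_gt0 divr_gt0.
  apply: filterS2 (IH _ d2) (displacement_near (huw j) t0 s0) => t' h1 h2 t'0.
  rewrite big_nat_recr//= [d]splitr; apply: lerD; first exact: h1.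
  rewrite mulrC -ler_pdivlMr// -[X in X <= _]real_normK ?num_real//.
  have := h2 t'0; rewrite -(@ler_pXn2r _ 2) ?nnegrE ?sqrtr_ge0//.
  by rewrite sqr_sqrtr// ltW// divr_gt0.
have e2 : 0 < eps ^+ 2 / 2 by rewrite divr_gt0// exprn_gt0.
have near1 : \forall t' \near t, t' < t + 1 by apply: lt_nbhsl; lra.
apply: filterS2 (low N _ e2) near1 => t' h1 t'T t'0.
have t'T' : 0 <= t' <= t + 1 by rewrite t'0 ltW.
have bound n : \sum_(0 <= k < n)
    (lam k `^ (3 / 2) * dot (comp_u (U t') - comp_u (U t)) (e k)) ^+ 2 <= eps ^+ 2.
  rewrite (eq_bigr (fun k => lam k ^+ 3 * (u t' k - u t k) ^+ 2)); last first.
    by move=> k _; rewrite exprMn (powR_three_halves he) (dotBl hdot).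
  have pos k : 0 <= lam k ^+ 3 * (u t' k - u t k) ^+ 2.
    by rewrite mulr_ge0 ?sqr_ge0// exprn_ge0// ltW.
  apply: (@le_trans _ _ (\sum_(0 <= k < N + n) lam k ^+ 3 * (u t' k - u t k) ^+ 2)).
    rewrite [leRHS](big_cat_nat _ (leq_addl N n))//= lerDl sumr_ge0// => k _; exact: pos.
  rewrite (big_cat_nat _ (leq_addr n N))//=.
  have h2 : \sum_(N <= k < N + n) lam k ^+ 3 * (u t' k - u t k) ^+ 2 <=
     2 * \sum_(N <= k < N + n) lam k ^+ 3 * u t' k ^+ 2 +
     2 * \sum_(N <= k < N + n) lam k ^+ 3 * u t k ^+ 2.
    rewrite !mulr_sumr -big_split/=; apply: ler_sum => k _.
    have := mulr_ge0 (exprn_ge0 3 (ltW (lam_gt0 k))) (sqr_ge0 (u t' k + u t k)); lra.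
  have := hN t' t'T' N (N + n)%N (leqnn N); have := hN t tT N (N + n)%N (leqnn N).
  by have := h1 t'0; lra.
have [hF hn] := Fsp_bounded hdot he bound.
rewrite /Fnorm; case: ifPn => [_|/asboolP//]; rewrite lee_fin.
by rewrite -(@ler_pXn2r _ 2) ?nnegrE// ltW.
Unshelve. all: by end_near. Qed.

End Regularity.

(** * Square-integrable functions on a plane domain *)

Section PlaneMeasure.
Context {R : realType}.
Local Notation plane := (R * R)%type.
Local Notation leb := (@lebesgue_measure R).

#[global] Instance area_ae_filter : Filter (almost_everywhere (@area R)).
Proof. exact: ae_filter_ringOfSetsType. Qed.

Lemma ball_planeP (x y : plane) (d : R) :
  `|x.1 - y.1| < d -> `|x.2 - y.2| < d -> ball x d y.
Proof. by move=> h1 h2; split. Qed.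

(** Rational boxes form a countable basis, so that the product sigma-algebra
    contains the open sets. *)
Lemma open_measurable_plane (O : set plane) : open O -> measurable O.
Proof.
move=> oO; pose box (q : rat * rat * (rat * rat)) : set plane :=
  `]ratr q.1.1, ratr q.1.2[%classic `*` `]ratr q.2.1, ratr q.2.2[%classic.
pose F q := if pselect (box q `<=` O) then box q else set0.
suff -> : O = \bigcup_q F q.
  apply: countable_bigcupT_measurable; first exact: countableP.
  move=> q; rewrite /F; case: pselect => sub; last exact: measurable0.
  by apply: measurableX; exact: measurable_itv.
apply/seteqP; split => [x Ox|x [q _]]; last first.
  by rewrite /F; case: pselect => // sub; exact: sub.
have /nbhs_ballP[d /= d0 sub] : nbhs x O by exact: open_nbhs_nbhs.
have rat_below (c : R) : exists q : rat, c - d < ratr q < c.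
  have /rat_in_itvoo[q] : c - d < c by lra.
  by rewrite in_itv/= => h; exists q.
have rat_above (c : R) : exists q : rat, c < ratr q < c + d.
  have /rat_in_itvoo[q] : c < c + d by lra.
  by rewrite in_itv/= => h; exists q.
have [a1 /andP[a1l a1r]] := rat_below x.1; have [b1 /andP[b1l b1r]] := rat_above x.1.
have [a2 /andP[a2l a2r]] := rat_below x.2; have [b2 /andP[b2l b2r]] := rat_above x.2.
exists ((a1, b1), (a2, b2)) => //; rewrite /F; case: pselect => [sub'|[]].
  by split; rewrite /= in_itv/=; apply/andP.
move=> y [/=]; rewrite !in_itv/= => /andP[y1 y2] /andP[y3 y4].
by apply: sub; apply: ball_planeP; rewrite ltr_norml; apply/andP; split; lra.
Qed.

Lemma continuous_measurable_plane (f : plane -> R) (D : set plane) :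
  continuous f -> measurable D -> measurable_fun D f.
Proof.
move=> /continuousP cf mD.
apply: (measurability (RGenOpens.G (R:=R))); first exact: RGenOpens.measurableE.
move=> _ [_ [a [b ->]] <-]; apply: measurableI => //.
by apply: open_measurable_plane; apply: cf; exact: interval_open.
Qed.

Variable Omega : set plane.
Hypothesis hOmega : bounded_domain Omega.

Lemma domain_measurable : measurable Omega.
Proof. by apply: open_measurable_plane; case: hOmega. Qed.

Lemma domain_area : (area Omega < +oo)%E.
Proof.
case: hOmega => _ _ _ [B [_ hB]].
set C := Num.max (B + 1) 1; have BC : B < C by rewrite lt_max; apply/orP; left; lra.
have C0 : 0 < C by rewrite lt_max ltr01 orbT.
have sub : Omega `<=` `[- C, C]%classic `*` `[- C, C]%classic.
  move=> x Ox; have : `|x| <= C by exact: hB.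
  rewrite prod_normE ge_max !ler_norml => /andP[h1 h2].
  by split; rewrite /= in_itv/=.
have mC : measurable (`[- C, C]%classic `*` `[- C, C]%classic : set plane).
  by apply: measurableX; exact: measurable_itv.
apply: (@le_lt_trans _ _ (area (`[- C, C]%classic `*` `[- C, C]%classic))).
  by apply: le_measure; rewrite ?inE//; exact: domain_measurable.
rewrite /area product_measure1E//= !lebesgue_measure_itv/= lte_fin.
by case: ifP => _; rewrite ?mule0 ?ltry// -EFinD -EFinM ltry.
Qed.

Lemma smooth_pd i (phi : plane -> R) : smooth phi -> smooth (pd i phi).
Proof. by move=> h s x; have := h (rcons s i) x; rewrite foldr_rcons. Qed.

Lemma test_fun_pd i (phi : plane -> R) :
  test_fun Omega phi -> test_fun Omega (pd i phi).
Proof.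
move=> [sphi [K [cK KO phi0]]]; split; first exact: smooth_pd.
exists K; split => // x Kx; rewrite /pd.
have cl : closed K by apply: compact_closed => //; exact: norm_hausdorff.
have := @near_eq_derive _ _ _ phi (cst 0) x (if i then (0, 1) else (1, 0)).
rewrite derive_cst; apply.
have : nbhs x (~` K) by apply: open_nbhs_nbhs; split => //; exact: closed_openC.
by apply: filterS => z; exact: phi0.
Qed.

Lemma test_fun_continuous (phi : plane -> R) : test_fun Omega phi -> continuous phi.
Proof. by move=> [h _] x; apply: differentiable_continuous; exact: (h [::] x). Qed.

Lemma test_fun_L2 (phi : plane -> R) : test_fun Omega phi -> L2 Omega phi.
Proof.
move=> tphi; have cphi := test_fun_continuous tphi.
have mO := domain_measurable.
have mphi : measurable_fun Omega phi by exact: continuous_measurable_plane.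
split => //; case: tphi => _ [K [cK KO phi0]].
have /compact_bounded[B [_ hB]] : compact (phi @` K).
  by apply: continuous_compact => //; exact: continuous_subspaceT.
set C := Num.max (B + 1) 1; have BC : B < C by rewrite lt_max; apply/orP; left; lra.
have C0 : 0 < C by rewrite lt_max ltr01 orbT.
have phiC x : `|phi x| <= C.
  have [Kx|Kx] := pselect (K x); last by rewrite phi0// normr0 ltW.
  by apply: hB => //; exists x.
rewrite /L2norm2; apply: (@le_lt_trans _ _ (\int[area]_(x in Omega) (cst (C ^+ 2)%:E x))%E).
  apply: le_integralT => x _; first by rewrite lee_fin sqr_ge0.
  rewrite lee_fin -[phi x ^+ 2]real_normK ?num_real// ler_pXn2r// nnegrE//.
  exact: ltW.
rewrite integral_cst//; apply: lte_mul_pinfty => //; last exact: domain_area.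
by rewrite lee_fin sqr_ge0.
Qed.

End PlaneMeasure.

(** * Weak gradients on the form domain of the Dirichlet Laplacian *)

Section WeakGradient.
Context {R : realType} {H : completeNormedModType R}.
Local Notation plane := (R * R)%type.
Variable Omega : set plane.
Hypothesis hOmega : bounded_domain Omega.
Variables (dot : H -> H -> R) (iota : H -> plane -> R).
Hypothesis hdot : hilbert_dot dot.
Hypothesis hL2 : is_L2_space Omega dot iota.

Let mO : measurable Omega := domain_measurable hOmega.

Definition represents (f : plane -> R) (h : H) : Prop :=
  L2 Omega f /\ {ae area, forall x, Omega x -> iota h x = f x}.

Lemma represents_iota h : represents (iota h) h.
Proof. by case: hL2 => h1 _ _ _; split; [exact: h1|near=> x]. Unshelve. all: by end_near. Qed.

Lemma represents_exists f : L2 Omega f -> exists h, represents f h.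
Proof. by case: hL2 => _ _ _ h4 Lf; have [h hh] := h4 f Lf; exists h. Qed.

Lemma represents_dot f g h k : represents f h -> represents g k ->
  \int[area]_(x in Omega) (f x * g x) = dot h k.
Proof.
move=> [[mf _] fh] [[mg _] gk]; case: hL2 => hL _ <- _.
apply: ae_eq_Rintegral => //.
- exact: measurable_funM.
- by apply: measurable_funM; [case: (hL h)|case: (hL k)].
- by apply: filterS2 fh gk => x h1 h2 Ox; rewrite h1// h2.
Qed.

Lemma represents_norm f h : represents f h -> L2norm2 Omega f = (`|h| ^+ 2)%:E.
Proof.
move=> [[mf fi] fh]; rewrite -(dotxx hdot) -(represents_dot (conj (conj mf fi) fh) (conj (conj mf fi) fh)).
rewrite /L2norm2 /Rintegral fineK//.
rewrite ge0_fin_numE//; last by apply: integral_ge0 => x _; rewrite lee_fin -expr2 sqr_ge0.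
Qed.

Lemma represents_lin a f g h k : represents f h -> represents g k ->
  represents (fun x => a * f x + g x) (a *: h + k).
Proof.
move=> [[mf _] fh] [[mg _] gk]; case: hL2 => hL hlin _ _.
have m : measurable_fun Omega (fun x => a * f x + g x).
  by apply: measurable_funD => //; exact: measurable_funM.
have E : {ae area, forall x, Omega x -> iota (a *: h + k) x = a * f x + g x}.
  apply: filterS3 (hlin a h k) fh gk => x h1 h2 h3 Ox.
  by rewrite h1// h2// h3.
split => //; split => //; have [mi Li] := hL (a *: h + k).
apply: le_lt_trans Li; rewrite le_eqVlt; apply/orP; left; apply/eqP.
apply: ae_eq_integral => //.
- by apply/measurable_EFinP; exact: measurable_funX.
- by apply/measurable_EFinP; exact: measurable_funX.
- by apply: filterS E => x h1 Ox; rewrite h1.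
Qed.

Lemma represents_opp f h : represents f h -> represents (fun x => - f x) (- h).
Proof.
move=> rf; have := represents_lin (- 2) rf rf.
have -> : - 2 *: h + h = - h by rewrite -[X in _ + X = _]scale1r -scalerDl -[RHS]scaleN1r; congr (_ *: _); ring.
by congr represents; apply/funext => x; ring.
Qed.

Lemma represents_dist f g h k : represents f h -> represents g k ->
  L2norm2 Omega (f \- g) = (`|h - k| ^+ 2)%:E.
Proof.
move=> fh gk; have := represents_norm (represents_lin (-1) gk fh).
rewrite scaleN1r (addrC _ h) => <-; congr L2norm2.
by apply/funext => x /=; ring.
Qed.

Lemma represents_test phi : test_fun Omega phi -> exists h, represents phi h.
Proof. by move=> tp; apply: represents_exists; exact: test_fun_L2. Qed.

(** [h] belongs to [H^1_0] with weak gradient [G].  Both are vectors of the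
    Hilbert space [L^2(Omega)], so that limits are taken there and not among
    functions on the plane. *)
Definition H10_gradient (h : H) (G : bool -> H) : Prop :=
  (forall phi Phi P i, test_fun Omega phi -> represents phi Phi ->
     represents (pd i phi) P -> dot h P = - dot (G i) Phi) /\
  (forall eps : R, 0 < eps -> exists phi Phi P,
     [/\ test_fun Omega phi, represents phi Phi,
         forall i, represents (pd i phi) (P i), `|Phi - h| <= eps
       & forall i, `|P i - G i| <= eps]).

Lemma H10_gradient_exists h : H10 Omega (iota h) -> exists G, H10_gradient h G.
Proof.
move=> [phi [tphi [_ phih hg]]].
have {hg} : forall i, exists Gi : H, (weak_pd Omega i (iota h) (iota Gi)) /\
    L2norm2 Omega (pd i (phi n) \- iota Gi) @[n --> \oo] --> 0%E.
  move=> i; have [g [Lg wg cg]] := hg i; have [Gi [_ aeG]] := represents_exists Lg.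
  have mg := Lg.1; have mGi := (represents_iota Gi).1.1.
  exists Gi; split.
    move=> psi tpsi; rewrite (wg psi tpsi); congr (- _).
    have mpsi := (test_fun_L2 hOmega tpsi).1.
    apply: ae_eq_Rintegral => //; [exact: measurable_funM|exact: measurable_funM|].
    by apply: filterS aeG => x h1 Ox; rewrite h1.
  suff -> : (fun n => L2norm2 Omega (pd i (phi n) \- iota Gi)) =
     (fun n => L2norm2 Omega (pd i (phi n) \- g)) by [].
  apply/funext => n; have mp := (test_fun_L2 hOmega (test_fun_pd i (tphi n))).1.
  apply: ae_eq_integral => //.
  - apply/measurable_EFinP; apply: measurable_funX; exact: measurable_funB.
  - apply/measurable_EFinP; apply: measurable_funX; exact: measurable_funB.
  - by apply: filterS aeG => x h1 Ox; rewrite /= h1.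
move=> /choice[G hG]; exists G; split.
  move=> psi Psi P i tpsi rpsi rP; have [wG _] := hG i.
  by rewrite -(represents_dot (represents_iota h) rP)
    -(represents_dot (represents_iota (G i)) rpsi) wG.
move=> eps eps0; have e20 : 0 < eps ^+ 2 by rewrite exprn_gt0.
have close (f : nat -> plane -> R) (k : H) : (forall n, L2 Omega (f n)) ->
    L2norm2 Omega (f n \- iota k) @[n --> \oo] --> 0%E ->
    \forall n \near \oo, forall F, represents (f n) F -> `|F - k| <= eps.
  move=> Lf /fine_cvgP[_ /cvgrPdist_le /(_ _ e20)].
  apply: filterS => n + F rF; rewrite /= (represents_dist rF (represents_iota k))/=.
  by rewrite sub0r normrN ger0_norm ?sqr_ge0// ler_pXn2r// nnegrE// ltW.
have Lphi n : L2 Omega (phi n) := test_fun_L2 hOmega (tphi n).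
have Lpd i n : L2 Omega (pd i (phi n)) := test_fun_L2 hOmega (test_fun_pd i (tphi n)).
have c0 := close _ _ Lphi phih.
have c1 := close _ _ (Lpd false) (hG false).2.
have c2 := close _ _ (Lpd true) (hG true).2.
have [n [h0 [h1 h2]]] : exists n, (forall F, represents (phi n) F -> `|F - h| <= eps) /\
  (forall F, represents (pd false (phi n)) F -> `|F - G false| <= eps) /\
  (forall F, represents (pd true (phi n)) F -> `|F - G true| <= eps).
  have [N _ hN] := filterI c0 (filterI c1 c2).
  by exists N; have [? [? ?]] := hN N (leqnn N).
have [Phi rPhi] := represents_exists (Lphi n).
have /choice[P rP] : forall i, exists P, represents (pd i (phi n)) P.
  by move=> i; exact: represents_exists.
exists (phi n), Phi, P; split => //; first exact: h0.
by case; [apply: h2|apply: h1]; exact: rP.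
Qed.

Lemma H10_gradient_closed (hn : nat -> H) (Gn : nat -> bool -> H) h G :
  (forall n, H10_gradient (hn n) (Gn n)) -> hn @ \oo --> h ->
  (forall i, (fun n => Gn n i) @ \oo --> G i) -> H10_gradient h G.
Proof.
move=> hG ch cG; split.
  move=> phi Phi P i tphi rphi rP.
  have c1 : dot (hn n) P @[n --> \oo] --> dot h P by apply: (cvg_dotl hdot).
  have c2 : - dot (Gn n i) Phi @[n --> \oo] --> - dot (G i) Phi.
    by apply: cvgN; apply: (cvg_dotl hdot); exact: cG.
  rewrite -(cvg_lim (@Rhausdorff R) c1) -(cvg_lim (@Rhausdorff R) c2).
  congr (limn _); apply/funext => n; have [hw _] := hG n; exact: hw rphi rP.
move=> eps eps0; have e2 : 0 < eps / 2 by rewrite divr_gt0.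
have [N [h0 [h1 h2]]] : exists N, `|h - hn N| <= eps / 2 /\
    (`|G false - Gn N false| <= eps / 2 /\ `|G true - Gn N true| <= eps / 2).
  have /cvgrPdist_le /(_ _ e2) c0 := ch.
  have /cvgrPdist_le /(_ _ e2) c1 := cG false.
  have /cvgrPdist_le /(_ _ e2) c2 := cG true.
  have [N _ hN] := filterI c0 (filterI c1 c2).
  by exists N; have [? [? ?]] := hN N (leqnn N).
have [_ /(_ _ e2) [phi [Phi [P [tphi rphi rP h3 h4]]]]] := hG N.
have tri (x y z : H) : `|x - y| <= eps / 2 -> `|z - y| <= eps / 2 -> `|x - z| <= eps.
  move=> hxy hzy; have -> : x - z = (x - y) - (z - y) by rewrite opprB addrA subrK.
  by apply: le_trans (ler_normB _ _) _; rewrite [eps]splitr lerD.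
exists phi, Phi, P; split => //; first exact: tri h3 h0.
by case; [exact: tri (h4 true) h2|exact: tri (h4 false) h1].
Qed.

(** One test function for each tolerance [1 / (n + 1)] gives the approximating
    sequence. *)
Lemma H10_gradient_cvg h G f : H10_gradient h G -> represents f h ->
  exists phi, (forall n, test_fun Omega (phi n)) /\ cvg_H1 Omega phi f.
Proof.
move=> [hw ha] rf.
have /choice[phi hphi] : forall n : nat, exists phi, exists Phi P,
     [/\ test_fun Omega phi, represents phi Phi,
         forall i, represents (pd i phi) (P i), `|Phi - h| <= n.+1%:R^-1
       & forall i, `|P i - G i| <= n.+1%:R^-1].
  by move=> n; apply: ha; rewrite invr_gt0.
have to0 (q : nat -> \bar R) :
    (forall n, exists2 r : R, 0 <= r <= n.+1%:R^-1 & q n = (r ^+ 2)%:E) ->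
    q n @[n --> \oo] --> 0%E.
  move=> hq; apply/fine_cvgP; split.
    by near=> n; have [r _ ->] := hq n.
  apply: (@squeeze_cvgr _ _ _ _ (cst 0) (fun n => n.+1%:R^-1)).
  - near=> n; have [r /andP[r0 r1] /= ->] := hq n; rewrite /= sqr_ge0/=.
    apply: le_trans (_ : r <= _) => //; rewrite expr2 ler_piMr//.
    by apply: le_trans r1 _; rewrite invf_le1// ler1n.
  - exact: cvg_cst.
  - exact: cvg_harmonic.
exists phi; split; first by move=> n; have [Phi [P []]] := hphi n.
split; first by case: rf.
  apply: to0 => n; have [Phi [P [_ rphi _ h1 _]]] := hphi n.
  by exists `|Phi - h|; [rewrite normr_ge0|exact: represents_dist].
move=> i; exists (iota (G i)); split; first by case: (represents_iota (G i)).
  move=> psi tpsi.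
  have [Psi rpsi] := represents_test tpsi.
  have [P rP] := represents_test (test_fun_pd i tpsi).
  rewrite (represents_dot rf rP) (represents_dot (represents_iota (G i)) rpsi).
  exact: hw rpsi rP.
apply: to0 => n; have [Phi [P [_ _ rP _ h1]]] := hphi n.
exists `|P i - G i|; first by rewrite normr_ge0 h1.
exact: represents_dist (rP i) (represents_iota (G i)).
Unshelve. all: by end_near. Qed.

Variables (DA : set H) (A : H -> H).
Hypothesis hlap : is_dirichlet_laplacian Omega iota DA A.

(** Green's formula.  The weak gradient of [h] tested against [pd i phi] gives
    the weak Laplacian, and test functions approximate [k] together with its
    gradient. *)
Lemma H10_gradient_green h k G K : DA h ->
  H10_gradient h G -> H10_gradient k K ->
  dot (G false) (K false) + dot (G true) (K true) = dot (A h) k.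
Proof.
move=> Dh [hw _] [_ ka].
have test phi Phi P : test_fun Omega phi -> represents phi Phi ->
    (forall i, represents (pd i phi) (P i)) ->
    dot (G false) (P false) + dot (G true) (P true) = dot (A h) Phi.
  move=> tphi rphi rP.
  have [Q0 rQ0] := represents_test (test_fun_pd false (test_fun_pd false tphi)).
  have [Q1 rQ1] := represents_test (test_fun_pd true (test_fun_pd true tphi)).
  have e0 := hw _ _ _ false (test_fun_pd false tphi) (rP false) rQ0.
  have e1 := hw _ _ _ true (test_fun_pd true tphi) (rP true) rQ1.
  have [_ /(_ h Dh phi tphi)] := hlap.
  have := represents_dot (represents_iota h) (represents_lin 1 rQ0 rQ1).
  rewrite scale1r (dotDr hdot) e0 e1.
  under eq_Rintegral do rewrite mul1r.
  move=> ->; rewrite (represents_dot (represents_opp (represents_iota (A h))) rphi).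
  by rewrite (dotNl hdot); lra.
apply/eqP; rewrite -subr_eq0 -normr_le0; apply/ler_addgt0Pr => eps eps0; rewrite add0r.
pose C := 1 + `|G false| + `|G true| + `|A h|.
have C0 : 0 < C by rewrite /C -!addrA ltr_pwDl// !addr_ge0.
have [phi [Phi [P [tphi rphi rP h1 h2]]]] := ka (eps / C) (divr_gt0 eps0 C0).
have -> : dot (G false) (K false) + dot (G true) (K true) - dot (A h) k =
    dot (A h) (Phi - k) - dot (G false) (P false - K false)
    - dot (G true) (P true - K true).
  by rewrite !(dotBr hdot) -(test phi Phi P tphi rphi rP); ring.
have b (x y : H) : `|y| <= eps / C -> `|dot x y| <= `|x| * (eps / C).
  by move=> hy; apply: le_trans (dot_CS hdot x y) _; exact: ler_wpM2l.
have b0 := b (A h) _ h1; have b1 := b (G false) _ (h2 false); have b2 := b (G true) _ (h2 true).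
apply: le_trans (ler_normB _ _) _; apply: le_trans (lerD (ler_normB _ _) (lexx _)) _.
have -> : eps = C * (eps / C) by rewrite mulrCA mulfV ?mulr1// gt_eqF.
have : 0 < eps / C by rewrite divr_gt0.
move: b0 b1 b2; rewrite /C; set q := eps / _; lra.
Qed.

End WeakGradient.

(** * The trace of the Laplacian *)

Import HBNNSimple.

Section SetFunction.
Context {d} {T : measurableType d} {R : realType}.

Let sintegral_null (mu : set T -> \bar R) : mu set0 = 0%E -> sintegral mu (fun _ : T => 0 : R) = 0%E.
Proof.
move=> mu0; rewrite /sintegral fsbig1// => r _.
have [->|r0] := eqVneq r 0; first by rewrite mul0e.
rewrite (_ : _ @^-1` _ = set0) ?mu0 ?mule0//.
by apply/seteqP; split => // x /= /esym/eqP; rewrite (negbTE r0).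
Qed.

(** Arc length [hausdorff1] is a function of all subsets of the plane and not a
    measure; the integral of zero only involves its value at the empty set. *)
Lemma integral_null_function (mu : set T -> \bar R) (D : set T) (f : T -> \bar R) :
  mu set0 = 0%E -> (forall x, D x -> f x = 0%E) -> (\int[mu]_(x in D) f x)%E = 0%E.
Proof.
move=> mu0 f0; rewrite /integral.
have -> : (fun x => f x) \_ D = cst 0%E.
  by apply/funext => x; rewrite patchE; case: ifPn => // /[1!inE] /f0.
have Ep : (cst 0%E : T -> \bar R)^\+%E = cst 0%E.
  by apply/funext => x; rewrite funeposE maxxx.
have En : (cst 0%E : T -> \bar R)^\-%E = cst 0%E.
  by apply/funext => x; rewrite funenegE oppe0 maxxx.
have S0 : ereal_sup [set sintegral mu h |
    h in [set h : {nnsfun T >-> R} | forall x, ((h x)%:E <= cst 0%E x)%E]] = 0%E.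
  apply/eqP; rewrite eq_le; apply/andP; split; last first.
    apply: ereal_sup_ubound; exists nnsfun0 => //.
    by rewrite -[RHS](sintegral_null mu0); congr sintegral.
  apply: ge_ereal_sup => _ [h h0 <-].
  rewrite -(sintegral_null mu0) (_ : (h : T -> R) = fun=> 0)//.
  apply/funext => x; apply/eqP; rewrite eq_le; apply/andP; split => //.
  by rewrite -lee_fin; exact: h0.
by rewrite Ep En [X in (X - X)%E]S0 sube0.
Qed.

Lemma hausdorff1_set0 : @hausdorff1 R set0 = 0%E.
Proof.
have diam0 : @diam R set0 = 0%E.
  apply/eqP; rewrite eq_le; apply/andP; split.
    by apply: ge_ereal_sup => q [/= ->//|[x [y [xs _ _]]]].
  by apply: ereal_sup_ubound; left.
have diam_ge0 S : (0 <= @diam R S)%E by apply: ereal_sup_ubound; left.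
rewrite /hausdorff1 [X in ereal_sup X](_ : _ = [set 0%E]) ?ereal_sup1//.
apply/seteqP; split => [_ [r /= r0 <-]|_ ->].
  apply/eqP; rewrite eq_le; apply/andP; split.
    apply: ereal_inf_lbound; exists (fun=> set0); last by rewrite eseries0.
    by split => // k; rewrite diam0 lee_fin ltW.
  by apply: le_ereal_inf_tmp => _ [F _ <-]; apply: nneseries_ge0.
exists 1 => //=.
apply/eqP; rewrite eq_le; apply/andP; split.
  apply: ereal_inf_lbound; exists (fun=> set0); last by rewrite eseries0.
  by split => // k; rewrite diam0 lee_fin.
by apply: le_ereal_inf_tmp => _ [F _ <-]; apply: nneseries_ge0.
Qed.

End SetFunction.

Section Trace.
Context {R : realType} {H : completeNormedModType R}.
Variables (dot : H -> H -> R) (DA : set H) (A : H -> H) (lam : R^nat) (e : nat -> H).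
Hypothesis hdot : hilbert_dot dot.
Hypothesis hA : positive_selfadjoint dot DA A.
Hypothesis he : orthonormal_eigenbasis dot DA A lam e.
Variables (Omega : set (R * R)) (iota : H -> R * R -> R).
Hypothesis hOmega : bounded_domain Omega.
Hypothesis hL2 : is_L2_space Omega dot iota.
Hypothesis hlap : is_dirichlet_laplacian Omega iota DA A.

Let partial (h : H) n := \sum_(0 <= k < n) dot h (e k) *: e k.

Let partial_dom h n : DA (partial h n).
Proof.
rewrite /partial; case: hA => D0 Dlin _ _ _.
elim: n => [|n IH]; first by rewrite big_geq.
rewrite big_nat_recr//= addrC; apply: (Dlin _ _ _ _ IH).1.
by have [] := eigen_dom he n.
Qed.

Let partial_form h m n : (m <= n)%N ->
  dot (A (partial h n)) (partial h m) = \sum_(0 <= k < m) lam k * dot h (e k) ^+ 2.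
Proof.
move=> mn; rewrite (dotC hdot) (dot_suml hdot) big_seq [RHS]big_seq; apply: eq_bigr => k.
rewrite mem_index_iota => /andP[_ km].
rewrite (dotZl hdot) [dot (e k) _](dotC hdot) (coef_A hdot he hA k (partial_dom h n)).
rewrite (dot_sum_e hdot (eigen_orthonormal he)) leq0n (leq_trans km mn)/=; ring.
Qed.

(** The partial sums of the eigenfunction expansion of [h] are Cauchy for the
    Dirichlet form, hence their gradients converge. *)
Lemma form_domain_gradient h : Fsp dot lam e 2^-1 h ->
  exists G, H10_gradient Omega dot iota h G.
Proof.
move=> hh; case: (hlap) => hDA _.
have /choice[Gn hGn] n : exists G, H10_gradient Omega dot iota (partial h n) G.
  apply: (H10_gradient_exists hOmega hdot hL2).
  by have [/(_ (partial_dom h n))[]] := hDA (partial h n).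
have [Q QE] : exists Q : nat -> R, Q = fun n => \sum_(0 <= k < n) lam k * dot h (e k) ^+ 2.
  by eexists.
have cQ : cvgn Q.
  have /(FspP hdot he) := hh; rewrite QE.
  rewrite (_ : (fun k => _ ^+ 2) = fun k => lam k * dot h (e k) ^+ 2)//.
  by apply/funext => k; rewrite exprMn (powR_half he).
have form m n : (m <= n)%N -> dot (A (partial h n)) (partial h m) = Q m.
  by move=> mn; rewrite QE partial_form.
have dist m n : (m <= n)%N -> `|Gn n false - Gn m false| ^+ 2 + `|Gn n true - Gn m true| ^+ 2 = Q n - Q m.
  move=> mn; rewrite !(normB_sq hdot) -!(dotxx hdot).
  have e1 := H10_gradient_green hOmega hdot hL2 hlap (partial_dom h n) (hGn n) (hGn n).
  have e2 := H10_gradient_green hOmega hdot hL2 hlap (partial_dom h n) (hGn n) (hGn m).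
  have e3 := H10_gradient_green hOmega hdot hL2 hlap (partial_dom h m) (hGn m) (hGn m).
  move: e1 e2 e3; rewrite !form//; lra.
have cG i : cvgn (fun n => Gn n i).
  apply/cauchy_cvgP/cauchy_exP => eps eps0.
  have e20 : 0 < eps ^+ 2 by rewrite exprn_gt0.
  have e80 : 0 < eps ^+ 2 / 2 by rewrite divr_gt0.
  have /cvgrPdist_lt /(_ _ e80) [N _ hN] := cQ.
  have near_gap m n : (N <= m)%N -> (m <= n)%N -> `|Gn n i - Gn m i| < eps.
    move=> Nm mn; have d := dist m n mn.
    have hm := hN m Nm; have hn := hN n (leq_trans Nm mn).
    have gap : Q n - Q m < eps ^+ 2.
      by move: hm hn; rewrite /= !ltr_norml => /andP[? ?] /andP[? ?]; lra.
    rewrite -(@ltr_pXn2r _ 2) ?nnegrE// ?ltW//; apply: le_lt_trans gap; rewrite -d.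
    by case: (i); rewrite ?lerDl ?lerDr sqr_ge0.
  exists (Gn N i), N => // n /= Nn; rewrite -ball_normE/= distrC.
  exact: near_gap.
exists (fun i => limn (fun n => Gn n i)).
apply: (H10_gradient_closed hdot hGn) => //.
exact: (@fourier_cvg _ _ _ _ _ _ _ he h).
Qed.

Let integral_boundary (phi : nat -> R * R -> R) n : test_fun Omega (phi n) ->
  (\int[@hausdorff1 R]_(x in bdry Omega) ((phi n x - cst 0 x) ^+ 2)%:E)%E = 0%E.
Proof.
move=> [_ [K [_ KO phi0]]]; apply: integral_null_function hausdorff1_set0 _ => x [_ xO].
rewrite phi0; first by rewrite subr0 expr2 mul0r.
by move=> /KO Ox; apply: xO; apply: open_nbhs_nbhs; split => //; case: hOmega.
Qed.

(** Elements of the form domain are limits of test functions, whose boundary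
    values are zero. *)
Lemma laplacian_trace u : Fsp dot lam e (3 / 2) u ->
  exists Delta_u, weak_laplacian Omega (iota u) Delta_u /\
    has_trace Omega Delta_u (cst 0).
Proof.
move=> hu; have hu1 : Fsp dot lam e 1 u by apply: (Fsp_le hdot he _ hu); lra.
have [Du Au] := domain_Fsp1 hdot he hA hu1.
exists (fun x => - iota (A u) x); split; first by case: hlap => _; apply.
have hAu : Fsp dot lam e 2^-1 (- A u).
  have := Fsp_partial_sum hdot he 0%N _ hu => hs.
  apply: (Fsp_bounded hdot he _).1 => n; apply: le_trans (hs n).
  apply: ler_sum => k _; rewrite (dotNl hdot) mulrN sqrrN !exprMn.
  rewrite (powR_half he) (powR_three_halves he) (coef_A hdot he hA k Du); lra.
have [G hG] := form_domain_gradient hAu.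
have rf := represents_opp hOmega hL2 (represents_iota hL2 (A u)).
have [phi [tphi cphi]] := H10_gradient_cvg hOmega hdot hL2 hG rf.
exists phi; split => //; first by move=> n; case: (tphi n).
rewrite (_ : (fun n => _) = cst 0%E); first exact: cvg_cst.
by apply/funext => n; exact: integral_boundary.
Qed.

End Trace.

Theorem proposition2p2 (R : realType) (H : completeNormedModType R)
  (dot : H -> H -> R) (DA : set H) (A : H -> H) (lam : R^nat) (e : nat -> H)
  (hdot : hilbert_dot dot)
  (hA : positive_selfadjoint dot DA A)
  (he : orthonormal_eigenbasis dot DA A lam e)
  (omega nu beta : R) (p : H) (M mu1 mu2 : R -> R) (delta1 delta2 a b : R)
  (homega : 0 <= omega < 1) (hnu : 0 < nu) (hbeta : 0 < beta)
  (hmu1 : memory_kernel mu1 delta1)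
  (hmu2 : memory_kernel mu2 delta2)
  (hM : C2_halfline M)
  (ha : 0 < a < lam 0%N)
  (hMab : forall z, 0 <= z ->
     - a * z - b <= \int[lebesgue_measure]_(xi in `[0, z]) M xi)
  (U0 : @state R H)
  (hU0 : domL dot lam e omega nu beta mu1 mu2 U0)
  (hu0 : Linfty_F dot lam e (3 / 2) (fun t => comp_u U0 - comp_etabar U0 t))
  (U : R -> @state R H)
  (hU : classical_solution dot lam e omega nu beta p M mu1 mu2 A U0 U) :
  continuous_F dot lam e (3 / 2) (fun t => comp_u (U t)) /\
  (forall (Omega : set (R * R)) (iota : H -> R * R -> R),
     bounded_domain Omega ->
     smooth_boundary Omega \/ rectangular_boundary Omega ->
     is_L2_space Omega dot iota ->
     is_dirichlet_laplacian Omega iota DA A ->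
     forall t, 0 <= t -> exists Delta_u : R * R -> R,
       weak_laplacian Omega (iota (comp_u (U t))) Delta_u /\
       has_trace Omega Delta_u (cst 0)).
Proof.
have [dU [hC1 hdom hevol hinit]] := hU.
split.
  exact: (displacement_continuous_F hdot hA he hbeta hmu1 hmu2 hM hU0 hu0 hC1 hdom hevol hinit).
move=> Omega iota hOmega _ hL2 hlap t t0.
apply: (laplacian_trace hdot hA he hOmega hL2 hlap).
exact: (displacement_Fsp hdot hA he hbeta hmu1 hmu2 hM hU0 hu0 hC1 hdom hevol hinit t0).
Qed.
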